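(* Let $\Phi$ be an irreducible root system of type $A_\ell$, $B_\ell$ or $C_\ell$ in $\mathbb{R}^\ell$, with a fixed positive system $\Phi^+$ and base $\Delta=\{\alpha_1,\dots,\alpha_\ell\}$, and let $\mathcal{I}\subseteq\Phi^+$ be an ideal. Then the toric arrangement $\mathscr{A}_{\mathcal{I}}$ (with respect to the root lattice) is inductive.
   Context: Order $\Phi^+$ by $\beta_1\ge\beta_2$ iff $\beta_1-\beta_2$ is a nonnegative integer combination of $\Delta$; an ideal is a subset $\mathcal{I}\subseteq\Phi^+$ with $\beta_1\ge\beta_2$, $\beta_1\in\mathcal{I}$, $\beta_2\in\Phi^+$ implying $\beta_2\in\mathcal{I}$. For $\beta=\sum_i s_i\alpha_i\in\mathcal{I}$ let $H_\beta=\{t\in(\mathbb{S}^1)^\ell : t_1^{s_1}\cdots t_\ell^{s_\ell}=1\}$; $\mathscr{A}_{\mathcal{I}}$ is the set of connected components of the $H_\beta$, $\beta\in\mathcal{I}$. More generally (abelian arrangements with $G=\mathbb{S}^1$): with $\Gamma\cong\mathbb{Z}^\ell$, $T=\operatorname{Hom}(\Gamma,\mathbb{S}^1)\cong(\mathbb{S}^1)^\ell$, and for $\alpha\in\Gamma\setminus\{0\}$, $c\in\mathbb{S}^1$, $H_{\alpha,c}=\{\varphi\in T:\varphi(\alpha)=c\}$, an arrangement is the set of connected components of $H_{\alpha,c}$ for $(\alpha,c)$ in a finite set; $\varnothing_\ell$ is the empty arrangement in $T$. Its poset of layers $L(\mathscr{A})$ consists of the connected components of nonempty intersections of subsets of $\mathscr{A}$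 (the empty intersection being $T$), ordered by reverse inclusion, with rank given by codimension. $\chi_{\mathscr{A}}(t)=\sum_{X\in L(\mathscr{A})}\mu(T,X)t^{\dim X}$. For $H\in\mathscr{A}$: deletion $\mathscr{A}'=\mathscr{A}\setminus\{H\}$ (in $T$), restriction $\mathscr{A}''=$ the set of connected components of nonempty $K\cap H$, $K\in\mathscr{A}'$, regarded as an arrangement in $H\cong(\mathbb{S}^1)^{\ell-1}$. The class of inductive arrangements is the smallest class such that $\varnothing_\ell$ is inductive for all $\ell\ge1$, and $\mathscr{A}$ is inductive whenever there exists $H\in\mathscr{A}$ with $\mathscr{A}''$, $\mathscr{A}'$ inductive and $\chi_{\mathscr{A}'}(t)=(t-d)\chi_{\mathscr{A}''}(t)$ for some $d\in\mathbb{Z}$.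
   Formalization: The empty arrangement is taken to be inductive also in the 0-dimensional torus (ℓ ≥ 0 instead of ℓ ≥ 1); otherwise type A_1 with the full ideal, a single point of the circle, would not be inductive. *)

(* Defs.v *)
From HB Require Import structures.
From mathcomp Require Import all_boot all_order all_algebra.
From mathcomp Require Import all_classical all_reals topology normedtype.
Set Implicit Arguments. Unset Strict Implicit. Unset Printing Implicit Defensive.
Import Order.TTheory GRing.Theory Num.Theory.
Import numFieldNormedType.Exports.
Local Open Scope classical_set_scope.
Local Open Scope ring_scope.

Inductive RType := TA | TB | TC.

Definition rank_ok (t : RType) (l : nat) : Prop :=
  match t with TA => (1 <= l)%N | TB => (2 <= l)%N | TC => (2 <= l)%N end.

Definition edim (t : RType) (l : nat) : nat :=
  match t with TA => l.+1 | TB => l | TC => l end.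

(* k-th standard basis vector e_k of Z^n (0 if k >= n) *)
Definition evec (n k : nat) : 'rV[int]_n := \row_(j < n) ((j == k :> nat) : int).

(* the simple roots alpha_1, ..., alpha_l (indexed from 0) *)
Definition simple_root (t : RType) (l : nat) (i : 'I_l) : 'rV[int]_(edim t l) :=
  match t as t' return 'rV[int]_(edim t' l) with
  | TA => evec _ i - evec _ i.+1
  | TB => if (i.+1 < l)%N then evec _ i - evec _ i.+1 else evec _ i
  | TC => if (i.+1 < l)%N then evec _ i - evec _ i.+1 else 2 *: evec _ i
  end.

Definition pos_root_eps (t : RType) (l : nat) (v : 'rV[int]_(edim t l)) : Prop :=
  (exists i j : nat, (i < j < edim t l)%N /\ v = evec _ i - evec _ j)
  \/ (t <> TA /\ exists i j : nat, (i < j < l)%N /\ v = evec _ i + evec _ j)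
  \/ (t = TB /\ exists i : nat, (i < l)%N /\ v = evec _ i)
  \/ (t = TC /\ exists i : nat, (i < l)%N /\ v = 2 *: evec _ i).

Definition root_of (t : RType) (l : nat) (s : 'I_l -> int) : 'rV[int]_(edim t l) :=
  \sum_(i < l) s i *: simple_root t i.

Definition PhiPlus (t : RType) (l : nat) : set ('I_l -> int) :=
  [set s | pos_root_eps (root_of t s)].

(* beta1 >= beta2 iff beta1 - beta2 is a nonnegative combination of Delta *)
Definition root_ge (l : nat) (b1 b2 : 'I_l -> int) : Prop :=
  forall i, b2 i <= b1 i.

Definition is_ideal (t : RType) (l : nat) (I : set ('I_l -> int)) : Prop :=
  I `<=` @PhiPlus t l /\
  forall b1 b2, I b1 -> @PhiPlus t l b2 -> root_ge b1 b2 -> I b2.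

(* The compact torus (S^1)^l, realised inside 'M[R]_(l,2) = (R^2)^l.          *)
(* A point p has coordinates t_i = p i 0 + sqrt(-1) p i 1 in S^1.             *)

Section Torus.
Variables (R : realType) (l : nat).

Local Notation Pt := 'M[R]_(l, 2).

Definition cmul (z w : R * R) : R * R := (z.1 * w.1 - z.2 * w.2, z.1 * w.2 + z.2 * w.1).
Definition cconj (z : R * R) : R * R := (z.1, - z.2).
Definition cone : R * R := (1, 0).
Definition cpow (z : R * R) (k : int) : R * R :=
  match k with
  | Posz n => iter n (cmul z) cone
  | Negz n => iter n.+1 (cmul (cconj z)) cone  (* z^-1 = conj z on S^1 *)
  end.

Definition circle : set (R * R) := [set z | z.1 ^+ 2 + z.2 ^+ 2 = 1].

Definition torus : set Pt := [set p | forall i : 'I_l, (p i 0, p i 1) \in circle].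

Definition coord (p : Pt) (i : 'I_l) : R * R := (p i 0, p i 1).

Definition charv (a : 'I_l -> int) (p : Pt) : R * R :=
  \big[cmul/cone]_(i < l) cpow (coord p i) (a i).

Definition Hset (a : 'I_l -> int) (c : R * R) : set Pt :=
  [set p | torus p /\ charv a p = c].

Definition Hcomps (a : 'I_l -> int) (c : R * R) : set (set Pt) :=
  [set connected_component (Hset a c) x | x in Hset a c].

(* dimension of a layer X (a coset of a subtorus): l minus the rank of the
   lattice of characters that are constant on X *)
Definition char_const (a : 'I_l -> int) (X : set Pt) : Prop :=
  forall x y, X x -> X y -> charv a x = charv a y.

Definition ann_rank_ge (X : set Pt) (k : nat) : Prop :=
  exists a : 'I_k -> 'I_l -> int,
    \rank (\matrix_(j < k, i < l) ((a j i)%:~R : rat)) = k /\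
    forall j, char_const (a j) X.

Definition dimL (X : set Pt) : nat :=
  (l - \max_(k < l.+1 | `[< ann_rank_ge X k >]) k)%N.

Definition inter_in (E : set Pt) (S : set (set Pt)) : set Pt :=
  E `&` \bigcap_(K in S) K.

Definition layers (E : set Pt) (A : set (set Pt)) : set (set Pt) :=
  [set X | exists S : set (set Pt), S `<=` A /\
     exists x, inter_in E S x /\ X = connected_component (inter_in E S) x].

(* Moebius function mu(E, X) of the poset of layers (ordered by reverse
   inclusion), computed by the recursion
     mu(E,E) = 1,  mu(E,X) = - sum_{E <= Y < X} mu(E,Y);
   the recursion depth is bounded by the length of chains, which is <= l,
   so the fuel l.+1 gives the exact Moebius function. *)
Fixpoint mob_fuel (L : set (set Pt)) (E : set Pt) (n : nat) (X : set Pt) : int :=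
  match n with
  | 0 => 0
  | n.+1 => if `[< X = E >] then 1
            else - \sum_(Y \in [set Y | L Y /\ X `<=` Y /\ X <> Y]) mob_fuel L E n Y
  end.

Definition mobius (E : set Pt) (A : set (set Pt)) (X : set Pt) : int :=
  mob_fuel (layers E A) E l.+1 X.

Definition charpoly (E : set Pt) (A : set (set Pt)) : {poly int} :=
  \sum_(X \in layers E A) ((mobius E A X)%:P * 'X^(dimL X)).

Definition deletion (A : set (set Pt)) (H : set Pt) : set (set Pt) := A `\ H.

Definition restriction (A : set (set Pt)) (H : set Pt) : set (set Pt) :=
  [set Y | exists K, (A `\ H) K /\ exists x, (K `&` H) x /\
     Y = connected_component (K `&` H) x].

(* inductive arrangements: Ind E A means "A, an arrangement in the torus E,
   is inductive".  E is always the full torus or a layer (a torus). *)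
Inductive Ind : set Pt -> set (set Pt) -> Prop :=
  | Ind_empty E : Ind E set0
  | Ind_step E A H : A H ->
      Ind E (deletion A H) -> Ind H (restriction A H) ->
      (exists d : int, charpoly E (deletion A H) =
                       ('X - d%:P) * charpoly H (restriction A H)) ->
      Ind E A.

Definition toric_arr (I : set ('I_l -> int)) : set (set Pt) :=
  [set K | exists b, I b /\ Hcomps b cone K].

End Torus.

(* Main.v *)
(** Let N run through the multiples of a suitable integer. A torsion coset of dimension d then
    contains N^d points of order dividing N, so by Moebius inversion the characteristic polynomial
    at N counts the N-torsion points outside the arrangement. This gives
    chi(A) = chi(A') - chi(A''), and hypersurfaces can be added one at a time: if all of them
    have the same restriction A'', each one raises by one the root d in chi(A) = (t - d) chi(A'').

    Write the roots in terms of e_1, ..., e_l and induct on l, adding the roots that involve e_1,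
    which form a chain of the root poset. In type A, and in type B while e_1 is not in the ideal,
    these all restrict to the ideal on e_2, ..., e_l. If e_1 is in the ideal of type B, then so
    are all the e_i and e_i - e_j, and the e_i + e_j form a threshold graph. Restricting to
    e_1 + e_j = 0 turns e_1 - e_j into 2 e_j = 0, which has the extra component e_j = 1/2. One
    therefore allows extra hypersurfaces e_j = 1/2 for j in a set J of dominating vertices. On n
    vertices chi is then Q(t) (t - n - |J|) with Q independent of J, which makes the divisibility
    work at every step.

    In type C, with the root lattice as character lattice, 2 e_j = 0 is connected, and all the
    roots involving e_1 restrict to the ideal on e_2, ..., e_l, except 2 e_1, which is present
    only in the full arrangement; it restricts to the class above with J the set of all vertices. *)
Require Import Defs.
From HB Require Import structures.
From mathcomp Require Import all_boot all_order all_algebra finmap.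
From mathcomp Require Import all_classical all_reals topology normedtype.
From mathcomp Require Import sequences trigo ring lra zify.
Set Implicit Arguments. Unset Strict Implicit. Unset Printing Implicit Defensive.
Import Order.TTheory GRing.Theory Num.Theory.
Import numFieldNormedType.Exports.
Local Open Scope classical_set_scope.
Local Open Scope ring_scope.

(** * Characters of the torus in angular coordinates *)

(** Restrictions live in smaller tori without preferred coordinates, so every arrangement carries
    the list [gs] of equations of its ambient coset, always [prim]: that one condition gives
    connectedness, dimension and the number of torsion points.

    Type B rests on a numerical coincidence. Let [v] be peeled from [v :: W], with [J] inside [W].
    The hypersurfaces of the first batch, which restrict to the class of [(W, J)], number
    [|W| + |J| + 1], while that class has the root [|W| + |J|]. The polynomial reached has both
    roots, so it is also divisible by that of [(W, w :: J)], whose root is [|W| + |J| + 1], and a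
    second batch with this larger restriction can follow. Vertices of [J] must dominate because on
    [e_v + e_w = 0] every [e_v - e_u] turns into [e_w + e_u]. If [v] itself is in [J], the graph is
    complete and a vertex outside [J], if any, is peeled instead.

    In the full type C, with [n] vertices after [e_1], the roots before [2 e_1] is added are
    [2, 4, ..., 2n] and [n]; the restriction to [2 e_1 = 0] has exactly [2, 4, ..., 2n]. *)

Section Circle.
Variable R : realType.
Implicit Types s t : R.

(* Angles are measured in turns. *)
Definition e1 t : R * R := (cos (t * (pi *+ 2)), sin (t * (pi *+ 2))).

Lemma e1D s t : e1 (s + t) = cmul (e1 s) (e1 t).
Proof. by rewrite /e1 /cmul /= mulrDl cosD sinD; congr (_, _); ring. Qed.

Lemma e1N t : e1 (- t) = cconj (e1 t).
Proof. by rewrite /e1 /cconj mulNr cosN sinN. Qed.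

Lemma e10 : e1 0 = cone R.
Proof. by rewrite /e1 mul0r cos0 sin0. Qed.

Lemma e1_int (z : int) : e1 z%:~R = cone R.
Proof.
have e1_nat (n : nat) : e1 n%:R = cone R.
  elim: n => [|n IH]; first exact: e10.
  by rewrite -addn1 natrD e1D IH /e1 mul1r cos2pi sin2pi /cmul /cone /= !(mulr0, mul1r, mul0r, mulr1, subr0, addr0, add0r).
case: z => n; first exact: e1_nat.
by rewrite NegzE rmorphN /= e1N [in cconj _]e1_nat /cconj /= oppr0.
Qed.

(** Cosine is injective only on [[0, pi]], so the fractional part [r] is treated directly when it is
    at most one half, and through [1 - r] otherwise. *)
Lemma e1_eq1 t : e1 t = cone R -> t \is a Num.int.
Proof.
move=> h; set r := t - (Num.floor t)%:~R.
have er : e1 r = cone R.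
  by rewrite /r e1D h -rmorphN e1_int /cmul /cone /= !(mulr0, mul1r, mul0r, mulr1, subr0, addr0, add0r).
have r0 : 0 <= r by rewrite subr_ge0 ge_floor.
have r1 : r < 1 by rewrite ltrBlDl; have := floorD1_gt t; rewrite intrD addrC.
suff : r = 0 by move/eqP; rewrite subr_eq0 => /eqP ->; rewrite intr_int.
have p0 : 0 < pi :> R := pi_gt0 R.
have cr : cos (r * (pi *+ 2)) = 1 by case: er.
have [hr|hr] := leP (r * 2) 1.
  have : r * (pi *+ 2) = 0.
    apply: cos_inj; rewrite ?cos0 // ?in_itv /= ?lexx ?(ltW p0) //.
    apply/andP; split; first by rewrite mulr_ge0 // mulrn_wge0 // ltW.
    by rewrite -mulr_natl mulrA ler_piMl // ltW.
  by move/eqP; rewrite mulf_eq0 mulrn_eq0 /= (gt_eqF p0) orbF => /eqP.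
have : (1 - r) * (pi *+ 2) = 0.
  apply: cos_inj; rewrite ?in_itv /= ?lexx ?(ltW p0) //.
    apply/andP; split; first by rewrite mulr_ge0 ?subr_ge0 ?(ltW r1)// mulrn_wge0 // ltW.
    rewrite -mulr_natl mulrA ler_piMl // ?(ltW p0) //; lra.
  by rewrite cos0 mulrBl mul1r -cosN opprB cosB cos2pi sin2pi mulr1 mulr0 addr0.
by move/eqP; rewrite mulf_eq0 mulrn_eq0 /= (gt_eqF p0) orbF => /eqP; lra.
Qed.

Lemma e1_eq s t : e1 s = e1 t <-> s - t \is a Num.int.
Proof.
split=> [h|/intrP[z hz]].
  apply: e1_eq1; rewrite e1D e1N h /cmul /cconj /cone /e1 /=.
  by rewrite mulrN opprK -!expr2 cos2Dsin2 mulrN [sin _ * _]mulrC addNr.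
have -> : s = z%:~R + t by rewrite -hz subrK.
by rewrite e1D e1_int /cmul /cone /e1 /= !mul1r !mul0r subr0 addr0.
Qed.

Lemma e1_circle t : circle (e1 t).
Proof. by rewrite /circle /= cos2Dsin2. Qed.

Lemma circle_e1 (z : R * R) : circle z -> exists t, z = e1 t.
Proof.
have p0 : pi *+ 2 != 0 :> R by rewrite mulrn_eq0 /= gt_eqF // pi_gt0.
case: z => x y; rewrite /circle /= => hz.
have hx : -1 <= x <= 1.
  rewrite -ler_norml -(ler_pXn2r (n := 2)) ?nnegrE // expr1n -normrX ger0_norm ?sqr_ge0 //.
  by rewrite -hz lerDl sqr_ge0.
have hs : sin (acos x) = `|y| by rewrite sin_acos // -hz addrAC subrr add0r sqrtr_sqr.
have [y0|y0] := leP 0 y.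
  exists (acos x / (pi *+ 2)); rewrite /e1 mulfVK // acosK // ?hs ?ger0_norm //.
exists (- acos x / (pi *+ 2)); rewrite /e1 mulfVK // cosN sinN acosK // hs ltr0_norm // opprK //.
Qed.

End Circle.

Section Exp.
Variables (R : realType) (l : nat).
Implicit Types (a : 'rV[int]_l) (th : 'rV[R]_l).

Definition lin a th : R := \sum_i (a 0 i)%:~R * th 0 i.

Definition ex th : 'M[R]_(l, 2) := \matrix_(i, j) if j == 0 then (e1 (th 0 i)).1 else (e1 (th 0 i)).2.

Lemma coord_ex th i : Defs.coord (ex th) i = e1 (th 0 i).
Proof. by rewrite /Defs.coord !mxE. Qed.

Lemma cpow_e1 (t : R) (k : int) : cpow (e1 t) k = e1 (k%:~R * t).
Proof.
have pw (s : R) n : iter n (cmul (e1 s)) (cone R) = e1 (n%:R * s).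
  by elim: n => [|n IH]; rewrite ?mul0r ?e10 //= IH -e1D -[in RHS]addn1 natrD mulrDl mul1r addrC.
case: k => n /=; first by rewrite pw.
by rewrite -e1N -[cmul _ _]/(iter n.+1 (cmul (e1 (- t))) (cone R)) pw NegzE rmorphN /= mulNr mulrN.
Qed.

Lemma charv_ex (a : 'I_l -> int) th : charv a (ex th) = e1 (\sum_i (a i)%:~R * th 0 i).
Proof.
rewrite /charv; pose P (x : R * R) (y : R) := x = e1 y.
apply: (big_ind2 P) => [|x1 x2 y1 y2 -> ->|i _]; rewrite /P ?e10 ?e1D //.
by rewrite coord_ex cpow_e1.
Qed.

Lemma charv_ex_lin a th : charv (a 0) (ex th) = e1 (lin a th).
Proof. exact: charv_ex. Qed.

Lemma torus_ex th : torus (ex th).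
Proof. by move=> i; have := coord_ex th i; rewrite /Defs.coord inE => ->; exact: e1_circle. Qed.

Lemma torusP (p : 'M[R]_(l, 2)) : torus p <-> exists th, p = ex th.
Proof.
split=> [hp|[th ->]]; last exact: torus_ex.
have /choice[f hf] : forall i, exists t, (p i 0, p i 1) = e1 t.
  by move=> i; apply: circle_e1; have := hp i; rewrite inE.
exists (\row_i f i); apply/matrixP => i j; rewrite !mxE -hf.
have [->|] := eqVneq j 0; first by [].
by case: j => [[|[|//]] hj] //= _; congr (p i _); apply: val_inj.
Qed.

Lemma ex_eq th th' : ex th = ex th' <-> forall i, th 0 i - th' 0 i \is a Num.int.
Proof.
split=> [h i|h]; first by apply/e1_eq; rewrite -!coord_ex h.
by apply/matrixP => i j; rewrite !mxE (iffRL (e1_eq _ _) (h i)).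
Qed.

Lemma lin_is_linear a : linear (lin a : 'rV[R]_l -> R^o).
Proof.
move=> k u v; rewrite /lin scaler_sumr -big_split /=; apply: eq_bigr => i _.
by rewrite !mxE mulrDr /GRing.scale /= mulrCA.
Qed.
HB.instance Definition _ a := GRing.isLinear.Build R 'rV[R]_l R^o _ (lin a) (lin_is_linear a).

Lemma linDl a b th : lin (a + b) th = lin a th + lin b th.
Proof. by rewrite /lin -big_split /=; apply: eq_bigr => i _; rewrite mxE rmorphD mulrDl. Qed.

Lemma linNl a th : lin (- a) th = - lin a th.
Proof. by rewrite /lin -sumrN; apply: eq_bigr => i _; rewrite mxE rmorphN mulNr. Qed.

Lemma lin0l th : lin 0 th = 0.
Proof. by rewrite /lin big1 // => i _; rewrite mxE mul0r. Qed.

End Exp.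

(** * Continuity of characters and of paths in the torus *)

Section Connected.
Variables (R : realType) (l : nat).
Notation Pt := 'M[R]_(l, 2).

(** The fibre over [f q] is closed, and it is also open in [C] because the finitely many other
    values form a closed set. *)
Lemma connected_finite_image (C : set Pt) (f : Pt -> R) (s : seq R) :
  connected C -> continuous f -> (forall p, C p -> f p \in s) ->
  forall p q, C p -> C q -> f p = f q.
Proof.
move=> hC cf hs p q Cp Cq.
have clf (u : seq R) : closed [set z | z \in u].
  elim: u => [|a u IH].
    by rewrite (_ : mkset _ = set0); [exact: closed0|apply/seteqP; split].
  rewrite (_ : mkset _ = [set x | x = a] `|` [set z | z \in u]); first by apply: closedU => //; exact: closed_eq.
  apply/seteqP; split=> z /=; rewrite inE; first by case/predU1P; [left|right].
  by case=> [->|->]; rewrite ?eqxx ?orbT.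
have cpre D : closed D -> closed (f @^-1` D).
  by move=> hD; apply: preimage_closed => // x _; exact: cf.
suff E : C `&` f @^-1` [set x | x = f q] = C by move: Cp; rewrite -E => -[].
apply: hC; first by exists q.
  exists (~` (f @^-1` [set z | z \in [seq x <- s | x != f q]])).
    by apply: closed_openC; apply: cpre.
  apply/seteqP; split=> z [Cz /=]; rewrite mem_filter.
    by move=> ->; split => //=; rewrite eqxx.
  by move=> /negP; rewrite hs // andbT negbK => /eqP.
by exists (f @^-1` [set x | x = f q]) => //; apply: cpre; exact: closed_eq.
Qed.

(** Continuity is asked coordinatewise because [connected_finite_image] is applied to each real
    component separately. *)
Definition ccont (T : topologicalType) (F : T -> R * R) :=
  continuous (fun p => (F p).1) /\ continuous (fun p => (F p).2).

Lemma ccont_cst (T : topologicalType) (z : R * R) : ccont ((fun=> z) : T -> R * R).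
Proof. by split=> x; exact: cvg_cst. Qed.

Lemma ccont_mul (T : topologicalType) (F G : T -> R * R) :
  ccont F -> ccont G -> ccont (fun p => cmul (F p) (G p)).
Proof.
move=> [f1 f2] [g1 g2]; split=> x.
  by apply: cvgB; [apply: cvgM; [exact: f1|exact: g1]|apply: cvgM; [exact: f2|exact: g2]].
by apply: cvgD; [apply: cvgM; [exact: f1|exact: g2]|apply: cvgM; [exact: f2|exact: g1]].
Qed.

Lemma ccont_conj (T : topologicalType) (F : T -> R * R) :
  ccont F -> ccont (fun p => cconj (F p)).
Proof. by move=> [f1 f2]; split=> // x; apply: cvgN; exact: f2. Qed.

Lemma ccont_iter (T : topologicalType) (F : T -> R * R) n :
  ccont F -> ccont (fun p => iter n (cmul (F p)) (cone R)).
Proof.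
by move=> hF; elim: n => [|n IH] /=; [exact: ccont_cst|exact: ccont_mul].
Qed.

Lemma charv_continuous (a : 'I_l -> int) : ccont (charv a : Pt -> R * R).
Proof.
rewrite /charv unlock /reducebig; elim: (index_enum _) => [|i r IH] /=.
  exact: ccont_cst.
have hc : ccont (fun p : Pt => Defs.coord p i) by split => x; exact: coord_continuous.
apply: ccont_mul => //; case: (a i) => n /=; first exact: ccont_iter.
by apply: (@ccont_mul _ (fun p : Pt => cconj (Defs.coord p i))); [|apply: ccont_iter]; exact: ccont_conj.
Qed.

Lemma ex_path_continuous (th v : 'rV[R]_l) : continuous (fun s : R => ex (th + s *: v)).
Proof.
move=> s.
rewrite (_ : (fun s : R => _) = fun s => \sum_i \sum_j ex (th + s *: v) i j *: delta_mx i j); last first.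
  by apply: funext => x; rewrite -matrix_sum_delta.
apply: (cvg_big (P := xpredT)); first exact: add_continuous.
move=> i _; apply: (cvg_big (P := xpredT)); first exact: add_continuous.
move=> j _; apply: cvgZr_tmp.
have cl : continuous (fun s : R => (th 0 i + s * v 0 i) * (pi *+ 2)).
  move=> x; apply: cvgMr_tmp; apply: cvgD; first exact: cvg_cst.
  by apply: cvgMr_tmp; exact: cvg_id.
rewrite (_ : (fun x : R => _) = fun x => if j == 0 then cos ((th 0 i + x * v 0 i) * (pi *+ 2))
  else sin ((th 0 i + x * v 0 i) * (pi *+ 2))); last first.
  by apply: funext => x; rewrite !mxE /e1.
rewrite !mxE /e1 /=; case: (j == 0).
  by apply: continuous_comp; [exact: cl|exact: continuous_cos].
by apply: continuous_comp; [exact: cl|exact: continuous_sin].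
Qed.

End Connected.

(** * Cosets of subtori and their torsion points *)

Section Affine.
Variables (R : realType) (l : nat).
Notation Pt := 'M[R]_(l, 2).
Notation aff := ('rV[int]_l * R)%type.
Implicit Types (g h : aff) (gs hs : seq aff) (th : 'rV[R]_l).

(* A pair [g = (a, c)] stands for the affine function [th |-> a . th + c] of the angles. *)
Definition ev g th : R := lin g.1 th + g.2.

Lemma evD g h th : ev (g + h) th = ev g th + ev h th.
Proof. by rewrite /ev linDl addrACA. Qed.

Lemma evN g th : ev (- g) th = - ev g th.
Proof. by rewrite /ev linNl opprD. Qed.

Lemma evB g h th : ev (g - h) th = ev g th - ev h th.
Proof. by rewrite evD evN. Qed.

Lemma evBr g th th' : ev g th - ev g th' = lin g.1 (th - th').
Proof. by rewrite /ev opprD addrACA subrr addr0 linearB. Qed.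

Definition idot (a v : 'rV[int]_l) : int := \sum_i a 0 i * v 0 i.

Lemma idotDl a b v : idot (a + b) v = idot a v + idot b v.
Proof. by rewrite /idot -big_split; apply: eq_bigr => i _; rewrite mxE mulrDl. Qed.

Lemma idotNl a v : idot (- a) v = - idot a v.
Proof. by rewrite /idot -sumrN; apply: eq_bigr => i _; rewrite mxE mulNr. Qed.

Lemma idotBl a b v : idot (a - b) v = idot a v - idot b v.
Proof. by rewrite idotDl idotNl. Qed.

Lemma lin_int a v : lin a (map_mx intr v) = (idot a v)%:~R :> R.
Proof. by rewrite /idot rmorph_sum; apply: eq_bigr => i _; rewrite mxE rmorphM. Qed.

Definition Zs gs : set Pt :=
  [set p | exists2 th, p = ex th & forall g, g \in gs -> ev g th \is a Num.int].

(** Two lifts of a point differ by an integral vector and the linear part of [g] is integral; hence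
    membership in [Zs] can be tested on any lift. *)
Lemma ev_int_ex g th th' : ex th = ex th' -> ev g th \is a Num.int -> ev g th' \is a Num.int.
Proof.
move/ex_eq => h; rewrite -[ev g th'](subrK (ev g th)) => hg.
rewrite rpredD // evBr /lin rpred_sum // => i _.
by rewrite rpredM ?intr_int // !mxE -opprB rpredN.
Qed.

Lemma Zs_ex gs th : Zs gs (ex th) <-> forall g, g \in gs -> ev g th \is a Num.int.
Proof.
split=> [[th' he h] g /h|h]; last by exists th.
by apply: ev_int_ex.
Qed.

Lemma Zs_nil : Zs [::] = @torus R l.
Proof.
apply/seteqP; split=> p; first by case=> th -> _; exact: torus_ex.
by move/torusP => [th ->]; exists th.
Qed.

Lemma Zs_cat gs hs : Zs (gs ++ hs) = Zs gs `&` Zs hs.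
Proof.
apply/seteqP; split=> p.
  by case=> th -> h; split; apply/Zs_ex => g hg; apply: h; rewrite mem_cat hg ?orbT.
case=> -[th -> h] /Zs_ex h'; apply/Zs_ex => g; rewrite mem_cat => /orP[]; [exact: h|exact: h'].
Qed.

(* The linear parts of [gs] form a basis of a direct summand of the character lattice, so
   that [Zs gs] is a coset of a subtorus. *)
Definition prim gs := forall ks : seq int, size ks = size gs ->
  exists v, [seq idot g.1 v | g <- gs] = ks.

Lemma prim_dual gs : prim gs -> exists v : 'I_(size gs) -> 'rV[int]_l,
  forall j i : 'I_(size gs), idot (nth 0 gs i).1 (v j) = (i == j)%:Z.
Proof.
move=> hp.
suff /choice[v hv] : forall j : 'I_(size gs), exists v, forall i : 'I_(size gs),
    idot (nth 0 gs i).1 v = (i == j)%:Z by exists v.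
move=> j.
have [|v hv] := hp (mkseq (fun i => (i == j :> nat)%:Z) (size gs)); first by rewrite size_mkseq.
exists v => i; have := congr1 (fun s => nth 0 s i) hv.
by rewrite nth_mkseq // (nth_map 0).
Qed.

Lemma prim_real gs (ks : seq R) : prim gs -> size ks = size gs ->
  exists th, [seq lin g.1 th | g <- gs] = ks.
Proof.
move=> hp hs.
have [v hv] := prim_dual hp.
exists (\sum_j ks`_(nat_of_ord j) *: map_mx intr (v j)).
apply: (@eq_from_nth _ 0); first by rewrite size_map.
move=> i; rewrite size_map => hi; rewrite (nth_map 0) // linear_sum /=.
rewrite (bigD1 (Ordinal hi)) //= linearZ /= lin_int (hv _ (Ordinal hi)) eqxx [X in _ + X]big1.
  by rewrite addr0 /GRing.scale /= mulr1.
move=> j /negPf hj; rewrite linearZ /= lin_int (hv j (Ordinal hi)) eq_sym hj.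
by rewrite /GRing.scale /= mulr0.
Qed.

Lemma prim_ev gs (ks : seq R) : prim gs -> size ks = size gs ->
  exists th, [seq ev g th | g <- gs] = ks.
Proof.
move=> hp hs; have [|th hth] := @prim_real gs [seq x.1 - x.2.2 | x <- zip ks gs] hp.
  by rewrite size_map size_zip hs minnn.
exists th; apply: (@eq_from_nth _ 0); rewrite size_map // => i hi.
have := congr1 (fun s => nth 0 s i) hth; rewrite !(nth_map 0) ?size_zip ?hs ?minnn //.
rewrite (nth_zip 0 0) // /ev /= => ->.
by rewrite subrK.
Qed.

(** Any two points are joined by the image of a straight segment of angles: primitivity supplies an
    integral shift [v] of one lift after which all functions of [gs] agree at both ends, hence are
    constant along the segment. *)
Lemma prim_connected gs : prim gs -> connected (Zs gs).
Proof.
move=> hp; have [|th0 _] := @prim_ev gs (nseq (size gs) 0) hp; first by rewrite size_nseq.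
have [[p0 hp0]|h0] := pselect (Zs gs !=set0); last first.
  rewrite (_ : Zs gs = set0); first exact: connected0.
  by apply/seteqP; split=> // p Zp; case: h0; exists p.
have hpath p q : Zs gs p -> Zs gs q -> exists2 C, connected C & [/\ C `<=` Zs gs, C p & C q].
  move=> [th -> hth] [th' -> hth'].
  have [|v hv] := hp [seq Num.floor (ev g th' - ev g th) | g <- gs]; first by rewrite size_map.
  pose w := th' - map_mx intr v.
  have hw : ex w = ex th' by apply/ex_eq => i; rewrite !mxE addrAC subrr add0r rpredN intr_int.
  have hlin g : g \in gs -> lin g.1 (w - th) = 0.
    move=> hg; rewrite /w addrAC linearB /= lin_int -evBr.
    have -> : idot g.1 v = Num.floor (ev g th' - ev g th).
      have := congr1 (fun s => nth 0 s (index g gs)) hv.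
      by rewrite !(nth_map 0) ?index_mem // nth_index.
    by rewrite floorK ?subrr // rpredB ?hth ?hth'.
  exists ((fun s : R => ex (th + s *: (w - th))) @` `[0, 1]%classic).
    apply: connected_continuous_connected; first exact: segment_connected.
    by apply: continuous_subspaceT; exact: ex_path_continuous.
  split.
  - move=> _ [s _ <-]; apply/Zs_ex => g hg.
    rewrite /ev linearD linearZ /= hlin // scaler0 addr0; exact: hth.
  - by exists 0; rewrite ?scale0r ?addr0 //= in_itv /= lexx ler01.
  - by exists 1; rewrite ?scale1r 1?addrC ?subrK //= in_itv /= lexx ler01.
rewrite (_ : Zs gs = connected_component (Zs gs) p0); first exact: component_connected.
apply/seteqP; split; last exact: connected_component_sub.
move=> q hq; have [C hC [h1 h2 h3]] := hpath p0 q hp0 hq.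
by exists C.
Qed.

Definition ratl N gs := forall g, g \in gs -> N%:R * g.2 \is a Num.int.

(* The character of [g] takes at most [k] values on [C], hence is constant there. *)
Lemma connected_ev_int (C : set Pt) k g th th' : connected C -> C `<=` @torus R l ->
  (0 < k)%N -> (forall x, C (ex x) -> k%:R * ev g x \is a Num.int) ->
  C (ex th) -> C (ex th') -> ev g th - ev g th' \is a Num.int.
Proof.
move=> cC hC k0 hk Cth Cth'; rewrite evBr linearB /=.
(* If [k * (a . x + c)] is an integer, then [a . x] is congruent to [i / k - c] for a residue [i]
   modulo [k]. *)
pose s : seq (R * R) := [seq e1 (i%:R / k%:R - g.2) | i <- iota 0 k].
have kR : k%:R != 0 :> R by rewrite pnatr_eq0 -lt0n.
have hfin r : C r -> charv (g.1 0) r \in s.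
  move=> Cr; have /torusP[x er] := hC r Cr.
  move: Cr; rewrite er charv_ex_lin => /hk /intrP[z hz].
  apply/mapP; exists `|(z %% k)%Z|%N.
    by rewrite mem_iota /= add0n -ltz_nat gez0_abs ?modz_ge0 ?ltz_pmod // -lt0n.
  apply/e1_eq; rewrite natr_absz ger0_norm ?modz_ge0 -?lt0n //.
  rewrite opprB addrA -/(ev g x) -[ev g x](mulKf kR) mulrC hz -mulrBl -rmorphB /=.
  by rewrite {1}(divz_eq z k) addrK rmorphM /= mulfK.
have [c1 c2] := charv_continuous R (g.1 0).
have h1 := connected_finite_image cC c1 (s := map fst s) _ Cth Cth'.
have h2 := connected_finite_image cC c2 (s := map snd s) _ Cth Cth'.
apply/e1_eq; rewrite -!charv_ex_lin [LHS]surjective_pairing [RHS]surjective_pairing h1 ?h2 //.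
  by move=> r /hfin; exact: map_f.
by move=> r /hfin; exact: map_f.
Qed.

(* In coordinates adapted to the linear parts of [gs] (Smith normal form), [Zs gs] is defined
   by conditions [d_i * x_i + c_i = 0], and fixing the values [x_i] with [d_i <> 0] singles
   out a component. *)
Lemma component_Zs N gs : (0 < N)%N -> ratl N gs ->
  exists N', [/\ (0 < N')%N, (N %| N')%N & forall p, Zs gs p ->
    exists gs', [/\ prim gs', ratl N' gs', Zs gs' p & connected_component (Zs gs) p = Zs gs']].
Proof.
move=> N0 hN; pose m := size gs.
pose A := \matrix_(i < m, j < l) (nth 0 gs i).1 0 j.
have [L uL [Q uQ [d _ hA]]] := int_Smith_normal_form A.
set D := (\matrix_(i, j) _) in hA.
(* On [Zs gs], [N * d_i] times the [i]-th adapted coordinate is an integer; the product over all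
   nonzero [d_i] serves every coordinate and every point [p] at once. *)
pose N' := (N * \prod_(i < m | nth 0%R d i != 0%R) `|nth 0%R d i|)%N.
pose P (i : 'I_l) := (i < m)%N && (d`_i != 0).
pose q (x : 'rV[R]_l) i := lin (row i Q) x.
have linA (i : 'I_m) x : lin (nth 0 gs i).1 x = \sum_k (L i k)%:~R * \sum_j (D k j)%:~R * q x j.
  transitivity ((map_mx intr L *m (map_mx intr D *m (map_mx intr Q *m x^T))) i 0).
    rewrite !mulmxA -!map_mxM -hA mxE; apply: eq_bigr => j _.
    by rewrite !mxE.
  rewrite mxE; apply: eq_bigr => k _; rewrite mxE; congr (_ * _).
  rewrite mxE; apply: eq_bigr => j _; rewrite mxE; congr (_ * _).
  by rewrite mxE; apply: eq_bigr => n _; rewrite !mxE.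
have linD (k : 'I_m) x : \sum_j (D k j)%:~R * q x j =
    \sum_i (invmx L k i)%:~R * lin (nth 0 gs i).1 x.
  transitivity ((map_mx intr (invmx L) *m (map_mx intr L *m (\col_k \sum_j (D k j)%:~R * q x j))) k 0).
    by rewrite mulmxA -map_mxM mulVmx // map_mx1 mul1mx mxE.
  rewrite mxE; apply: eq_bigr => i _; rewrite mxE linA; congr (_ * _).
  by rewrite mxE; apply: eq_bigr => j _; rewrite !mxE.
have fact th i : Zs gs (ex th) -> P i -> N'%:R * q th i \is a Num.int.
  move=> /Zs_ex hth /andP[im di].
  have := linD (Ordinal im) th; rewrite (bigD1 i) //= big1 ?addr0; last first.
    by move=> j hj; rewrite mxE /= eq_sym -val_eqE in hj *; rewrite (negPf hj) mul0r.
  rewrite mxE eqxx /= mulr1n => h.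
  rewrite /N' (bigD1 (Ordinal im)) //= mulnA natrM mulrAC rpredM ?natr_int //.
  suff : N%:R * ((d`_i)%:~R * q th i) \is a Num.int.
    rewrite natrM natr_absz intr_norm -mulrA; case: (ger0P (d`_i)%:~R) => // _.
    by rewrite mulNr mulrN rpredN.
  rewrite h mulr_sumr rpred_sum // => k _.
  rewrite mulrCA rpredM ?intr_int //.
  rewrite (_ : lin _ _ = ev (nth 0 gs k) th - (nth 0 gs k).2); last by rewrite /ev addrK.
  by rewrite mulrBr rpredB ?hN ?mem_nth // rpredM ?natr_int ?hth ?mem_nth.
have N'0 : (0 < N')%N.
  by rewrite muln_gt0 N0 /= prodn_cond_gt0 // => i; rewrite absz_gt0.
exists N'; split=> // [|p Zp]; first by rewrite dvdn_mulr.
case: (Zp) => th0 ep hth0.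
(* The rows of the unimodular [Q] form a basis of the character lattice, so fixing some of these
   coordinates at their values at [p] gives a primitive system. *)
pose gs' := [seq (row i Q, - q th0 i) | i <- enum P].
have Zgs'P th : Zs gs' (ex th) <-> forall i, P i -> q th i - q th0 i \is a Num.int.
  rewrite Zs_ex; split=> h i; first by move=> Pi; apply: (h (row i Q, - q th0 i)); rewrite map_f ?mem_enum.
  by case/mapP => j; rewrite mem_enum => /h hj ->.
have prim' : prim gs'.
  move=> ks hks.
  pose w := \col_(i < l) ks`_(index i (enum P)).
  exists (invmx Q *m w)^T; apply: (@eq_from_nth _ 0); rewrite size_map // => i hi.
  have hi' : (i < size (enum P))%N by rewrite size_map in hi.
  rewrite (nth_map 0) //.
  have l0 : 'I_l by case: (enum P) hi'.
  rewrite (nth_map l0) //=.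
  transitivity ((Q *m (invmx Q *m w)) (nth l0 (enum P) i) 0).
    by rewrite mxE; apply: eq_bigr => j _; rewrite !mxE.
  by rewrite mulmxA mulmxV // mul1mx mxE index_uniq // enum_uniq.
exists gs'; split=> //.
- move=> g /mapP[i]; rewrite mem_enum => Pi -> /=.
  by rewrite mulrN rpredN fact // -ep.
- by rewrite ep; apply/Zgs'P => i _; rewrite subrr.
apply/seteqP; split=> [p' Cp'|]; last first.
  apply: connected_component_max; last exact: prim_connected.
  - by rewrite ep; apply/Zgs'P => i _; rewrite subrr.
  - move=> _ [th -> /Zs_ex /Zgs'P h]; apply/Zs_ex => g hg.
    rewrite -[ev g th](subrK (ev g th0)) rpredD ?hth0 // evBr.
    have hi : (index g gs < m)%N by rewrite index_mem.
    rewrite -[g](nth_index 0 hg) (linA (Ordinal hi)) rpred_sum // => k _.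
    rewrite rpredM ?intr_int // rpred_sum // => j _; rewrite mxE.
    case: eqP => [kj|_]; last by rewrite mulr0n mulr0z mul0r rpred0.
    have [->|dk] := eqVneq d`_k 0; first by rewrite mul0rn mulr0z mul0r rpred0.
    rewrite rpredM ?intr_int // /q linearB /= h // /P -kj dk andbT; exact: ltn_ord.
have Zp' := connected_component_sub Cp'.
case: (Zp') => th' ep' _; rewrite ep'; apply/Zgs'P => i Pi.
rewrite /q -[lin _ th']addr0 -[lin _ th0]addr0.
apply: (@connected_ev_int (connected_component (Zs gs) p) N' (row i Q, 0)); rewrite -?ep -?ep' //.
- exact: component_connected.
- by move=> r /connected_component_sub [x -> _]; exact: torus_ex.
- by move=> x /connected_component_sub /fact /(_ Pi); rewrite /ev /= addr0.
- exact: connected_component_refl.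
Qed.

End Affine.

(** * Dimension of a coset from the characters constant on it *)

Section Dimension.
Variables (R : realType) (l : nat).
Notation Pt := 'M[R]_(l, 2).
Notation aff := ('rV[int]_l * R)%type.
Implicit Types (g h : aff) (gs hs : seq aff) (th : 'rV[R]_l).

Definition rowsmx gs : 'M[rat]_(size gs, l) := \matrix_(i, j) ((nth 0 gs i).1 0 j)%:~R.

Lemma prim_nonempty gs : prim gs -> Zs gs !=set0.
Proof.
move=> hp; have [|th hth] := prim_ev (ks := nseq (size gs) 0) hp; first by rewrite size_nseq.
exists (ex th); apply/Zs_ex => g hg.
have := congr1 (fun s => nth 0 s (index g gs)) hth.
rewrite (nth_map 0) ?index_mem // nth_index // nth_nseq => ->.
by rewrite if_same rpred0.
Qed.

Lemma prim_row_free gs : prim gs -> row_free (rowsmx gs).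
Proof.
move=> hp; apply/row_freeP.
have [v hv] := prim_dual hp.
exists (\matrix_(i, j) (v j 0 i)%:~R); apply/matrixP => i j; rewrite !mxE.
transitivity ((idot (nth 0 gs i).1 (v j))%:~R : rat); last by rewrite hv; case: eqP.
by rewrite /idot rmorph_sum; apply: eq_bigr => k _; rewrite !mxE rmorphM.
Qed.

Lemma rank_rowsmx gs : prim gs -> \rank (rowsmx gs) = size gs.
Proof. by move/prim_row_free/eqP. Qed.

Lemma prim_size gs : prim gs -> (size gs <= l)%N.
Proof. by move=> hp; rewrite -(rank_rowsmx hp) rank_leq_col. Qed.

Lemma lin_ratr (a : 'rV[int]_l) (v : 'cV[rat]_l) :
  lin a (map_mx ratr v^T) = ratr ((map_mx intr a *m v) 0 0) :> R.
Proof. by rewrite mxE rmorph_sum; apply: eq_bigr => i _; rewrite !mxE rmorphM /= ratr_int. Qed.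

(** A constant character must vanish on every real direction killed by [gs], since whole lines in
    such directions lie on the coset. Conversely, two points have lifts that agree on [gs], and
    hence on every rational combination of its linear parts. *)
Lemma char_constP gs (a : 'I_l -> int) : prim gs ->
  char_const a (Zs gs : set Pt) <-> (\row_i (a i)%:~R <= rowsmx gs)%MS.
Proof.
move=> hp; pose A : 'rV[int]_l := \row_i a i.
have Aa : a = A 0 by apply: funext => i; rewrite mxE.
have -> : \row_i (a i)%:~R = map_mx intr A :> 'rV[rat]_l by apply/rowP => i; rewrite !mxE.
rewrite Aa; split.
  move=> hc; rewrite submxE; apply/eqP/rowP => j; rewrite [RHS]mxE.
  set v := col j (cokermx (rowsmx gs)).
  have -> : (map_mx intr A *m cokermx (rowsmx gs)) 0 j = (map_mx intr A *m v) 0 0.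
    by rewrite mxE [RHS]mxE; apply: eq_bigr => k _; rewrite [v k 0]mxE.
  have [p [th ep hth]] := prim_nonempty hp.
  pose w : 'rV[R]_l := map_mx ratr v^T.
  have hw g : g \in gs -> lin g.1 w = 0.
    move=> hg; rewrite lin_ratr.
    have hi : (index g gs < size gs)%N by rewrite index_mem.
    have := congr1 (fun M : 'M_(size gs, l) => M (Ordinal hi) j) (mulmx_coker (rowsmx gs)).
    rewrite mxE [RHS]mxE => hj; rewrite -[RHS](rmorph0 (ratr : rat -> R)) -hj; congr (ratr _).
    rewrite mxE; apply: eq_bigr => k _; rewrite [v k 0]mxE; congr (_ * _).
    by rewrite !mxE /= nth_index.
  have hs (s : R) : s * lin A w \is a Num.int.
    have h1 : Zs gs (ex (th + s *: w)).
      by apply/Zs_ex => g hg; rewrite /ev linearD linearZ /= hw // scaler0 addr0; exact: hth.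
    have h2 : Zs gs (ex th) by apply/Zs_ex.
    have := hc _ _ h1 h2; rewrite !charv_ex_lin => /e1_eq.
    by rewrite -linearB /= addrAC subrr add0r linearZ.
  have l0 : lin A w = 0.
    (* This multiple of [w] would make one half an integer. *)
    apply: contrapT => /eqP n0; have := hs (2^-1 / lin A w).
    rewrite mulfVK // => /intrP[z hz].
    have : (1 : R) = (z * 2)%:~R by rewrite intrM -hz mulVf // pnatr_eq0.
    by rewrite -[1]/(1%:~R) => /intr_inj; lia.
  by have := lin_ratr A v; rewrite -/w l0 -(rmorph0 (ratr : rat -> R)) => /fmorph_inj.
move=> /submxP[C hC] _ _ [th -> hth] [th' -> hth'].
rewrite !charv_ex_lin; apply/e1_eq.
have [|v hv] := hp [seq Num.floor (ev g th - ev g th') | g <- gs]; first by rewrite size_map.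
pose w := th - map_mx intr v.
rewrite -linearB /= (_ : th - th' = (w - th') + map_mx intr v); last first.
  by rewrite addrAC subrK.
rewrite linearD /= lin_int rpredD ?intr_int //.
suff -> : lin A (w - th') = 0 by rewrite rpred0.
have hlin (i : 'I_(size gs)) : lin (nth 0 gs i).1 (w - th') = 0.
  rewrite /w addrAC linearB /= lin_int -evBr.
  have -> : idot (nth 0 gs i).1 v = Num.floor (ev (nth 0 gs i) th - ev (nth 0 gs i) th').
    have := congr1 (fun s => nth 0 s i) hv.
    by rewrite !(nth_map 0).
  by rewrite floorK ?subrr // rpredB ?hth ?hth' ?mem_nth.
transitivity (\sum_i ratr (C 0 i) * lin (nth 0 gs i).1 (w - th')); last first.
  by rewrite big1 // => i _; rewrite hlin mulr0.
rewrite /lin; under [RHS]eq_bigr do rewrite mulr_sumr.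
rewrite exchange_big; apply: eq_bigr => j _ /=.
under eq_bigr do rewrite mulrA; rewrite -mulr_suml; congr (_ * _).
have := congr1 (fun M : 'rV_l => M 0 j) hC; rewrite mxE => h.
rewrite -(ratr_int R) h mxE rmorph_sum; apply: eq_bigr => i _.
by rewrite mxE rmorphM /= ratr_int.
Qed.

Lemma dimL_Zs gs : prim gs -> dimL (Zs gs : set Pt) = (l - size gs)%N.
Proof.
move=> hp; rewrite /dimL; congr (_ - _)%N; apply/eqP; rewrite eqn_leq; apply/andP; split.
  apply/bigmax_leqP => k /asboolP[a [hk ha]].
  rewrite -(rank_rowsmx hp) -[X in (X <= _)%N]hk; apply: mxrankS; apply/row_subP => i.
  have := iffLR (char_constP _ hp) (ha i); congr (_ <= _)%MS.
  by apply/rowP => j; rewrite !mxE.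
have hl : (size gs < l.+1)%N by rewrite ltnS prim_size.
apply: (@leq_bigmax_cond _ _ (fun k : 'I_l.+1 => k : nat) (Ordinal hl)); apply/asboolP => /=.
exists (fun j => (nth 0 gs j).1 0); split.
  by rewrite -[RHS](rank_rowsmx hp); congr (\rank _); apply/matrixP => i j; rewrite !mxE.
move=> j; apply/char_constP => //; rewrite (_ : \row__ _ = row j (rowsmx gs)) ?row_sub //.
by apply/rowP => k; rewrite !mxE.
Qed.

(** A character constant on the larger coset is constant on the smaller, which gives an inclusion of
    row spaces. With equal ranks every function of [gs] would be constant modulo integers on
    [Zs gs'], and the cosets would coincide. *)
Lemma Zs_proper_size gs gs' : prim gs -> prim gs' -> Zs gs `<=` (Zs gs' : set Pt) ->
  Zs gs <> Zs gs' -> (size gs' < size gs)%N.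
Proof.
move=> hp hp' hsub hne.
have rowE (s : seq aff) (i : 'I_(size s)) : row i (rowsmx s) = \row_j ((nth 0 s i).1 0 j)%:~R.
  by apply/rowP => j; rewrite !mxE.
have hM : (rowsmx gs' <= rowsmx gs)%MS.
  apply/row_subP => i; rewrite rowE; apply/char_constP => // p q hp1 hq1.
  suff : char_const ((nth 0 gs' i).1 0) (Zs gs' : set Pt) by apply; apply: hsub.
  by apply/char_constP => //; rewrite -rowE row_sub.
rewrite -(rank_rowsmx hp) -(rank_rowsmx hp') ltn_neqAle mxrankS // andbT.
apply/negP => /eqP hr; apply: hne; apply/seteqP; split=> //.
have hM' : (rowsmx gs <= rowsmx gs')%MS by rewrite -(mxrank_leqif_sup hM) hr.
move=> _ [th -> hth]; apply/Zs_ex => g hg.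
have [p0 h0] := prim_nonempty hp; have [th0 e0 hth0] := h0.
rewrite -[ev g th](subrK (ev g th0)) rpredD ?hth0 // evBr linearB /=.
apply/e1_eq; rewrite -!charv_ex_lin.
have hi : (index g gs < size gs)%N by rewrite index_mem.
have hc : char_const (g.1 0) (Zs gs' : set Pt).
  apply/char_constP => //; apply: submx_trans hM'.
  by rewrite -[g in g.1](nth_index 0 hg) -(rowE gs (Ordinal hi)) row_sub.
by apply: hc; [exists th|apply: hsub; rewrite -e0].
Qed.

(** * Counting torsion points on a coset *)

Section Torsion.
Variable n : nat.
Notation N := n.+2.
Notation T := 'rV['I_N]_l.

(* The [N]-torsion points of the torus. *)
Definition tpt (f : T) : Pt := ex (\row_i ((f 0 i : nat)%:R / N%:R)).

(** This is [N] times the value of [g] at [tpt f], reduced modulo [N], provided [N * g.2] is an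
    integer, so that the floor is exact. The shape [n.+2] of [N] gives ['I_N] its ring structure. *)
Definition phi g (f : T) : 'I_N :=
  \sum_i (g.1 0 i)%:~R * f 0 i + (Num.floor (N%:R * g.2))%:~R.

Lemma intZp_eq0 (z : int) : (z%:~R == 0 :> 'I_N) = (N %| z)%Z.
Proof.
have N0 : N%:R = 0 :> 'I_N by rewrite Zp_nat; apply: val_inj; exact: modnn.
rewrite {1}(divz_eq z N) rmorphD rmorphM /= -pmulrn N0 mulr0 add0r.
have r0 : 0 <= (z %% N)%Z by rewrite modz_ge0.
rewrite (sameP dvdz_mod0P eqP) -(gez0_abs r0) -pmulrn Zp_nat -(inj_eq val_inj).
change ((`|(z %% N)%Z| %% N == 0)%N = (`|(z %% N)%Z|%:Z == 0)).
by rewrite modn_small // -ltz_nat gez0_abs // ltz_pmod.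
Qed.

Lemma tpt_Zs gs f : ratl N gs -> Zs gs (tpt f) <-> all (fun g => phi g f == 0) gs.
Proof.
move=> hr; rewrite /tpt Zs_ex.
suff H g : g \in gs -> (ev g (\row_i ((f 0 i : nat)%:R / N%:R)) \is a Num.int) = (phi g f == 0).
  by split=> [h|/allP h g hg]; [apply/allP => g hg; rewrite -H ?h|rewrite H ?h].
move=> hg; pose z : int := \sum_i g.1 0 i * (f 0 i : nat)%:Z + Num.floor (N%:R * g.2).
have NR : N%:R != 0 :> R by rewrite pnatr_eq0.
have hz : N%:R * ev g (\row_i ((f 0 i : nat)%:R / N%:R)) = z%:~R.
  rewrite /z rmorphD /= floorK ?hr // /ev mulrDr; congr (_ + _).
  rewrite rmorph_sum mulr_sumr; apply: eq_bigr => i _.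
  by rewrite mxE rmorphM /= mulrCA; congr (_ * _); rewrite mulrC divfK.
have -> : phi g f = z%:~R.
  rewrite /z rmorphD rmorph_sum; congr (_ + _); apply: eq_bigr => i _.
  by rewrite rmorphM; congr (_ * _); rewrite /= -pmulrn natr_Zp.
rewrite intZp_eq0; apply/idP/idP.
  move=> /intrP[y hy]; apply/dvdzP; exists y; apply: (@intr_inj R).
  by rewrite -hz hy rmorphM mulrC.
case/dvdzP => y hy; apply/intrP; exists y; apply: (mulfI NR).
by rewrite hz hy rmorphM mulrC.
Qed.

Lemma prim_cons g gs : prim (g :: gs) -> prim gs.
Proof. by move=> hp ks hk; have [|v [_ hv]] := hp (0 :: ks); [rewrite /= hk|exists v]. Qed.

Lemma phiD g f (x : 'I_N) (v : 'rV[int]_l) :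
  phi g (f + x *: map_mx intr v) = phi g f + x * (idot g.1 v)%:~R.
Proof.
rewrite /phi addrAC; congr (_ + _).
rewrite rmorph_sum mulr_sumr -big_split; apply: eq_bigr => i _.
by rewrite !mxE rmorphM mulrDr /= mulrCA.
Qed.

(** Primitivity of [g :: gs] yields an integral [v] on which [g] is 1 and [gs] vanishes; translation
    by the multiples of [v] identifies the solutions of [gs] with those of [g :: gs] times the
    integers modulo [N]. *)
Lemma card_Zs gs : prim gs ->
  #|[set f : T | all (fun g => phi g f == 0) gs]%SET| = (N ^ (l - size gs))%N.
Proof.
move=> hp; suff : (#|[set f : T | all (fun g => phi g f == 0%R) gs]%SET| * N ^ size gs = N ^ l)%N.
  have -> : (N ^ l = N ^ (l - size gs) * N ^ size gs)%N by rewrite -expnD subnK // prim_size.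
  by move/eqP; rewrite eqn_pmul2r ?expn_gt0 // => /eqP.
elim: gs hp => [|g gs IH] hp.
  rewrite muln1 (eq_card (B := predT)) => [|f]; last by rewrite !inE.
  by rewrite card_mx card_ord mul1n.
rewrite -(IH (prim_cons hp)) /= expnS mulnA; congr (_ * _)%N.
have [|v [hv hv']] := hp (1 :: nseq (size gs) 0); first by rewrite /= size_nseq.
have hvs g' : g' \in gs -> idot g'.1 v = 0.
  move=> hg; have := congr1 (fun s => nth 0 s (index g' gs)) hv'.
  by rewrite (nth_map 0) ?index_mem // nth_index // nth_nseq if_same.
set S0 := [set f : T | _]%SET; set S := [set f : T | _]%SET.
pose F (fx : T * 'I_N) := fx.1 + fx.2 *: map_mx intr v.
have FgS fx : phi g (F fx) = phi g fx.1 + fx.2 by rewrite phiD hv mulr1.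
have Fgs fx g' : g' \in gs -> phi g' (F fx) = phi g' fx.1.
  by move=> hg; rewrite phiD hvs // mulr0 addr0.
transitivity #|finset.setX S0 [set: 'I_N]%SET|; first by rewrite cardsX cardsT card_ord.
rewrite -(@card_in_imset _ _ F).
  apply: eq_card => f; apply/imsetP/idP.
    case=> fx; rewrite !inE => /andP[/andP[_ /allP h] _] ->.
    by apply/allP => g' hg'; rewrite Fgs ?h.
  rewrite inE => /allP h; exists (f - phi g f *: map_mx intr v, phi g f).
    rewrite !inE andbT; apply/andP; split.
      by rewrite -scaleNr phiD hv mulr1 subrr.
    by apply/allP => g' hg'; rewrite -scaleNr phiD hvs // mulr0 addr0 h.
  by rewrite /F /= subrK.
move=> [f x] [f' x']; rewrite !inE /= !andbT => /andP[/eqP h _] /andP[/eqP h' _] e.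
have ex' : x = x' by have := congr1 (phi g) e; rewrite !FgS /= h h' !add0r.
by move: e; rewrite /F /= ex' => /addIr ->.
Qed.

End Torsion.
End Dimension.

(** * The characteristic polynomial counts torsion points *)

Section Mobius.
Variables (R : realType) (l : nat).
Notation Pt := 'M[R]_(l, 2).
Variables (L : set (set Pt)) (E : set Pt) (cd : set Pt -> nat).
Hypotheses (Lfin : finite_set L) (LE : forall X, L X -> X `<=` E).
Hypotheses (cdl : forall X, (cd X <= l)%N).
Hypothesis cd_lt : forall X Y, L X -> L Y -> X `<=` Y -> X <> Y -> (cd Y < cd X)%N.

Lemma mob_fuelS n X : mob_fuel L E n.+1 X = if `[< X = E >] then 1
  else - \sum_(Y \in [set Y | L Y /\ X `<=` Y /\ X <> Y]) mob_fuel L E n Y.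
Proof. by []. Qed.

(** The codimension drops strictly at each recursive call, so fuel beyond [cd X] is never
    consumed. *)
Lemma mob_fuel_stable n X : L X -> (cd X < n)%N -> mob_fuel L E n X = mob_fuel L E n.+1 X.
Proof.
elim: n X => [//|n IH] X LX hX; rewrite [RHS]mob_fuelS mob_fuelS.
case: asboolP => // _; congr (- _); apply: eq_fsbigr => Y.
rewrite inE => -[LY [XY nXY]]; apply: IH => //.
by have := cd_lt LX LY XY nXY; lia.
Qed.

(** The defining recursion of the Moebius function, freed from fuel: the strictly larger layers are
    evaluated there with one unit less, which is harmless as their codimension is below that of
    [X]. *)
Lemma mob_fuel_sum X : L E -> L X ->
  \sum_(Y <- fset_set L | `[< X `<=` Y >]) mob_fuel L E l.+1 Y = (`[< X = E >] : nat)%:Z.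
Proof.
move=> LEE LX.
have Xin : X \in fset_set L by rewrite in_fset_set // inE.
rewrite big_mkcond (big_fsetD1 X) // asboolT //.
have rest : \sum_(Y <- (fset_set L `\ X)%fset) (if `[< X `<=` Y >] then mob_fuel L E l.+1 Y else 0)
   = \sum_(Y \in [set Y | L Y /\ X `<=` Y /\ X <> Y]) mob_fuel L E l.+1 Y.
  rewrite (_ : [set Y | _] = L `&` [set Y | X `<=` Y /\ X <> Y]) // fsbig_mkcondr fsbig_finite //.
  rewrite [RHS](big_fsetD1 X) //= ifF ?add0r; last by apply/negbTE; rewrite notin_setE => -[].
  rewrite !big_seq; apply: eq_bigr => Y; rewrite in_fsetD1 => /andP[/eqP YX _].
  congr (if _ then _ else _); apply/asboolP/idP; rewrite inE; last by case.
  by move=> XY; split=> // /esym.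
rewrite rest [LHS](_ : _ = mob_fuel L E l.+1 X +
  \sum_(Y \in [set Y | L Y /\ X `<=` Y /\ X <> Y]) mob_fuel L E l.+1 Y)
  // [X in X + _]mob_fuelS; case: asboolP => [XE|nXE].
  rewrite fsbig1 ?addr0 // => Y [LY [XY nXY]].
  by case: nXY; apply/seteqP; split=> //; rewrite XE; exact: LE.
apply/eqP; rewrite addrC subr_eq0; apply/eqP.
apply: eq_fsbigr => Y; rewrite inE => -[LY [XY nXY]].
rewrite -mob_fuel_stable //.
by have := cd_lt LX LY XY nXY; have := cdl X; lia.
Qed.

End Mobius.

(** * Layers as primitive cosets, and the count of points off the arrangement *)

Section CharPoly.
Variables (R : realType) (l : nat).
Notation Pt := 'M[R]_(l, 2).
Notation aff := ('rV[int]_l * R)%type.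
Implicit Types (g h : aff) (gs hs : seq aff) (th : 'rV[R]_l).

Definition Arr gs hs : set (set Pt) := [set K | exists2 h, h \in hs & K = Zs (h :: gs)].

(** Primitivity of [h :: gs] makes each hypersurface connected, hence a single element of the
    arrangement; a common denominator of the constants ensures that layers contain torsion
    points. *)
Definition arrangement gs hs :=
  [/\ prim gs, forall h, h \in hs -> prim (h :: gs)
    & exists2 N, (0 < N)%N & ratl N (hs ++ gs)].

Lemma ratl_dvd N N' gs : (N %| N')%N -> ratl N gs -> ratl N' gs.
Proof.
by case/dvdnP => k -> h g /h; rewrite natrM -mulrA => hg; rewrite rpredM ?natr_int.
Qed.

Lemma hyp_proper h gs : prim (h :: gs) -> ~ (Zs gs `<=` (Zs (h :: gs) : set Pt)).
Proof.
move=> hp hs; have [|th [h1 h2]] := prim_ev (ks := 2^-1 :: nseq (size gs) 0) hp.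
  by rewrite /= size_nseq.
have /hs/Zs_ex/(_ h) : Zs gs (ex th).
  apply/Zs_ex => g hg; have := congr1 (fun s => nth 0 s (index g gs)) h2.
  by rewrite (nth_map 0) ?index_mem // nth_index // nth_nseq if_same => ->; rewrite rpred0.
rewrite mem_head h1 => /(_ isT) /intrP[z hz].
have : (1 : R) = (z * 2)%:~R by rewrite intrM -hz mulVf // pnatr_eq0.
by rewrite -[1]/(1%:~R) => /intr_inj; lia.
Qed.

Definition sub_hyps (S : set (set Pt)) gs hs := [seq h <- hs | `[< S (Zs (h :: gs)) >]].

Lemma Zs_consE h gs : Zs (h :: gs) = Zs [:: h] `&` (Zs gs : set Pt).
Proof. exact: (Zs_cat [:: h] gs). Qed.

Lemma inter_in_Arr gs hs S : S `<=` Arr gs hs ->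
  inter_in (Zs gs) S = Zs (sub_hyps S gs hs ++ gs).
Proof.
move=> hS; apply/seteqP; split=> p.
  case=> -[th -> hth] hcap; apply/Zs_ex => g; rewrite mem_cat => /orP[|/hth //].
  rewrite mem_filter => /andP[/asboolP /hcap hg _].
  by move/Zs_ex: hg => /(_ g); rewrite mem_head; apply.
rewrite Zs_cat => -[h1 h2]; split=> // K SK; have [h hh eK] := hS K SK.
rewrite eK Zs_consE; split=> //; case: h1 => th -> hth; apply/Zs_ex => g; rewrite inE => /eqP ->.
by apply: hth; rewrite mem_filter hh andbT; apply/asboolP; rewrite -eK.
Qed.

(** [sub_hyps] only sees the members of [S] that belong to the arrangement, so [S] may be an
    arbitrary family of sets. *)
Lemma layersE gs hs X : layers (Zs gs) (Arr gs hs) X <->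
  exists S : set (set Pt), exists2 p, Zs (sub_hyps S gs hs ++ gs) p
      & X = connected_component (Zs (sub_hyps S gs hs ++ gs)) p.
Proof.
split=> [[S [hS [p [hp ->]]]]|[S [p hp ->]]].
  by exists S; exists p; rewrite -(inter_in_Arr hS).
pose S' := S `&` Arr gs hs.
have e : sub_hyps S' gs hs = sub_hyps S gs hs.
  apply: eq_in_filter => h hh; apply/asboolP/asboolP => [[]//|Sh]; split=> //.
  by exists h.
have hS' : S' `<=` Arr gs hs by move=> K [].
by exists S'; split=> //; exists p; rewrite (inter_in_Arr hS') e.
Qed.

(** Every layer is a component of one of the finitely many systems [mask bs hs ++ gs]; the product
    of the denominators from [component_Zs] over all masks serves all layers. *)
Lemma layers_prim gs hs : arrangement gs hs ->
  exists2 N, (0 < N)%N & [/\ ratl N (hs ++ gs) & forall X, layers (Zs gs) (Arr gs hs) X ->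
    exists gs', [/\ prim gs', ratl N gs' & X = Zs gs']].
Proof.
move=> [_ _ [N N0 hN]].
have /choice[F hF] : forall bs : (size hs).-tuple bool, exists N', [/\ (0 < N')%N, (N %| N')%N
   & forall p, Zs (mask bs hs ++ gs) p -> exists gs', [/\ prim gs', ratl N' gs', Zs gs' p &
       connected_component (Zs (mask bs hs ++ gs)) p = Zs gs']].
  move=> bs; apply: component_Zs => // g; rewrite mem_cat => /orP[/mem_mask|] hg; apply: hN;
    by rewrite mem_cat hg ?orbT.
exists (N * \prod_bs F bs)%N.
  by rewrite muln_gt0 N0; apply: prodn_gt0 => bs; have [] := hF bs.
split; first by apply: ratl_dvd hN; exact: dvdn_mulr.
move=> X /layersE[S [p hp ->]].
have hb : size (map (fun h => `[< S (Zs (h :: gs)) >]) hs) == size hs by rewrite size_map.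
move: hp; rewrite /sub_hyps filter_mask => hp.
have [_ _ /(_ p hp)[gs' [h1 h2 h3 h4]]] := hF (Tuple hb).
exists gs'; split=> //; apply: ratl_dvd h2.
by rewrite (bigD1 (Tuple hb)) //= dvdn_mull // dvdn_mulr.
Qed.

(** Every layer contains a torsion point of a fixed order, so it is determined by a mask and such a
    point. *)
Lemma layers_finite gs hs : arrangement gs hs -> finite_set (layers (Zs gs) (Arr gs hs)).
Proof.
move=> hA; have [N N0 [_ hN]] := layers_prim hA.
(* Doubling brings the order to at least 2, hence to the form [n.+2]. *)
pose n := (N * 2).-2.
have nE : n.+2 = (N * 2)%N by rewrite /n; lia.
pose F (x : (size hs).-tuple bool * 'rV['I_n.+2]_l) : set Pt :=
  connected_component (Zs (mask x.1 hs ++ gs)) (tpt R x.2).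
apply: (sub_finite_set (B := F @` setT)); last by apply: finite_image; exact: finite_finset.
move=> X LX; have [gs' [h1 h2 h3]] := hN X LX.
have h2' : ratl n.+2 gs' by apply: ratl_dvd h2; rewrite nE dvdn_mulr.
have : (0 < #|[set f : 'rV['I_n.+2]_l | all (fun g => phi g f == 0%R) gs']%SET|)%N.
  by rewrite card_Zs // expn_gt0.
case/card_gt0P => f; rewrite inE => /(tpt_Zs _ h2'); rewrite -h3 => Xf.
case/layersE: LX Xf => S [p hp ->] Xf.
have hb : size (map (fun h => `[< S (Zs (h :: gs)) >]) hs) == size hs by rewrite size_map.
exists (Tuple hb, f) => //; rewrite /F /= -filter_mask; apply/esym.
exact: same_connected_component.
Qed.

Lemma layers_full gs hs : prim gs -> layers (Zs gs) (Arr gs hs) (Zs gs).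
Proof.
move=> hp; have [p hp0] := prim_nonempty hp.
have e : sub_hyps set0 gs hs = [::].
  by apply/eqP; rewrite -(negbK (_ == _)) -has_filter; apply/hasPn => h _; apply/asboolPn.
apply/layersE; exists set0; rewrite e; exists p => //.
by rewrite connected_component_id //; exact: prim_connected.
Qed.

Lemma layers_sub gs hs X : layers (Zs gs) (Arr gs hs) X -> X `<=` (Zs gs : set Pt).
Proof.
by case/layersE => S [p _ ->] q /connected_component_sub; rewrite Zs_cat => -[].
Qed.

(** The layer is the component through [p] of the intersection of all hypersurfaces containing [p];
    any other layer through [p] is a component of an intersection of fewer of them. *)
Lemma smallest_layer gs hs p : Zs gs p -> exists2 X, layers (Zs gs) (Arr gs hs) X &
  (forall Y, layers (Zs gs) (Arr gs hs) Y -> Y p <-> X `<=` Y) /\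
  (arrangement gs hs -> X = Zs gs <-> forall h, h \in hs -> ~ Zs (h :: gs) p).
Proof.
move=> Zp; pose S := [set K : set Pt | K p].
have hS : Zs (sub_hyps S gs hs ++ gs) p.
  rewrite Zs_cat; split=> //; have [th pe _] := Zp; rewrite pe; apply/Zs_ex => g.
  rewrite mem_filter => /andP[/asboolP]; rewrite /S /= pe => /Zs_ex/(_ g).
  by rewrite mem_head => h _; apply: h.
exists (connected_component (Zs (sub_hyps S gs hs ++ gs)) p).
  by apply/layersE; exists S; exists p.
split.
  move=> Y /layersE[S' [q hq ->]]; split=> [Yp|]; last first.
    by apply; exact: connected_component_refl.
  rewrite (same_connected_component Yp).
  apply: connected_component_max; last exact: component_connected.
    exact: connected_component_refl.
  move=> r /connected_component_sub; rewrite !Zs_cat => -[[th -> hth] Zr]; split=> //.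
  apply/Zs_ex => g hg; apply: hth; move: hg; rewrite !mem_filter => /andP[/asboolP hg hgs].
  rewrite hgs andbT; apply/asboolP; rewrite /S /= Zs_consE; split=> //.
  move/connected_component_sub: Yp; rewrite Zs_cat => -[[th' -> hth'] _].
  apply/Zs_ex => g'; rewrite inE => /eqP ->; apply: hth'.
  by rewrite mem_filter hgs andbT; apply/asboolP.
move=> [hp hps _]; split=> [XE h hh hhp|hno].
  apply: (hyp_proper (hps h hh)); rewrite -{1}XE => q /connected_component_sub.
  rewrite Zs_cat Zs_consE => -[[th -> hth] Zq]; split=> //; apply/Zs_ex => g.
  rewrite inE => /eqP ->; apply: hth; rewrite mem_filter hh andbT; exact/asboolP.
have -> : sub_hyps S gs hs = [::].
  by apply/eqP; rewrite -(negbK (_ == _)) -has_filter; apply/hasPn => h /hno hn; apply/asboolPn.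
by rewrite connected_component_id //; exact: prim_connected.
Qed.

(* Every torsion point lies in a smallest layer, so summing the Moebius function over the
   layers through it leaves only the points on no hypersurface. *)
Theorem charpoly_count gs hs : arrangement gs hs -> exists2 N0, (0 < N0)%N &
  forall n, (N0 %| n.+2)%N -> (charpoly (Zs gs) (Arr gs hs)).[n.+2%:Z] =
   #|[pred f : 'rV['I_n.+2]_l | `[< Zs gs (tpt R f) /\
       forall h, h \in hs -> ~ Zs (h :: gs) (tpt R f) >]]|%:Z.
Proof.
move=> hA; have [N N0 [hr hN]] := layers_prim hA; exists N => // n Nn.
have [hp _ _] := hA.
set E := Zs gs; set L := layers E (Arr gs hs).
have Lfin : finite_set L by exact: layers_finite.
have LE X : L X -> X `<=` E by exact: layers_sub.
pose cd (X : set Pt) : nat := (l - dimL X)%N.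
have cdZ gs' : prim gs' -> cd (Zs gs') = size gs'.
  by move=> h; rewrite /cd dimL_Zs // subKn // prim_size.
have cd_lt X Y : L X -> L Y -> X `<=` Y -> X <> Y -> (cd Y < cd X)%N.
  move=> /hN[s [s1 _ ->]] /hN[s' [s1' _ ->]] h1 h2; rewrite !cdZ //.
  exact: Zs_proper_size h1 h2.
have cdl X : (cd X <= l)%N by exact: leq_subr.
rewrite /charpoly -/L fsbig_finite // horner_sum.
(* The power of [n.+2] with exponent the dimension of [X] is the number of torsion points on [X], by
   [dimL_Zs] and [card_Zs]. *)
transitivity (\sum_(X <- fset_set L) \sum_(f : 'rV['I_n.+2]_l | `[< X (tpt R f) >]) mobius E (Arr gs hs) X).
  rewrite !big_seq; apply: eq_bigr => X; rewrite in_fset_set // inE => /hN[s [s1 s2 ->]].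
  rewrite hornerM hornerC hornerXn sumr_const -[RHS]mulr_natr dimL_Zs // -[n.+2%:Z]natz -natrX; congr (_ * _%:R).
  rewrite -(card_Zs n s1); apply: eq_card => f; rewrite !inE.
  by apply/idP/asboolP => /tpt_Zs; apply; exact: ratl_dvd s2.
under eq_bigr do rewrite big_mkcond.
rewrite exchange_big /= -[RHS]natz -sum1_card natr_sum [RHS]big_mkcond; apply: eq_bigr => f _.
rewrite -big_mkcond /=.
have [Ef|nEf] := pselect (E (tpt R f)); last first.
  rewrite [in RHS]inE asboolF; last by case.
  rewrite big_seq_cond big_pred0 // => X; apply/negbTE/negP => /andP[].
  by rewrite in_fset_set // inE => /LE h /asboolP /h.
have [X0 LX0 [h1 /(_ hA) h2]] := smallest_layer hs Ef.
transitivity ((`[< X0 = E >] : nat)%:Z).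
  rewrite -(mob_fuel_sum Lfin LE cdl cd_lt) //; last exact: layers_full.
  rewrite big_seq_cond [RHS]big_seq_cond; apply: eq_bigl => Y.
  case: (boolP (Y \in _)) => //=; rewrite in_fset_set // inE => LY.
  by apply/asboolP/asboolP => /(h1 Y LY).
rewrite [in RHS]inE (asbool_equiv_eq (Q := X0 = E)); first by case: asbool.
split=> [[_ /h2]//|/h2]; by [].
Qed.

End CharPoly.

(** * Deletion and restriction *)

Section Step.
Variables (R : realType) (l : nat).
Notation Pt := 'M[R]_(l, 2).
Notation aff := ('rV[int]_l * R)%type.
Implicit Types (g h f : aff) (gs hs ts : seq aff) (th : 'rV[R]_l).

Lemma poly_eq_infinitely_often (p q : {poly int}) (N0 : nat) : (0 < N0)%N ->
  (forall n, (N0 %| n.+2)%N -> p.[n.+2%:Z] = q.[n.+2%:Z]) -> p = q.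
Proof.
move=> N00 H; apply/eqP; rewrite -subr_eq0; apply/eqP.
(* Distinct multiples of [N0] that are at least 2, in number the size of [p - q]: one more than its
   degree allows as roots. *)
pose F i := ((i.+2 * N0)%N)%:Z.
pose s := [seq F i | i <- iota 0 (size (p - q))].
apply: (@roots_geq_poly_eq0 _ _ s); last by rewrite size_map size_iota.
  apply/allP => x /mapP[i _ ->]; rewrite rootE hornerD hornerN subr_eq0 /F.
  have -> : (i.+2 * N0 = (i.+2 * N0).-2.+2)%N by nia.
  by apply/eqP/H; have <- : (i.+2 * N0 = (i.+2 * N0).-2.+2)%N; [nia|rewrite dvdn_mull].
rewrite map_inj_uniq ?iota_uniq // => i j [] /eqP.
by rewrite eqn_pmul2r // => /eqP [].
Qed.

Notation chi gs hs := (charpoly (Zs gs) (Arr gs hs)).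

Lemma chi_nil gs : prim gs -> ratl 2 gs -> chi gs [::] = 'X^(l - size gs).
Proof.
move=> hp hr.
have hA : arrangement gs [::] by split=> //; exists 2%N.
have [N N0 hN] := charpoly_count hA.
apply: (@poly_eq_infinitely_often _ _ (N * 2)); first by rewrite muln_gt0 N0.
move=> n hn; rewrite hN ?(dvdn_trans _ hn) ?dvdn_mulr // hornerXn.
rewrite -[n.+2%:Z]natz -natrX natz -(card_Zs n hp); congr (_%:Z).
have hr' : ratl n.+2 gs by apply: ratl_dvd hr; rewrite (dvdn_trans _ hn) ?dvdn_mull.
apply: eq_card => f; rewrite !inE; apply/asboolP/idP => [[/(tpt_Zs _ hr')//]|/(tpt_Zs _ hr')].
by [].
Qed.

(** At an order divisible by all three denominators, the points off [hs] are sorted by whether they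
    lie on [h]; those on [h] are the points of [Zs (h :: gs)] off [hs'']. *)
Lemma chi_del_res gs h hs hs'' : arrangement gs (h :: hs) -> arrangement (h :: gs) hs'' ->
  (forall p, Zs (h :: gs) p -> (exists2 h', h' \in hs & Zs (h' :: gs) p) <->
                               (exists2 t, t \in hs'' & Zs (t :: h :: gs) p)) ->
  chi gs (h :: hs) = chi gs hs - chi (h :: gs) hs''.
Proof.
move=> hA hA'' H.
have hA' : arrangement gs hs.
  have [h1 h2 [N N0 h3]] := hA; split=> // [h' hh|]; first by apply: h2; rewrite inE hh orbT.
  by exists N => // g hg; apply: h3; rewrite inE hg orbT.
have [N N0 hN] := charpoly_count hA.
have [N' N'0 hN'] := charpoly_count hA'.
have [N'' N''0 hN''] := charpoly_count hA''.
apply: (@poly_eq_infinitely_often _ _ (N * (N' * N''))); first by rewrite !muln_gt0 N0 N'0.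
move=> n hn; rewrite hornerD hornerN.
have d1 : (N %| n.+2)%N by rewrite (dvdn_trans _ hn) ?dvdn_mulr.
have d2 : (N' %| n.+2)%N by rewrite (dvdn_trans _ hn) // dvdn_mull // dvdn_mulr.
have d3 : (N'' %| n.+2)%N by rewrite (dvdn_trans _ hn) // !dvdn_mull.
rewrite hN // hN' // hN'' //; apply/eqP; rewrite eq_sym subr_eq; apply/eqP.
rewrite -PoszD; congr Posz.
rewrite -[LHS](cardID [pred f | `[< Zs (h :: gs) (tpt R f) >]]) addnC; congr (_ + _)%N.
  apply: eq_card => f; rewrite !inE; apply/andP/asboolP.
    move=> [/asboolPn h1 /asboolP[h2 h3]]; split; first exact: h2.
    by move=> h'; rewrite inE => /predU1P[->|]; [exact: h1|exact: h3].
  move=> [h1 h2]; split; first by apply/asboolPn; apply: h2; rewrite mem_head.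
  by apply/asboolP; split=> // h' hh; apply: h2; rewrite inE hh orbT.
apply: eq_card => f; rewrite !inE; apply/andP/asboolP.
  move=> [/asboolP[h2 h3] /asboolP h1]; split; [exact: h1|move=> t tt htt].
  have [|h' hh hh'] := (iffRL (H _ h1)); first by exists t.
  exact: h3 hh'.
move=> [h1 h2]; split; last exact/asboolP.
apply/asboolP; split; first by move: h1; rewrite Zs_consE => -[].
move=> h' hh hh'; have [|t tt htt] := (iffLR (H _ h1)); first by exists h'.
exact: h2 htt.
Qed.

(* On [f = 0] the hypersurface [h = 0] is the union of the [t = 0], [t] in [ts]; as each [t] takes
   finitely many values there, these are its components. *)
Definition splits f h ts :=
  (forall th, ev f th \is a Num.int ->
     (ev h th \is a Num.int) = has (fun t => ev t th \is a Num.int) ts) /\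
  (exists2 k, (0 < k)%N & forall t, t \in ts -> forall th, ev f th \is a Num.int ->
     ev h th \is a Num.int -> k%:R * ev t th \is a Num.int).

Lemma splits_Zs f h ts gs p : splits f h ts ->
  Zs (f :: gs) p -> Zs (h :: gs) p <-> exists2 t, t \in ts & Zs (t :: f :: gs) p.
Proof.
move=> [hs _] [th -> hth]; rewrite Zs_ex.
have hf : ev f th \is a Num.int by apply: hth; rewrite mem_head.
have -> : (forall g, g \in h :: gs -> ev g th \is a Num.int) <-> ev h th \is a Num.int.
  split=> [|hh g]; first by apply; rewrite mem_head.
  by rewrite inE => /predU1P[->//|hg]; apply: hth; rewrite inE hg orbT.
rewrite (hs th hf); split=> [/hasP[t tt ht]|[t tt /Zs_ex/(_ t)]].
  by exists t => //; apply/Zs_ex => g; rewrite inE => /predU1P[->//|/hth].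
by rewrite mem_head => h1; apply/hasP; exists t => //; apply: h1.
Qed.

(** Arrangements are sets of sets, so deleting [f] removes nothing else only if the other
    hypersurfaces differ from it as sets. *)
Lemma splits_neq f h ts gs : prim (f :: gs) -> (forall t, t \in ts -> prim (t :: f :: gs)) ->
  splits f h ts -> Zs (h :: gs) <> Zs (f :: gs).
Proof.
move=> hp hpt hs; case: ts hpt hs => [|t ts] hpt hs heq.
  have [p hp0] := prim_nonempty hp.
  have := hp0; rewrite -heq => /(splits_Zs hs hp0)[t]; by rewrite in_nil.
have [_ [k k0 hk]] := hs.
(* With [t] equal to [1 / (2 k)], the product [k * t] is one half, so this point of [f] is not on
   [h]. *)
have [|th [h1 h2 h3]] := prim_ev (ks := (k%:R * 2)^-1 :: 0 :: nseq (size gs) 0) (hpt t (mem_head _ _)).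
  by rewrite /= size_nseq.
have hf : ev f th \is a Num.int by rewrite h2 rpred0.
have : Zs (f :: gs) (ex th).
  apply/Zs_ex => g; rewrite inE => /predU1P[->//|hg].
  have := congr1 (fun s => nth 0 s (index g gs)) h3.
  by rewrite (nth_map 0) ?index_mem // nth_index // nth_nseq if_same => ->; rewrite rpred0.
rewrite -heq => /Zs_ex/(_ h); rewrite mem_head => /(_ isT) hh.
have := hk t (mem_head _ _) th hf hh; rewrite h1 invfM mulrA mulfV ?mul1r ?pnatr_eq0 -?lt0n //.
move=> /intrP[z hz].
have : (1 : R) = (z * 2)%:~R by rewrite intrM -hz mulVf // pnatr_eq0.
by rewrite -[1]/(1%:~R) => /intr_inj; lia.
Qed.

Lemma splits_component f h ts gs t p : prim (t :: f :: gs) -> splits f h ts -> t \in ts ->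
  Zs (t :: f :: gs) p ->
  connected_component (Zs (h :: gs) `&` Zs (f :: gs)) p = Zs (t :: f :: gs).
Proof.
move=> hp hs tt Zp; apply/seteqP; split; last first.
  apply: connected_component_max => //; last exact: prim_connected.
  move=> q Zq; have Zfq : Zs (f :: gs) q by move: Zq; rewrite Zs_consE => -[].
  by split=> //; apply/(splits_Zs hs Zfq); exists t.
move=> q hq; have [Zhq Zfq] := connected_component_sub hq.
have Zfp : Zs (f :: gs) p by move: Zp; rewrite Zs_consE => -[].
rewrite Zs_consE; split=> //.
have [_ [k k0 hk]] := hs.
case: (Zp) => thp ep hthp; case: (Zfq) => thq eq hthq.
rewrite eq; apply/Zs_ex => g; rewrite inE => /eqP ->.
rewrite -[ev t thq](subrK (ev t thp)) rpredD ?hthp ?mem_head //.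
apply: (@connected_ev_int _ _ (connected_component (Zs (h :: gs) `&` Zs (f :: gs)) p) k t) => //; rewrite -?ep -?eq //.
- exact: component_connected.
- by move=> r /connected_component_sub[[x -> _] _]; exact: torus_ex.
- move=> th /connected_component_sub[/Zs_ex/(_ h) h1 /Zs_ex/(_ f) h2].
  by apply: hk => //; [apply: h2|apply: h1]; rewrite mem_head.
- by apply: connected_component_refl; split=> //; apply/(splits_Zs hs Zfp); exists t.
Qed.

Lemma restriction_Arr gs f hs hs'' (tsf : aff -> seq aff) :
  arrangement (f :: gs) hs'' -> (forall h, h \in hs -> splits f h (tsf h)) ->
  (forall h, h \in hs -> {subset tsf h <= hs''}) ->
  (forall t, t \in hs'' -> exists2 h, h \in hs & t \in tsf h) ->
  restriction (Arr gs (f :: hs)) (Zs (f :: gs)) = Arr (f :: gs) hs''.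
Proof.
move=> [hp hpt _] hs1 hs2 hs3; apply/seteqP; split=> Y.
  case=> K [[[h + ->] hne] [p [[Kp Hp] ->]]].
  rewrite inE => /predU1P[hf|hh]; first by case: hne; rewrite hf.
  have [t tt Ztp] := iffLR (splits_Zs (hs1 h hh) Hp) Kp.
  exists t; first exact: (hs2 _ hh _ tt).
  by apply: (splits_component _ (hs1 h hh) tt Ztp); apply: hpt; exact: (hs2 _ hh _ tt).
case=> t tt ->; have [h hh tth] := hs3 t tt.
have [p Zp] := prim_nonempty (hpt t tt).
have Zfp : Zs (f :: gs) p by move: Zp; rewrite Zs_consE => -[].
exists (Zs (h :: gs)); split.
  split; first by exists h => //; rewrite inE hh orbT.
  by apply: (splits_neq hp _ (hs1 h hh)) => t' /(hs2 h hh); exact: hpt.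
exists p; split; first by split=> //; apply/(splits_Zs (hs1 h hh) Zfp); exists t.
by rewrite (splits_component _ (hs1 h hh) tth Zp) //; exact: hpt.
Qed.

(** The polynomial accompanies inductiveness because the divisibility condition of the next step
    compares two such polynomials. *)
Definition indchi gs hs (q : {poly int}) :=
  [/\ arrangement gs hs, Ind (Zs gs) (Arr gs hs) & chi gs hs = q].

Lemma indchi_step gs f hs hs'' (tsf : aff -> seq aff) (d : int) q :
  prim (f :: gs) -> ratl 2 [:: f] -> 
  indchi gs hs (('X - d%:P) * q) -> indchi (f :: gs) hs'' q ->
  (forall h, h \in hs -> splits f h (tsf h)) ->
  (forall h, h \in hs -> {subset tsf h <= hs''}) ->
  (forall t, t \in hs'' -> exists2 h, h \in hs & t \in tsf h) ->
  indchi gs (f :: hs) (('X - (d + 1)%:P) * q).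
Proof.
move=> hpf hrf [hA hI hc] [hA'' hI'' hc''] hs1 hs2 hs3.
have hA1 : arrangement gs (f :: hs).
  have [h1 h2 [N N0 h3]] := hA; split=> // [h|].
    by rewrite inE => /predU1P[->|/h2].
  exists (N * 2)%N; first by rewrite muln_gt0 N0.
  move=> g; rewrite inE => /predU1P[->|hg].
    by apply: (ratl_dvd _ hrf); rewrite ?mem_head ?dvdn_mull.
  by apply: (ratl_dvd _ h3) => //; rewrite dvdn_mulr.
have hneq h : h \in hs -> Zs (h :: gs) <> Zs (f :: gs).
  have [_ hpt _] := hA''.
  by move=> hh; apply: (splits_neq hpf _ (hs1 h hh)) => t /(hs2 h hh); exact: hpt.
have hdel : deletion (Arr gs (f :: hs)) (Zs (f :: gs)) = Arr gs hs.
  apply/seteqP; split=> K.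
    by case=> -[h + ->] hne; rewrite inE => /predU1P[hf|hh]; [case: hne; rewrite hf|exists h].
  by case=> h hh ->; split; [exists h => //; rewrite inE hh orbT|exact: hneq].
have hres := restriction_Arr hA'' hs1 hs2 hs3.
split=> //.
  apply: (@Ind_step _ _ _ _ (Zs (f :: gs))).
  - by exists f => //; rewrite mem_head.
  - by rewrite hdel.
  - by rewrite hres.
  - by exists d; rewrite hdel hres hc hc''.
rewrite (chi_del_res hA1 hA'').
  by rewrite hc hc'' polyCD opprD addrA [RHS]mulrBl mul1r.
move=> p Zp; split=> [[h hh]|[t tt Ztp]].
  by move/(splits_Zs (hs1 h hh) Zp) => [t tt ?]; exists t => //; exact: (hs2 _ hh _ tt).
have [h hh tth] := hs3 t tt; exists h => //.
by apply/(splits_Zs (hs1 h hh) Zp); exists t.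
Qed.

Lemma indchi_nil gs : prim gs -> ratl 2 gs -> indchi gs [::] 'X^(l - size gs).
Proof.
move=> hp hr; split; [by split=> //; exists 2%N| |exact: chi_nil].
suff -> : Arr gs [::] = set0 by exact: Ind_empty.
by apply/seteqP; split=> K // [h]; rewrite in_nil.
Qed.

End Step.

(** * Adding a batch of hypersurfaces with a common restriction polynomial *)

Section Chain.
Variables (R : realType) (l : nat).
Notation aff := ('rV[int]_l * R)%type.
Implicit Types (gs hs : seq aff).
Variables (F : eqType) (I : F -> aff).

(** The list is determined by [S] only up to order, so classes can be given as predicates on
    labels. *)
Definition good gs (S : pred F) q :=
  exists s : seq F, [/\ uniq s, s =i S & indchi gs (map I s) q].

(** Every trace in [hs''] already arises from [S0], so the restriction to [f] is the same whichever
    part of [fs] has been added before; this is why a batch may be added in any order. *)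
Lemma good_chain gs (S0 : pred F) (fs : seq F) (d : int) q :
  good gs S0 (('X - d%:P) * q) -> uniq fs -> (forall f : F, f \in fs -> ~~ S0 f) ->
  (forall f : F, f \in fs -> prim (I f :: gs) /\ ratl 2 [:: I f]) ->
  (forall f : F, f \in fs -> exists hs'', exists tsf : F -> seq aff,
     [/\ indchi (I f :: gs) hs'' q,
         forall h : F, (h \in fs) || S0 h -> h != f ->
           splits (I f) (I h) (tsf h) /\ {subset tsf h <= hs''}
       & forall t, t \in hs'' -> exists2 h : F, S0 h & t \in tsf h]) ->
  good gs (fun a => (a \in fs) || S0 a) (('X - (d + (size fs)%:Z)%:P) * q).
Proof.
move=> [s0 [us0 hs0 hi0]] ufs dfs hfs hres.
suff: indchi gs (map I (fs ++ s0)) (('X - (d + (size fs)%:Z)%:P) * q).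
  exists (fs ++ s0); split=> //.
    by rewrite cat_uniq ufs us0 andbT /=; apply/hasPn => f /=; rewrite hs0 => h; apply/negP => /dfs/negP.
  by move=> a; rewrite mem_cat hs0.
suff H (fs1 : seq F) : uniq fs1 -> {subset fs1 <= fs} ->
    indchi gs (map I (fs1 ++ s0)) (('X - (d + (size fs1)%:Z)%:P) * q) by exact: H.
elim: fs1 => [|f fs1 IH] /=; first by move=> _ _; rewrite [d + _]addr0.
case/andP=> ffs1 ufs1 hsub.
have {}IH : indchi gs (map I (fs1 ++ s0)) (('X - (d + (size fs1)%:Z)%:P) * q).
  by apply: IH => // g hg; apply: hsub; rewrite inE hg orbT.
have ff : f \in fs by apply: hsub; rewrite mem_head.
have [hpf hrf] := hfs f ff.
have [hs'' [tsf [h1 h2 h3]]] := hres f ff.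
have hcov (h : F) : h \in fs1 ++ s0 -> splits (I f) (I h) (tsf h) /\ {subset tsf h <= hs''}.
  rewrite mem_cat hs0 => hh; apply: h2.
    by case/orP: hh => hh; apply/orP; [left; apply: hsub; rewrite inE hh orbT|right].
  by apply: contraTneq hh => ->; rewrite negb_or ffs1; exact: dfs.
(* Traces are given per label but wanted per affine function, and [I] is not assumed injective: the
   traces of all labels over [a] are gathered. *)
pose tsf' (a : aff) : seq aff := flatten [seq tsf h | h <- fs1 ++ s0 & I h == a].
rewrite (_ : d + (size fs1).+1%:Z = d + (size fs1)%:Z + 1); last by rewrite -addrA -PoszD addn1.
apply: (indchi_step (tsf := tsf') hpf hrf IH h1).
- move=> _ /mapP[h hh ->]; split=> [th hth|].
    apply/idP/hasP => [hi|[t /flattenP[_ /mapP[h' + ->] tt] ht]].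
      have [sp1 _] := (hcov h hh).1; move: hi; rewrite (sp1 th hth) => /hasP[t tt ht].
      exists t => //; apply/flattenP; exists (tsf h) => //; apply: map_f.
      by rewrite mem_filter eqxx.
    rewrite mem_filter => /andP[/eqP e hh']; rewrite -e.
    by have [sp1 _] := (hcov h' hh').1; rewrite (sp1 th hth); apply/hasP; exists t.
  have /choice[k hk] : forall h' : F, exists k, (0 < k)%N /\ (h' \in fs1 ++ s0 ->
     forall t, t \in tsf h' -> forall th, ev (I f) th \is a Num.int ->
     ev (I h') th \is a Num.int -> k%:R * ev t th \is a Num.int).
    move=> h'; have [hh'|_] := boolP (h' \in fs1 ++ s0); last by exists 1%N.
    by have [[_ [k k0 sp]] _] := hcov h' hh'; exists k.
  exists (\prod_(h' <- fs1 ++ s0) k h')%N; first by apply: prodn_gt0 => h'; have [] := hk h'.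
  move=> t /flattenP[_ /mapP[h' + ->] tt] th hth hi; rewrite mem_filter => /andP[/eqP e hh'].
  have [_ /(_ hh' t tt th hth)] := hk h'; rewrite e => /(_ hi) hint.
  rewrite (big_rem h') //= natrM mulrAC rpredM ?natr_int //.
- move=> _ /mapP[h hh ->] t /flattenP[_ /mapP[h' + ->] tt].
  by rewrite mem_filter => /andP[_ hh']; apply: (hcov h' hh').2.
- move=> t /h3[h hh tt]; exists (I h).
    by apply: map_f; rewrite mem_cat hs0; apply/orP; right.
  apply/flattenP; exists (tsf h) => //; apply: map_f; rewrite mem_filter eqxx mem_cat hs0.
  by apply/orP; right.
Qed.

Lemma good_eq gs (S S' : pred F) q q' : S =1 S' -> q = q' -> good gs S q -> good gs S' q'.
Proof.
by move=> hS <- [s [h1 h2 h3]]; exists s; split=> // a; rewrite h2; exact: hS.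
Qed.

Lemma good_nil gs (S : pred F) : (forall a, S a = false) -> prim gs -> ratl 2 gs ->
  good gs S 'X^(l - size gs).
Proof.
move=> hS hp hr; exists [::]; split=> //; last exact: indchi_nil.
by move=> a; rewrite in_nil; apply/esym/hS.
Qed.

End Chain.

(** * Arrangements of signed graphs *)

(* The hypersurfaces [e_i - e_j = 0], [e_i + e_j = 0], [e_i = 0], [e_i = 1/2] and [2 e_i = 0]. *)
Inductive atom := ESub of nat & nat | EAdd of nat & nat | EOne of nat | ENeg of nat | EDbl of nat.
HB.instance Definition _ := gen_eqMixin atom.

Lemma atom_eqE :
  (((forall i j v, (ESub i j == EOne v) = false) * (forall i j v, (EAdd i j == EOne v) = false) *
   (forall i j v, (ESub i j == ENeg v) = false) * (forall i j v, (EAdd i j == ENeg v) = false)) *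
   ((forall i v, (EOne i == ENeg v) = false) * (forall i v, (ENeg i == EOne v) = false) *
   (forall i v, (EDbl i == EOne v) = false) * (forall i v, (EDbl i == ENeg v) = false)) *
   ((forall i v, (EOne i == EOne v) = (i == v)) * (forall i v, (ENeg i == ENeg v) = (i == v))))%type.
Proof. by do !split=> *; try exact/eqP; apply/eqP/eqP => [[]|->]. Qed.

(** The kinds of hypersurface on which traces are computed by [res_atom]; the hypersurface
    [2 e_v = 0] is treated through [dbl_trace]. *)
Inductive kind := KSub | KAdd | KOne | KNeg.

Definition mkSub v w := if (v < w)%N then ESub v w else ESub w v.
Definition mkAdd v w := if (v < w)%N then EAdd v w else EAdd w v.

Definition kind_atom k v w :=
  match k with KSub => mkSub v w | KAdd => mkAdd v w | KOne => EOne v | KNeg => ENeg v end.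

Definition atom_wf h := match h with ESub i j | EAdd i j => (i < j)%N | _ => true end.

Definition involves v h :=
  match h with ESub i j | EAdd i j => (i == v) || (j == v) | EOne i | ENeg i | EDbl i => i == v end.

(* The hyperplanes cut out by the atom [h] on the hyperplane [kind_atom k v w], expressed
   without the vertex [v]; [2 * e_w = 0] is one component if [b] (it is the atom [EDbl w]),
   and two components otherwise. *)
Definition res_atom (b : bool) k v w h : seq atom :=
  let dbl := if b then [:: EDbl w] else [:: EOne w; ENeg w] in
  match h with
  | ESub i j => if (i == v) || (j == v) then
      let u := if i == v then j else i in
      match k with
      | KSub => [:: mkSub w u] | KAdd => if u == w then dbl else [:: mkAdd w u]
      | KOne => [:: EOne u] | KNeg => [:: ENeg u] end
    else [:: h]
  | EAdd i j => if (i == v) || (j == v) then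
      let u := if i == v then j else i in
      match k with
      | KSub => if u == w then dbl else [:: mkAdd w u] | KAdd => [:: mkSub w u]
      | KOne => [:: EOne u] | KNeg => [:: ENeg u] end
    else [:: h]
  | EOne i => if i == v then match k with KSub | KAdd => [:: EOne w] | _ => [::] end else [:: h]
  | ENeg i => if i == v then match k with KSub | KAdd => [:: ENeg w] | _ => [::] end else [:: h]
  | EDbl i => if i == v then match k with KSub | KAdd => [:: EDbl w] | _ => [::] end else [:: h]
  end.

Section AtomValues.
Variable R : realType.
Implicit Types (x y z : R) (a : nat -> R).

Definition atom_val a h : R :=
  match h with
  | ESub i j => a i - a j | EAdd i j => a i + a j
  | EOne i => a i | ENeg i => a i + 2^-1 | EDbl i => a i *+ 2
  end.

Notation int x := (x \is a Num.int).

Lemma intB_eq x y : int (x - y) -> int x = int y.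
Proof. by move=> h; rewrite -[x](subrK y) rpredDl. Qed.

Lemma intD_eq x y : int (x + y) -> int x = int y.
Proof. by move=> h; rewrite -(rpredN _ y); apply: intB_eq; rewrite opprK. Qed.

Lemma int_half : int (2^-1 : R) = false.
Proof.
apply/negbTE/negP => /intrP[z hz].
have : (1 : R) = (z * 2)%:~R by rewrite intrM -hz mulVf // pnatr_eq0.
by rewrite -[1]/(1%:~R) => /intr_inj; lia.
Qed.

Lemma half_add_half : 2^-1 + 2^-1 = 1 :> R.
Proof. by lra. Qed.

(** The parity of [2 x] decides between the alternatives. This is the origin of the extra component
    [e_w = 1/2]. *)
Lemma int_double x : int (x *+ 2) = int x || int (x + 2^-1).
Proof.
apply/idP/orP => [/intrP[z hz]|[h|h]]; last 2 first.
- by rewrite rpredMn.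
- by rewrite -(intB_eq (x := (x + 2^-1) *+ 2)) ?rpredMn // mulrnDl addrAC subrr add0r mulr2n half_add_half rpred1.
have e : z%:~R = (z %/ 2)%Z%:~R * 2 + (z %% 2)%Z%:~R :> R.
  by rewrite {1}(divz_eq z 2) rmorphD rmorphM.
have [h0|h1] : (z %% 2)%Z = 0 \/ (z %% 2)%Z = 1 by lia.
  left; have -> : x = (z %/ 2)%Z%:~R by rewrite h0 in e; lra.
  exact: intr_int.
right; have -> : x + 2^-1 = (z %/ 2)%Z%:~R + 1 by rewrite h1 in e; lra.
by rewrite rpredD ?rpred1 // intr_int.
Qed.

Lemma int_val_mkSub a v w : int (atom_val a (mkSub v w)) = int (a v - a w).
Proof. by rewrite /mkSub; case: ifP => //= _; rewrite -rpredN opprB. Qed.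

Lemma int_val_mkAdd a v w : int (atom_val a (mkAdd v w)) = int (a v + a w).
Proof. by rewrite /mkAdd; case: ifP => //= _; rewrite addrC. Qed.

(** Modulo integers the equation of [kind_atom k v w] eliminates [a v], and each case is this
    substitution. Empty lists record that [e_v = 0] and [e_v = 1/2] are disjoint; [2 e_v = 0]
    contains both, hence the condition on [EDbl]. The factor 2 is the bound required by [splits]. *)
Lemma res_atom_val b k v w h a : atom_wf h -> h != kind_atom k v w ->
  (if h is EDbl i then (k = KSub) \/ (k = KAdd) else True) ->
  int (atom_val a (kind_atom k v w)) ->
  int (atom_val a h) = has (fun t => int (atom_val a t)) (res_atom b k v w h) /\
  (forall t, t \in res_atom b k v w h -> int (atom_val a h) -> int (2%:R * atom_val a t)).
Proof.
have one g t : int (atom_val a g) = int (atom_val a t) ->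
    int (atom_val a g) = has (fun t => int (atom_val a t)) [:: t] /\
    (forall t', t' \in [:: t] -> int (atom_val a g) -> int (2%:R * atom_val a t')).
  move=> e; split; first by rewrite /= orbF.
  by move=> t'; rewrite inE => /eqP ->; rewrite e => hi; rewrite rpredM ?natr_int.
have two g u : int (atom_val a g) = int (a u *+ 2) ->
    let s := if b then [:: EDbl u] else [:: EOne u; ENeg u] in
    int (atom_val a g) = has (fun t => int (atom_val a t)) s /\
    (forall t', t' \in s -> int (atom_val a g) -> int (2%:R * atom_val a t')).
  case: b => e /=; first exact: (one g (EDbl u) e).
  split; first by rewrite e int_double orbF.
  move=> t'; rewrite !inE e => /orP[] /eqP -> hi /=; rewrite mulr_natl //.
  by rewrite mulrnDl rpredD // mulr2n half_add_half rpred1.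
have none g : int (atom_val a g) = false ->
    int (atom_val a g) = has (fun t => int (atom_val a t)) [::] /\
    (forall t', t' \in [::] -> int (atom_val a g) -> int (2%:R * atom_val a t')).
  by move=> ->.
case: h => [i j|i j|i|i|i]; rewrite /res_atom.
- move=> ij hne _ hf; case: (eqVneq i v) hne ij => [->|iv].
    move=> hne vj; case: k hf hne => hf hne.
    + apply: (one (ESub v j)); rewrite int_val_mkSub /=; rewrite int_val_mkSub in hf.
      by apply: intB_eq; rewrite (_ : _ - _ = a v - a w) //; ring.
    + rewrite /=; case: (eqVneq j w) => [->|_].
        apply: (two (ESub v w)) => /=; rewrite int_val_mkAdd in hf.
        by rewrite -(rpredN _ (_ *+ 2)); apply: intB_eq; rewrite (_ : _ - _ = a v + a w) //; ring.
      apply: (one (ESub v j)); rewrite int_val_mkAdd /=; rewrite int_val_mkAdd in hf.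
      by apply: intD_eq; rewrite (_ : _ + _ = a v + a w) //; ring.
    + by apply: (one (ESub v j)) => /=; apply: intD_eq; rewrite (_ : _ + _ = a v) //; ring.
    + apply: (one (ESub v j)) => /=; apply: intD_eq; rewrite (_ : _ + _ = a v + 2^-1) //.
      by ring.
  case: (eqVneq j v) => [->|jv] hne iv'; last exact: (one (ESub i j)).
  case: k hf hne => hf hne.
  + apply: (one (ESub i v)); rewrite int_val_mkSub /=; rewrite int_val_mkSub in hf.
    by apply: intD_eq; rewrite (_ : _ + _ = - (a v - a w)) ?rpredN //; ring.
  + rewrite /=; case: (eqVneq i w) => [->|_].
      apply: (two (ESub w v)) => /=; rewrite int_val_mkAdd in hf.
      by apply: intB_eq; rewrite (_ : _ - _ = - (a v + a w)) ?rpredN //; ring.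
    apply: (one (ESub i v)); rewrite int_val_mkAdd /=; rewrite int_val_mkAdd in hf.
    by apply: intB_eq; rewrite (_ : _ - _ = - (a v + a w)) ?rpredN //; ring.
  + by apply: (one (ESub i v)) => /=; apply: intB_eq; rewrite (_ : _ - _ = - a v) ?rpredN //; ring.
  + apply: (one (ESub i v)) => /=; apply: intB_eq; rewrite (_ : _ - _ = - (a v + 2^-1)) ?rpredN //.
    by ring.
- move=> ij hne _ hf; case: (eqVneq i v) hne ij => [->|iv].
    move=> hne vj; case: k hf hne => hf hne.
    + rewrite /=; case: (eqVneq j w) => [->|_].
        apply: (two (EAdd v w)) => /=; rewrite int_val_mkSub in hf.
        by apply: intB_eq; rewrite (_ : _ - _ = a v - a w) //; ring.
      apply: (one (EAdd v j)); rewrite int_val_mkAdd /=; rewrite int_val_mkSub in hf.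
      by apply: intB_eq; rewrite (_ : _ - _ = a v - a w) //; ring.
    + apply: (one (EAdd v j)); rewrite int_val_mkSub /=; rewrite int_val_mkAdd in hf.
      by apply: intD_eq; rewrite (_ : _ + _ = a v + a w) //; ring.
    + by apply: (one (EAdd v j)) => /=; apply: intB_eq; rewrite (_ : _ - _ = a v) //; ring.
    + apply: (one (EAdd v j)) => /=; apply: intB_eq; rewrite (_ : _ - _ = a v + 2^-1 - (2^-1 + 2^-1)).
        by rewrite half_add_half rpredB ?rpred1.
      by ring.
  case: (eqVneq j v) => [->|jv] hne iv'; last exact: (one (EAdd i j)).
  case: k hf hne => hf hne.
  + rewrite /=; case: (eqVneq i w) => [->|_].
      apply: (two (EAdd w v)) => /=; rewrite int_val_mkSub in hf.
      by apply: intB_eq; rewrite (_ : _ - _ = a v - a w) //; ring.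
    apply: (one (EAdd i v)); rewrite int_val_mkAdd /=; rewrite int_val_mkSub in hf.
    by apply: intB_eq; rewrite (_ : _ - _ = a v - a w) //; ring.
  + apply: (one (EAdd i v)); rewrite int_val_mkSub /=; rewrite int_val_mkAdd in hf.
    by apply: intD_eq; rewrite (_ : _ + _ = a v + a w) //; ring.
  + by apply: (one (EAdd i v)) => /=; apply: intB_eq; rewrite (_ : _ - _ = a v) //; ring.
  + apply: (one (EAdd i v)) => /=; apply: intB_eq; rewrite (_ : _ - _ = a v + 2^-1 - (2^-1 + 2^-1)).
      by rewrite half_add_half rpredB ?rpred1.
    by ring.
- move=> _ hne _ hf; case: (eqVneq i v) hne => [->|iv] hne; last exact: (one (EOne i)).
  case: k hf hne => hf hne.
  + apply: (one (EOne v)) => /=; rewrite int_val_mkSub in hf; exact: intB_eq.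
  + apply: (one (EOne v)) => /=; rewrite int_val_mkAdd in hf; exact: intD_eq.
  + by case/eqP: hne.
  + apply: (none (EOne v)) => /=; apply: contraFF int_half => hv.
    by rewrite -(intB_eq (x := a v + 2^-1)) // addrK.
- move=> _ hne _ hf; case: (eqVneq i v) hne => [->|iv] hne; last exact: (one (ENeg i)).
  case: k hf hne => hf hne.
  + apply: (one (ENeg v)) => /=; rewrite int_val_mkSub in hf.
    by apply: intB_eq; rewrite (_ : _ - _ = a v - a w) //; ring.
  + apply: (one (ENeg v)) => /=; rewrite int_val_mkAdd in hf.
    apply: intD_eq; rewrite (_ : _ + _ = a v + a w + (2^-1 + 2^-1)).
      by rewrite half_add_half rpredD ?rpred1.
    by ring.
  + apply: (none (ENeg v)) => /=; apply: contraFF int_half => hv.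
    by rewrite -(intB_eq (x := a v + 2^-1)) // addrK.
  + by case/eqP: hne.
- move=> _ hne hk hf; case: (eqVneq i v) hne => [->|iv] hne; last exact: (one (EDbl i)).
  case: k hk hf hne => hk hf hne; try by case: hk.
  + apply: (one (EDbl v)) => /=; rewrite int_val_mkSub in hf.
    by apply: intB_eq; rewrite (_ : _ - _ = (a v - a w) *+ 2) ?rpredMn //; ring.
  + apply: (one (EDbl v)) => /=; rewrite int_val_mkAdd in hf.
    by apply: intD_eq; rewrite (_ : _ + _ = (a v + a w) *+ 2) ?rpredMn //; ring.
Qed.

End AtomValues.

(** * Atoms realised as affine functions on a coset *)

Section Fiber.
Variables (R : realType) (l : nat).
Notation aff := ('rV[int]_l * R)%type.
Implicit Types (gs : seq aff) (y : nat -> aff).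

(** The numbers [a i] play the role of the [e_i], which need not be characters themselves; [D]
    selects the atoms that [I] realises. *)
Definition valued (I : atom -> aff) (D : pred atom) :=
  forall th, exists a : nat -> R, forall h, D h -> ev (I h) th = atom_val a h.

Lemma splits_res_atom (I : atom -> aff) (D : pred atom) b k v w h :
  valued I D -> D h -> D (kind_atom k v w) -> all D (res_atom b k v w h) ->
  atom_wf h -> h != kind_atom k v w ->
  (if h is EDbl i then (k = KSub) \/ (k = KAdd) else True) ->
  splits (I (kind_atom k v w)) (I h) (map I (res_atom b k v w h)).
Proof.
move=> hI Dh Df /allP Dr wfh hne hk; split=> [th|].
  have [a ha] := hI th; rewrite (ha _ Dh) (ha _ Df) => hf.
  have [-> _] := res_atom_val b wfh hne hk hf.
  by rewrite has_map; apply: eq_in_has => t tt /=; rewrite ha ?Dr.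
exists 2%N => // _ /mapP[t tt ->] th; have [a ha] := hI th.
rewrite (ha _ Dh) (ha _ Df) (ha _ (Dr t tt)) => hf.
by have [_ H] := res_atom_val b wfh hne hk hf; exact: H.
Qed.

(** The case of [good_chain] where all of [fs] passes through one vertex [v]. An atom of [S0] that
    avoids [v] is its own trace, which usually accounts for all of [S2]. *)
Lemma good_fiber (I : atom -> aff) (D : pred atom) gs (S0 : pred atom)
    (fs : seq atom) b v (d : int) q :
  valued I D -> good I gs S0 (('X - d%:P) * q) -> uniq fs ->
  (forall f, f \in fs -> ~~ S0 f) ->
  (forall h, (h \in fs) || S0 h -> D h /\ atom_wf h) ->
  (forall f, f \in fs -> prim (I f :: gs) /\ ratl 2 [:: I f]) ->
  (forall f, f \in fs -> exists k w (S2 : pred atom),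
    [/\ f = kind_atom k v w, good I (I f :: gs) S2 q,
     (forall h, (h \in fs) || S0 h -> h != f ->
       (if h is EDbl i then (k = KSub) \/ (k = KAdd) else True) /\
       all S2 (res_atom b k v w h)) &
     (forall t, S2 t -> D t /\ exists2 h, S0 h & t \in res_atom b k v w h)]) ->
  good I gs (fun a => (a \in fs) || S0 a) (('X - (d + (size fs)%:Z)%:P) * q).
Proof.
move=> hI h0 ufs hdis hD hf hres; apply: good_chain => // f ff.
have [k [w [S2 [fE [s [us hs hi]] h1 h2]]]] := hres f ff.
have [Df _] : D f /\ atom_wf f by apply: hD; rewrite ff.
exists (map I s), (fun h => map I (res_atom b k v w h)); split=> //.
  move=> h hh hne; have [hk hall] := h1 h hh hne; have [Dh wfh] := hD h hh; split.
    rewrite fE; apply: (splits_res_atom (D := D)); rewrite -?fE //.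
    by apply/allP => t /(allP hall) /h2[].
  by move=> _ /mapP[t tt ->]; apply: map_f; rewrite hs; exact: (allP hall).
move=> _ /mapP[t + ->]; rewrite hs => /h2[_ [h hh tt]].
by exists h => //; apply: map_f.
Qed.

(* The characters [y i], [i] in [V], are independent coordinates on the coset [Zs gs]. *)
Definition frame gs (V : seq nat) y :=
  [/\ forall ks (t : nat -> int), size ks = size gs -> exists x,
        [seq idot g.1 x | g <- gs] = ks /\ forall i, i \in V -> idot (y i).1 x = t i,
      ratl 2 gs & forall i, i \in V -> ratl 2 [:: y i]].

Definition atomB y h : aff :=
  match h with
  | ESub i j => y i - y j | EAdd i j => y i + y j
  | EOne i => y i | ENeg i => y i + (0, 2^-1) | EDbl i => y i + y i
  end.

Lemma valued_atomB y : valued (atomB y) predT.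
Proof.
move=> th; exists (fun i => ev (y i) th) => -[i j|i j|i|i|i] _ /=; rewrite ?evB ?evD -?mulr2n //.
by rewrite [ev (0, _) _]/ev lin0l add0r.
Qed.

Definition vertices_in (V : seq nat) h :=
  match h with
  | ESub i j | EAdd i j => (i \in V) && (j \in V) | EOne i | ENeg i | EDbl i => i \in V end.

Definition notDbl h := if h is EDbl _ then false else true.

Lemma frame_sub gs V V' y : {subset V' <= V} -> frame gs V y -> frame gs V' y.
Proof.
move=> hs [h1 h2 h3]; split=> // [ks t hk|i /hs/h3//].
by have [x [hx1 hx2]] := h1 ks t hk; exists x; split=> // i /hs/hx2.
Qed.

Lemma frame_prim gs V y : frame gs V y -> prim gs.
Proof. by move=> [h _ _] ks hk; have [x [hx _]] := h ks (fun=> 0) hk; exists x. Qed.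

Lemma frame_ratl gs V y : frame gs V y -> ratl 2 gs.
Proof. by case. Qed.

(** The equations and the coordinates on [V] together are primitive. The bound keeps the natural
    subtraction in the exponents of ['X] from truncating. *)
Lemma frame_size gs V y : uniq V -> frame gs V y -> (size gs + size V <= l)%N.
Proof.
move=> uV [h _ _]; rewrite -(size_map y V) -size_cat; apply: (@prim_size R) => ks.
rewrite size_cat size_map => hk.
have [|x [hx1 hx2]] := h (take (size gs) ks) (fun i => nth 0 (drop (size gs) ks) (index i V)).
  by rewrite size_take hk; case: ltngtP => //; lia.
exists x; rewrite map_cat hx1 -[RHS](cat_take_drop (size gs)); congr (_ ++ _).
rewrite -map_comp; apply: (@eq_from_nth _ 0); rewrite size_map ?size_drop ?hk ?addKn // => i hi.
by rewrite (nth_map 0%N) //= hx2 ?mem_nth // index_uniq.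
Qed.

Lemma ratl1 (g : aff) : ratl 2 [:: g] <-> 2%:R * g.2 \is a Num.int.
Proof. by split=> [h|h g']; [apply: h; rewrite mem_head|rewrite inE => /eqP ->]. Qed.

Lemma ratl_atomB gs V y h : frame gs V y -> vertices_in V h -> ratl 2 [:: atomB y h].
Proof.
move=> [_ _ hy].
have hy2 i : i \in V -> 2%:R * (y i).2 \is a Num.int by move/hy/ratl1.
case: h => [i j|i j|i|i|i] /= hv; apply/ratl1 => /=.
- by case/andP: hv => hi hj; rewrite mulrBr rpredB ?hy2.
- by case/andP: hv => hi hj; rewrite mulrDr rpredD ?hy2.
- exact: hy2.
- by rewrite mulrDr mulfV ?pnatr_eq0 // rpredD ?hy2 ?rpred1.
- by rewrite mulrDr rpredD ?hy2.
Qed.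

Lemma prim_atomB gs V y h : frame gs V y -> vertices_in V h -> atom_wf h -> notDbl h ->
  prim (atomB y h :: gs).
Proof.
move=> [hf _ _] hv hw hd [//|k ks] [hk].
have H i0 : exists x, [seq idot g.1 x | g <- gs] = ks /\
    forall i, i \in V -> idot (y i).1 x = if i == i0 then k else 0 by exact: hf.
case: h hv hw hd => [i j|i j|i|i|//] /= hv hw _; have [x [hx1 hx2]] := H i;
  exists x; rewrite /= hx1; congr (_ :: _); rewrite ?idotBl ?idotDl.
- by case/andP: hv => hi hj; rewrite !hx2 // eqxx gtn_eqF // subr0.
- by case/andP: hv => hi hj; rewrite !hx2 // eqxx gtn_eqF // addr0.
- by rewrite hx2 // eqxx.
- by rewrite hx2 // eqxx /idot big1 ?addr0 // => j _; rewrite mxE mul0r.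
Qed.

Lemma frame_restr gs V V' y k v w : frame gs V y -> v \in V -> v \notin V' -> {subset V' <= V} ->
  ((k = KSub \/ k = KAdd) -> w \in V') ->
  frame (atomB y (kind_atom k v w) :: gs) V' y.
Proof.
move=> hfr vV vV' V'V hw; have [hf hr hy] := hfr.
have hwV : (k = KSub \/ k = KAdd) -> w \in V by move/hw/V'V.
split; last by move=> i /V'V/hy.
  move=> [//|z ks] t [hk].
  have wv : (k = KSub \/ k = KAdd) -> (w == v) = false.
    by move=> /hw hw'; apply: contraNF vV' => /eqP <-.
  (* The value at [v] is solved from the requirement that the new equation take the value [z]; the
     sign follows the orientation chosen by [mkSub]. *)
  pose c := match k with KSub => (if (v < w)%N then z else - z) + t w | KAdd => z - t w | KOne | KNeg => z end.
  have [x [hx1 hx2]] := hf ks (fun i => if i == v then c else t i) hk.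
  exists x; split; last first.
    move=> i iV'; rewrite hx2 ?V'V //; case: eqP => // iv.
    by move: vV'; rewrite -iv iV'.
  rewrite /= hx1; congr (_ :: _); case: k hw hwV wv @c hx2 => hw hwV wv c hx2 /=.
  - rewrite /mkSub; have w1 := wv (or_introl erefl); have w2 := hwV (or_introl erefl).
    case: ifP => vw; rewrite /= idotBl !hx2 // eqxx w1 /c vw; first by rewrite addrK.
    by rewrite opprD addrCA subrr addr0 opprK.
  - rewrite /mkAdd; have w1 := wv (or_intror erefl); have w2 := hwV (or_intror erefl).
    by case: ifP => vw; rewrite /= idotDl !hx2 // eqxx w1 /c ?subrK // addrC subrK.
  - by rewrite hx2 // eqxx.
  - by rewrite idotDl hx2 // eqxx /idot big1 ?addr0 // => j _; rewrite mxE mul0r.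
move=> g; rewrite inE => /predU1P[->|/hr //].
apply: (ratl_atomB hfr); last exact: mem_head.
case: k hw hwV => /= hw hwV //.
- by rewrite /mkSub; case: ifP => _ /=; rewrite vV hwV //; left.
- by rewrite /mkAdd; case: ifP => _ /=; rewrite vV hwV //; right.
Qed.

End Fiber.

(** * Signed graphs with loops and their restrictions *)

Section ThresholdClass.
Variables (R : realType) (l : nat).
Notation aff := ('rV[int]_l * R)%type.
Implicit Types (gs : seq aff) (y : nat -> aff) (V J W : seq nat).
Variable G : rel nat.
Hypothesis Gsym : symmetric G.

(* The signed graph on the vertices [V] with all negative edges, all the loops [y_i = 0],
   the positive edges of [G], and the extra loops [y_i = 1/2] for [i] in [J]. *)
Definition loop_class V J h :=
  match h with
  | ESub i j => [&& i \in V, j \in V & (i < j)%N]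
  | EAdd i j => [&& i \in V, j \in V, (i < j)%N & G i j]
  | EOne i => i \in V
  | ENeg i => (i \in V) && (i \in J)
  | EDbl _ => false
  end.

Lemma loop_class_wf V J h : loop_class V J h -> [/\ vertices_in V h, atom_wf h & notDbl h].
Proof.
by case: h => [i j|i j|i|i|//] /=; [case/and3P=> -> ->|case/and4P=> -> ->|move=> ->|case/andP => ->].
Qed.

Lemma loop_class_mkSub V J v w : v \in V -> w \in V -> v != w -> loop_class V J (mkSub v w).
Proof.
by move=> hv hw vw; rewrite /mkSub; case: ltngtP vw => //= h _; rewrite hv hw h.
Qed.

Lemma loop_class_mkAdd V J v w : v \in V -> w \in V -> v != w -> G v w -> loop_class V J (mkAdd v w).
Proof.
move=> hv hw vw g; rewrite /mkAdd; case: ltngtP vw => //= h _; rewrite hv hw h ?g //.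
by rewrite Gsym g.
Qed.

Lemma mem_mkSub v W h : v \notin W ->
  (h \in [seq mkSub v w | w <- W]) =
  match h with ESub i j => (i < j)%N && ((i == v) && (j \in W) || (j == v) && (i \in W)) | _ => false end.
Proof.
move=> vW; apply/mapP/idP => [[w wW ->]|].
  rewrite /mkSub; case: ltngtP => [vw|wv|e] /=; rewrite ?eqxx ?wW ?andbT ?orbT // ?vw ?wv //.
  by move: vW; rewrite e wW.
case: h => [i j|//|//|//|//] /andP[ij /orP[] /andP[/eqP <- hW]].
  by exists j => //; rewrite /mkSub ij.
by exists i => //; rewrite /mkSub ltnNge (ltnW ij).
Qed.

Lemma mem_mkAdd v W h : v \notin W ->
  (h \in [seq mkAdd v w | w <- W]) =
  match h with EAdd i j => (i < j)%N && ((i == v) && (j \in W) || (j == v) && (i \in W)) | _ => false end.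
Proof.
move=> vW; apply/mapP/idP => [[w wW ->]|].
  rewrite /mkAdd; case: ltngtP => [vw|wv|e] /=; rewrite ?eqxx ?wW ?andbT ?orbT // ?vw ?wv //.
  by move: vW; rewrite e wW.
case: h => [//|i j|//|//|//] /andP[ij /orP[] /andP[/eqP <- hW]].
  by exists j => //; rewrite /mkAdd ij.
by exists i => //; rewrite /mkAdd ltnNge (ltnW ij).
Qed.

Lemma mkSub_inj v : injective (mkSub v).
Proof. by move=> a b; rewrite /mkSub; do 2 case: ifP => ?; case; congruence. Qed.

Lemma mkAdd_inj v : injective (mkAdd v).
Proof. by move=> a b; rewrite /mkAdd; do 2 case: ifP => ?; case; congruence. Qed.

Lemma uniq_star v W1 W2 (s : seq atom) : uniq W1 -> uniq W2 -> uniq s ->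
  (forall h, h \in s -> if h is EOne _ then true else if h is ENeg _ then true else false) ->
  v \notin W1 -> v \notin W2 ->
  uniq ([seq mkSub v w | w <- W1] ++ s ++ [seq mkAdd v w | w <- W2]).
Proof.
move=> u1 u2 us hs v1 v2; rewrite !cat_uniq !map_inj_uniq //; [|exact: mkAdd_inj|exact: mkSub_inj].
rewrite u1 u2 us /= !andbT; apply/andP; split; apply/hasPn => h.
  rewrite mem_cat; case/orP => [/hs|]; first by rewrite /= mem_mkSub //; case: h.
  by rewrite mem_mkAdd //= mem_mkSub //; case: h.
by rewrite mem_mkAdd // => hh; apply/negP => /hs; case: h hh.
Qed.

(** Each hypothesis stops one way of leaving the class. On [KSub], positive edges at [v] move to
    [w], so [w] must inherit the neighbours of [v], and the edge [v w] itself splits into two loops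
    at [w]. On [KAdd], negative edges become positive, so [w] must dominate, and [ESub v w] splits,
    so [w] must be in [J']. On [KNeg], every edge to [u] becomes [y_u = 1/2]. *)
Lemma res_loop_class v W J J' k w h :
  v \notin W -> (forall a b, a \in W -> b \in W -> b != a -> G v b -> G a b) ->
  ((k = KSub \/ k = KAdd) -> w \in W) ->
  ((k = KSub \/ k = KAdd) -> v \in J -> w \in J') ->
  (k = KAdd -> w \in J' /\ forall u, u \in W -> u != w -> G w u) ->
  (k = KNeg -> {subset W <= J'}) ->
  {subset J <= v :: J'} ->
  loop_class (v :: W) J h -> (k = KSub -> w \notin J' -> h != mkAdd v w) ->
  h != kind_atom k v w ->
  all (loop_class W J') (res_atom false k v w h).
Proof.
move=> vW hG hw hvJ hadd hneg JJ' hh hns hne.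
have hmem i : i \in v :: W -> i != v -> i \in W.
  by rewrite inE => /orP[/eqP ->|//]; rewrite eqxx.
have hJ i : i \in J -> i != v -> i \in J'.
  by move=> /JJ'; rewrite inE => /orP[/eqP ->|//]; rewrite eqxx.
have vneq u : u \in W -> v != u by apply: contraTneq => <-.
have stepSub u : u \in W -> h = mkSub v u -> all (loop_class W J')
    match k with
    | KSub => [:: mkSub w u] | KAdd => if u == w then [:: EOne w; ENeg w] else [:: mkAdd w u]
    | KOne => [:: EOne u] | KNeg => [:: ENeg u] end.
  move=> uW hE; case: k hw hvJ hadd hneg hns hne => hw hvJ hadd hneg hns hne; rewrite /= ?andbT.
  - apply: loop_class_mkSub => //; first by apply: hw; left.
    by apply: contraNneq hne => ->; rewrite hE.
  - have wW : w \in W by apply: hw; right.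
    have [wJ hdom] := hadd erefl.
    case: eqVneq => [_|uw] /=; first by rewrite wW wJ.
    by rewrite andbT loop_class_mkAdd // 1?eq_sym ?hdom.
  - exact: uW.
  - by rewrite uW; exact: hneg.
have stepAdd u : u \in W -> h = mkAdd v u -> G v u -> all (loop_class W J')
    match k with
    | KSub => if u == w then [:: EOne w; ENeg w] else [:: mkAdd w u] | KAdd => [:: mkSub w u]
    | KOne => [:: EOne u] | KNeg => [:: ENeg u] end.
  move=> uW hE g; clear stepSub; case: k hw hvJ hadd hneg hns hne => hw hvJ hadd hneg hns hne; rewrite /= ?andbT.
  - have wW : w \in W by apply: hw; left.
    case: eqVneq => [uw|uw] /=.
      rewrite wW /= andbT; apply: contraT => wJ; have := hns erefl wJ.
      by rewrite hE uw eqxx.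
    rewrite andbT loop_class_mkAdd // 1?eq_sym //; apply: hG => //.
  - apply: loop_class_mkSub => //; first by apply: hw; right.
    by apply: contraNneq hne => ->; rewrite hE.
  - exact: uW.
  - by rewrite uW; exact: hneg.
case: h hh hne hns stepSub stepAdd => [i j|i j|i|i|//] /=.
- case/and3P => hi hj ij _ _ stepSub _.
  case: (eqVneq i v) => [iv|iv] /=.
    apply: stepSub; first by apply: hmem => //; rewrite -iv gtn_eqF.
    by rewrite /mkSub -iv ij.
  case: (eqVneq j v) => [jv|jv] /=.
    apply: stepSub; first exact: hmem.
    by rewrite /mkSub -jv ltnNge (ltnW ij).
  by rewrite !hmem // ij.
- case/and4P => hi hj ij g _ _ _ stepAdd.
  case: (eqVneq i v) => [iv|iv] /=.
    apply: stepAdd; last by rewrite -iv.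
      by apply: hmem => //; rewrite -iv gtn_eqF.
    by rewrite /mkAdd -iv ij.
  case: (eqVneq j v) => [jv|jv] /=.
    apply: stepAdd; last by rewrite -jv Gsym.
      exact: hmem.
    by rewrite /mkAdd -jv ltnNge (ltnW ij).
  by rewrite !hmem // ij g.
- move=> hi hne _ _ _; case: (eqVneq i v) => [iv|iv] /=; last by rewrite hmem.
  by case: k hw {hvJ hadd hneg} hne => hw hne //=; rewrite andbT; apply: hw; [left|right].
- case/andP => hi iJ hne _ _ _; case: (eqVneq i v) => [iv|iv] /=; last by rewrite hmem // hJ.
  rewrite iv in iJ; case: k hw hvJ {hadd hneg} hne => hw hvJ hne //=; rewrite andbT.
    by rewrite hw ?hvJ //; left.
  by rewrite hw ?hvJ //; right.
Qed.

Lemma res_atom_notinv b k v w h : ~~ involves v h -> res_atom b k v w h = [:: h].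
Proof. by case: h => [i j|i j|i|i|i] /=; case: ifP => //; case: k. Qed.

Lemma loop_class_notinv W J v h : v \notin W -> loop_class W J h -> ~~ involves v h.
Proof.
move=> vW; have vneq i : i \in W -> (i == v) = false by move=> iW; apply: contraNF vW => /eqP <-.
by case: h => [i j|i j|i|i|//] /=; [case/and3P|case/and4P| |case/andP]; move=> *; rewrite ?vneq.
Qed.

Lemma loop_class_cons v W J h : v \notin W -> loop_class (v :: W) J h =
  match h with
  | ESub i j => (i < j)%N && ((i == v) && (j \in W) || (j == v) && (i \in W))
  | EAdd i j => (i < j)%N && ((i == v) && (G v j && (j \in W)) || (j == v) && (G v i && (i \in W)))
  | EOne i => i == v
  | ENeg i => (i == v) && (v \in J)
  | EDbl _ => false
  end || loop_class W J h.
Proof.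
move=> /negbTE vW; case: h => [i j|i j|i|i|//] /=; rewrite ?inE //.
- have [->|iv] := eqVneq i v; have [->|jv] := eqVneq j v; rewrite ?vW ?ltnn ?andbF //=.
  + by rewrite !orbF andbC.
  + by rewrite orbF andbC.
- have [->|iv] := eqVneq i v; have [->|jv] := eqVneq j v; rewrite ?vW ?ltnn ?andbF //=.
  + by rewrite !orbF andbCA [G v j && _]andbC.
  + by rewrite !orbF (Gsym i v) andbCA [G v i && _]andbC.
- by have [->|iv] := eqVneq i v; rewrite ?vW ?orbF.
Qed.

End ThresholdClass.

(** * Threshold graphs: peeling off one vertex *)

Section Threshold.
Variables (R : realType) (l : nat).
Notation aff := ('rV[int]_l * R)%type.
Implicit Types (gs : seq aff) (y : nat -> aff) (V J W : seq nat).
Variable G : rel nat.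
Hypothesis Gsym : symmetric G.
Hypothesis Gvic : forall v w u, (v <= w)%N -> u != w -> G v u -> G w u.

Definition dominating W w := forall u, u \in W -> u != w -> G w u.

Lemma peel_fiber gs y v W J s W2 (d : int) q :
  let fs := [seq mkSub v w | w <- W] ++ s ++ [seq mkAdd v w | w <- W2] in
  frame gs (v :: W) y -> uniq (v :: W) -> uniq s -> uniq W2 -> {subset W2 <= W} ->
  (forall w, w \in W2 -> [/\ G v w, w \in J & dominating W w]) ->
  {subset s <= [:: EOne v; ENeg v]} -> (ENeg v \in s -> v \in J) ->
  (v \in J -> {subset W <= J}) ->
  (forall a b, a \in W -> b \in W -> b != a -> G v b -> G a b) ->
  good (atomB y) gs (loop_class G W J) (('X - d%:P) * q) ->
  (forall f, frame (f :: gs) W y -> good (atomB y) (f :: gs) (loop_class G W J) q) ->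
  good (atomB y) gs (fun a => (a \in fs) || loop_class G W J a) (('X - (d + (size fs)%:Z)%:P) * q).
Proof.
move=> fs hfr /=/andP[vW uW] us uW2 W2W hW2 hs hneg hvJ hG h0 h2.
have vW2 : v \notin W2 by apply: contra vW => /W2W.
have vneq u : u \in W -> v != u by apply: contraTneq => <-.
have s_cases h : h \in s -> h = EOne v \/ h = ENeg v.
  by move=> /hs; rewrite !inE => /orP[] /eqP; [left|right].
have hcl h : (h \in fs) || loop_class G W J h -> loop_class G (v :: W) J h.
  case/orP; last first.
    by case: h => [i j|i j|i|i|//] /=; rewrite !inE;
      [case/and3P=> -> -> ->|case/and4P=> -> -> -> ->|move=> ->|case/andP=> -> ->]; rewrite !orbT.
  rewrite !mem_cat => /orP[|/orP[]].
  - case/mapP => w wW ->; apply: loop_class_mkSub; rewrite ?mem_head ?inE ?wW ?orbT //; exact: vneq.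
  - move=> hh; case: (s_cases h hh) => e; rewrite e /= ?mem_head //.
    by apply: hneg; rewrite -e.
  - case/mapP => w wW ->; have [g _ _] := hW2 w wW.
    apply: loop_class_mkAdd; rewrite ?mem_head ?inE ?W2W ?orbT //; exact/vneq/W2W.
have hinv f : f \in fs -> involves v f.
  rewrite !mem_cat => /orP[/mapP[w wW ->]|/orP[/s_cases[]->|/mapP[w wW ->]]] /=; rewrite ?eqxx //.
    by rewrite /mkSub; case: ifP => _ /=; rewrite eqxx ?orbT.
  by rewrite /mkAdd; case: ifP => _ /=; rewrite eqxx ?orbT.
have hwf h : (h \in fs) || loop_class G W J h -> [/\ vertices_in (v :: W) h, atom_wf h & notDbl h].
  by move/hcl/loop_class_wf.
have hS0 h : loop_class G W J h -> ~~ involves v h by exact: loop_class_notinv.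
apply: (@good_fiber R l (atomB y) notDbl _ _ _ false v) => //.
- by move=> th; have [a ha] := valued_atomB y th; exists a => h _; exact: ha.
- apply: uniq_star => //; move=> h /s_cases[]-> //.
- by move=> f /hinv hf; apply: contraL hf => /hS0.
- by move=> h /hwf[].
- move=> f ff; have [h3 h4 h5] : [/\ vertices_in (v :: W) f, atom_wf f & notDbl f] by apply: hwf; rewrite ff.
  by split; [exact: (prim_atomB hfr h3 h4 h5)|exact: (ratl_atomB hfr h3)].
move=> f ff.
have [k [w [fE hkw hkA hkN]]] : exists k w, [/\ f = kind_atom k v w, (k = KSub \/ k = KAdd) -> w \in W,
    k = KAdd -> w \in W2 & k = KNeg -> v \in J].
  move: ff; rewrite !mem_cat => /orP[/mapP[w wW ->]|/orP[hh|/mapP[w wW ->]]].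
  - by exists KSub, w; split.
  - case: (s_cases f hh) => fE.
      by exists KOne, v; split=> // -[].
    by exists KNeg, v; split=> [//|[]//|//|_]; apply: hneg; rewrite -fE.
  - by exists KAdd, w; split=> // _; apply: W2W.
exists k, w, (loop_class G W J); split=> //.
- apply: h2; rewrite fE; apply: (frame_restr hfr) => //; first exact: mem_head.
  by move=> u uW'; rewrite inE uW' orbT.
- move=> h hh hne; split; first by have [_ _] := hwf h hh; case: (h).
  apply: res_loop_class => //.
  + by move=> /hkw wW vJ; exact: (hvJ vJ _ wW).
  + by move=> /hkA /hW2[].
  + by move=> /hkN /hvJ.
  + by move=> a aJ; rewrite inE aJ orbT.
  + exact: hcl.
  + move=> _ wJ; apply: contraNneq wJ => e; move: hh; rewrite e => /orP[|].
      rewrite !mem_cat mem_mkSub // (mem_map (@mkAdd_inj v)) => /orP[|/orP[|/hW2[]//]].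
        by rewrite /mkAdd; case: ifP.
      by move=> /s_cases; rewrite /mkAdd; case: ifP => _ [].
    move=> /hS0; rewrite /mkAdd; case: ifP => _ /=; by rewrite eqxx ?orbT.
  + by rewrite -fE.
- move=> t tS; have [_ _ dt] := loop_class_wf tS; split=> //; exists t => //.
  by rewrite res_atom_notinv ?mem_head // hS0.
Qed.

(** All cosets and frames are covered at once because the induction applies the same statement to
    the ambient coset and to its hypersurfaces. *)
Definition loop_good V J (Q : {poly int}) := forall gs y, frame gs V y ->
  good (atomB y) gs (loop_class G V J)
    ('X^(l - size gs - size V) * (Q * ('X - ((size V + count (mem J) V)%N%:Z)%:P))).

Lemma count_cons_notin W J w : uniq W -> w \in W -> w \notin J ->
  count (mem (w :: J)) W = (count (mem J) W).+1.
Proof.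
move=> uW wW wJ; have := count_predUI (pred1 w) (mem J) W.
rewrite (count_uniq_mem _ uW) wW add1n => <-.
rewrite (eq_count (a2 := pred0) (a1 := predI (pred1 w) (mem J))); last first.
  by move=> u /=; apply/negbTE; case: eqP => //= ->.
by rewrite count_pred0 addn0; apply: eq_count => u /=; rewrite inE.
Qed.

(* The hypersurfaces through [v] restricting to the class of [(W, J)] are added first; then
   those of the [EAdd v w] with [w] not in [J], which restrict to the class of [(W, w :: J)]
   because [2 y_w = 0] acquires the second component [y_w = 1/2]. *)
Lemma peel_mixed v W J Q : (0 < size W)%N -> uniq (v :: W) -> v \notin J ->
  (forall a b, a \in W -> b \in W -> b != a -> G v b -> G a b) ->
  (forall w, w \in W -> G v w -> dominating W w) ->
  (forall w, w \in J -> w \in W -> G v w) ->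
  (forall J', (forall w, w \in J' -> w \in W -> dominating W w) -> loop_good W J' Q) ->
  loop_good (v :: W) J (Q * ('X - ((size W + count (G v) W)%N%:Z)%:P)).
Proof.
move=> W0 uvW vJ hG hdom hJ IH gs y hfr.
have [vW uW] := andP uvW.
have hW : {subset W <= v :: W} by move=> u hu; rewrite inE hu orbT.
have vneq u : u \in W -> v != u by apply: contraTneq => <-.
have hsz := frame_size uvW hfr.
pose e := (l - size gs - (size W).+1)%N.
pose j := count (mem J) W.
pose n1 := size W.
have hJd w : w \in J -> w \in W -> dominating W w by move=> wJ wW; apply: hdom => //; exact: hJ.
pose q1 : {poly int} := 'X^e * (Q * ('X - ((n1 + j)%N%:Z)%:P)).
have h0 : good (atomB y) gs (loop_class G W J) (('X - 0%:P) * q1).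
  apply: good_eq (IH J hJd gs y (frame_sub hW hfr)) => //.
  rewrite polyC0 subr0 /q1 [RHS]mulrA -exprS; congr ('X^_ * _).
  by rewrite /e; rewrite /= in hsz; lia.
pose W2 := [seq w <- W | w \in J].
pose fs1 := [seq mkSub v w | w <- W] ++ [:: EOne v] ++ [seq mkAdd v w | w <- W2].
have hfs1 : size fs1 = (n1 + j).+1.
  by rewrite !size_cat !size_map size_filter /= add1n addnS.
have h1 : good (atomB y) gs (fun a => (a \in fs1) || loop_class G W J a)
    (('X - (0 + (size fs1)%:Z)%:P) * q1).
  apply: (@peel_fiber gs y v W J [:: EOne v] W2 0 q1) => //.
  - exact: filter_uniq.
  - by move=> w; rewrite mem_filter => /andP[].
  - by move=> w; rewrite mem_filter => /andP[wJ wW]; split=> //; [exact: hJ|exact: hJd].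
  - by move=> a; rewrite inE => /eqP ->; rewrite mem_head.
  - by rewrite inE => /eqP.
  - by rewrite (negbTE vJ).
  - move=> f hf; apply: good_eq (IH J hJd (f :: gs) y hf) => //.
    by rewrite /q1 /e /n1 /=; congr ('X^_ * _); lia.
pose q2 : {poly int} := 'X^e * (Q * ('X - ((n1 + j.+1)%N%:Z)%:P)).
pose W3 := [seq w <- W | G v w && (w \notin J)].
pose fs2 := [seq mkAdd v w | w <- W3].
have vW3 : v \notin W3 by rewrite mem_filter (negbTE vW) andbF.
have vW2 : v \notin W2 by rewrite mem_filter (negbTE vW) andbF.
pose S1 : pred atom := fun a => (a \in fs1) || loop_class G W J a.
(* The first batch leaves the roots [n1 + j], from its restriction, and [n1 + j + 1], its own size.
   Their roles are now exchanged: [n1 + j + 1] is the root of the new restriction, and [n1 + j] is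
   the one that the second batch raises. *)
have h1' : good (atomB y) gs S1 (('X - ((n1 + j)%N%:Z)%:P) * q2).
  apply: good_eq h1 => //; rewrite hfs1 /q1 /q2 add0r addnS.
  by ring.
have hcl h : (h \in fs2) || S1 h = loop_class G (v :: W) J h.
  rewrite /S1 /fs2 /fs1 !mem_cat mem_mkSub // !mem_mkAdd // (loop_class_cons Gsym) //.
  rewrite orbA; congr (_ || _); case: h => [i j'|i j'|i|i|i] //=.
  - by rewrite inE atom_eqE !orbF.
  - rewrite inE atom_eqE /=.
    rewrite !mem_filter -andb_orr; congr (_ && _).
    have hJb u : G v u && (u \in W) = (G v u && (u \notin J) && (u \in W)) || ((u \in J) && (u \in W)).
      case: (boolP (u \in W)) => uW'; rewrite ?andbF //= !andbT.
      by case: (boolP (u \in J)) => uJ; rewrite ?andbF ?andbT ?orbF //= hJ.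
    by rewrite !hJb !andb_orr orbACA.
  - by rewrite inE atom_eqE orbF.
  - by rewrite (negbTE vJ) andbF inE atom_eqE.
  - by rewrite inE atom_eqE.
have hsz2 : (size fs2 + j = count (G v) W)%N.
  rewrite size_map size_filter /j -count_predUI.
  rewrite [X in (_ + X)%N](eq_count (a2 := pred0)) ?count_pred0 ?addn0; last first.
    by move=> u /=; case: (u \in J); rewrite ?andbF.
  apply: eq_in_count => u uW' /=; case: (boolP (u \in J)) => uJ; rewrite ?andbT ?orbF //=.
  by rewrite orbT hJ.
have S1fs2 f : f \in fs2 -> ~~ S1 f.
  rewrite mem_mkAdd // /S1 !mem_cat mem_mkSub // mem_mkAdd //; case: f => [//|i j'|//|//|//].
  move=> h; apply/negP => h'.
  have hinv : ~~ loop_class G W J (EAdd i j').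
    apply/negP => /(loop_class_notinv vW) /=; case/andP: h => _ /orP[] /andP[/eqP -> _];
    by rewrite eqxx ?orbT.
  move: h h'; rewrite (negbTE hinv) orbF inE atom_eqE /=.
  rewrite !mem_filter; case: ltngtP => //= ij.
  have [iv|iv] := eqVneq i v; have [jv|jv] /= := eqVneq j' v.
  - by move: ij; rewrite iv jv ltnn.
  - by rewrite !orbF => /andP[/andP[_ /negbTE ->]].
  - by move=> /andP[/andP[_ /negbTE ->]].
  - by [].
have h2 : good (atomB y) gs (fun a => (a \in fs2) || S1 a)
    (('X - ((n1 + j)%N%:Z + (size fs2)%:Z)%:P) * q2).
  apply: (@good_fiber R l (atomB y) notDbl _ _ _ false v) => //.
  - by move=> th; have [a ha] := valued_atomB y th; exists a => h _; exact: ha.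
  - by rewrite map_inj_uniq ?filter_uniq //; exact: mkAdd_inj.
  - by move=> h; rewrite hcl => /loop_class_wf[].
  - move=> f ff; have [h3 h4 h5] : [/\ vertices_in (v :: W) f, atom_wf f & notDbl f].
      by apply: (@loop_class_wf G _ J); rewrite -hcl ff.
    by split; [exact: (prim_atomB hfr h3 h4 h5)|exact: (ratl_atomB hfr h3)].
  move=> f /mapP[w + fE]; rewrite mem_filter => /andP[/andP[gvw wJ] wW].
  have dw : dominating W w by exact: hdom.
  exists KAdd, w, (loop_class G W (w :: J)); split=> //.
  - have hJ' u : u \in w :: J -> u \in W -> dominating W u.
      by rewrite inE => /predU1P[-> _|]; [exact: dw|exact: hJd].
    have hfr' : frame (atomB y f :: gs) W y.
      by rewrite fE; apply: (@frame_restr R l gs _ W y KAdd v w hfr) => //; exact: mem_head.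
    apply: good_eq (IH (w :: J) hJ' (atomB y f :: gs) y hfr') => //.
    by rewrite /q2 /e /n1 /= count_cons_notin //; congr ('X^_ * _); lia.
  - move=> h hh hne; split; first by move: hh; rewrite hcl => /loop_class_wf[_ _]; case: (h).
    move: hh; rewrite hcl => hh; apply: (@res_loop_class G Gsym v W J) => //.
    + by rewrite (negbTE vJ).
    + by move=> _; rewrite mem_head; split.
    + by move=> u uJ; rewrite !inE uJ !orbT.
    + by rewrite fE in hne.
  - move=> t tS; split; first by have [] := loop_class_wf tS.
    have tinv := loop_class_notinv vW tS.
    have [tJ|] := boolP (loop_class G W J t).
      by exists t; [rewrite /S1 tJ orbT|rewrite res_atom_notinv // mem_head].
    case: t tS tinv => [i j'|i j'|i|i|//] /=; try by move=> ->.
    case/andP => iW; rewrite inE iW /= => /predU1P[-> _ _|->//].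
    (* The new component [y_w = 1/2] is cut out by the negative edge between [v] and [w], present
       since the first batch. *)
    exists (mkSub v w); first by rewrite /S1 mem_cat map_f.
    have /negbTE wv := vneq w wW; rewrite eq_sym in wv.
    by rewrite /mkSub; case: ifP => _ /=; rewrite ?wv ?eqxx /= ?eqxx !inE eqxx orbT.
apply: good_eq h2 => //.
rewrite /q2 -/n1 -hsz2 /= (negbTE vJ) /= -/j -/n1 -/e.
rewrite (_ : (n1.+1 + (0 + j) = n1 + j.+1)%N); last by lia.
rewrite (_ : (n1 + (size fs2 + j))%N%:Z = (n1 + j)%N%:Z + (size fs2)%:Z :> int); last by lia.
by ring.
Qed.

Lemma eq_loop_class V V' J : V =i V' -> loop_class G V J =1 loop_class G V' J.
Proof. by move=> h [i j|i j|i|i|i] /=; rewrite ?h. Qed.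

Lemma loop_good_perm V V' J Q : perm_eq V V' -> loop_good V' J Q -> loop_good V J Q.
Proof.
move=> hp H gs y hfr; have hm := perm_mem hp.
have hs : {subset V' <= V} by move=> u; rewrite hm.
apply: good_eq (H gs y (frame_sub hs hfr)); first by move=> h; apply/esym/eq_loop_class.
by rewrite (perm_size hp) (permP hp).
Qed.

Definition complete V := forall a b, a \in V -> b \in V -> b != a -> G a b.

(** As [J] contains [W], all second components [y_u = 1/2] are present from the start, and a single
    batch of [2 |W| + 2] hypersurfaces suffices. *)
Lemma peel_all v W J Q : (0 < size W)%N -> uniq (v :: W) -> {subset v :: W <= J} ->
  complete (v :: W) -> (forall J', (forall w, w \in J' -> w \in W -> dominating W w) -> loop_good W J' Q) ->
  loop_good (v :: W) J (Q * ('X - ((size W + size W)%N%:Z)%:P)).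
Proof.
move=> W0 uvW hVJ hcomp IH gs y hfr.
have [vW uW] := andP uvW.
have hW : {subset W <= v :: W} by move=> u hu; rewrite inE hu orbT.
have vJ : v \in J by apply: hVJ; rewrite mem_head.
have WJ : {subset W <= J} by move=> u /hW/hVJ.
have vneq u : u \in W -> u != v by apply: contraTneq => ->.
have hsz := frame_size uvW hfr.
pose e := (l - size gs - (size W).+1)%N.
have hd w : w \in W -> dominating W w by move=> wW u uW'; apply: hcomp; exact: hW.
have cJ : count (mem J) W = size W by apply/eqP; rewrite -all_count; apply/allP => u /WJ.
pose q1 : {poly int} := 'X^e * (Q * ('X - ((size W + size W)%N%:Z)%:P)).
pose fs := [seq mkSub v w | w <- W] ++ [:: EOne v; ENeg v] ++ [seq mkAdd v w | w <- W].
have h1 : good (atomB y) gs (fun a => (a \in fs) || loop_class G W J a)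
    (('X - (0 + (size fs)%:Z)%:P) * q1).
  apply: (@peel_fiber gs y v W J [:: EOne v; ENeg v] W 0 q1) => //.
  - by rewrite /= inE andbT; apply/eqP.
  - by move=> w wW; split; [apply: hcomp; rewrite ?mem_head ?inE ?wW ?orbT // vneq|exact: WJ|exact: hd].
  - by move=> a b aW bW ba _; apply: hcomp => //; exact: hW.
  - apply: good_eq (IH J (fun w _ => hd w) gs y (frame_sub hW hfr)) => //.
    rewrite polyC0 subr0 /q1 [RHS]mulrA -exprS cJ; congr ('X^_ * _).
    by rewrite /e; rewrite /= in hsz; lia.
  - move=> f hf; apply: good_eq (IH J (fun w _ => hd w) (f :: gs) y hf) => //.
    by rewrite /q1 /e cJ /=; congr ('X^_ * _); lia.
apply: good_eq h1 => [h|].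
  rewrite (loop_class_cons Gsym) //; congr (_ || _).
  rewrite /fs !mem_cat mem_mkSub // mem_mkAdd //.
  case: h => [i j'|i j'|i|i|i] //=; rewrite !inE.
  - by rewrite !atom_eqE /= orbF.
  - rewrite !atom_eqE /=.
    have hG u : u \in W = G v u && (u \in W).
      by case: (boolP (u \in W)) => uW'; rewrite ?andbF // hcomp ?mem_head ?hW ?vneq.
    by rewrite -!hG.
  - by rewrite !atom_eqE !orbF.
  - by rewrite !atom_eqE vJ andbT orbF.
  - by rewrite !atom_eqE.
rewrite /q1 /= vJ cJ /fs !size_cat !size_map /= -/e add0r.
rewrite (_ : ((size W).+1 + (1 + size W) = size W + (2 + size W))%N); last by lia.
by ring.
Qed.

Lemma loop_good1 v J : loop_good [:: v] J 1.
Proof.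
move=> gs y hfr; have hsz := frame_size (isT : uniq [:: v]) hfr.
pose s := EOne v :: (if v \in J then [:: ENeg v] else [::]).
pose q1 : {poly int} := 'X^(l - size gs - 1).
have hs h : h \in s -> h = EOne v \/ h = ENeg v /\ v \in J.
  rewrite inE => /predU1P[->|]; first by left.
  by case: ifP => // vJ; rewrite inE => /eqP ->; right.
have hnil h : loop_class G [::] J h = false by case: h.
have hsub : {subset [::] <= [:: v]} by [].
pose fs := [seq mkSub v w | w <- [::]] ++ s ++ [seq mkAdd v w | w <- [::]].
have h1 : good (atomB y) gs (fun a => (a \in fs) || loop_class G [::] J a)
    (('X - (0 + (size fs)%:Z)%:P) * q1).
  apply: (@peel_fiber gs y v [::] J s [::] 0 q1) => //.
  - by rewrite /s; case: ifP => //= _; rewrite inE andbT; apply/eqP.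
  - by move=> h /hs[->|[-> _]]; rewrite !inE eqxx ?orbT.
  - by move=> /hs[|[]].
  - apply: good_eq (good_nil (atomB y) hnil (frame_prim hfr) (frame_ratl hfr)) => //.
    rewrite polyC0 subr0 /q1 -exprS; congr 'X^_.
    by rewrite /= in hsz; lia.
  - move=> f hf; apply: good_eq (good_nil (atomB y) hnil (frame_prim hf) (frame_ratl hf)) => //.
    by rewrite /q1 /=; congr 'X^_; lia.
apply: good_eq h1 => [h|].
  rewrite hnil orbF (loop_class_cons Gsym) // hnil orbF /fs cats0 /=.
  apply/idP/idP => [/hs[->|[-> vJ]]|]; rewrite /= ?eqxx //.
  case: h => [i j|i j|i|i|//]; rewrite ?andbF //.
  - by move=> /eqP ->; rewrite mem_head.
  - by move=> /andP[/eqP -> vJ]; rewrite /s vJ !inE eqxx orbT.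
rewrite /q1 mul1r /fs cats0 /= /s mulrC add0r; congr (_ * ('X - (_)%:P)).
by case: (v \in J).
Qed.

(** The part of the polynomial independent of [J]: peeling [v] contributes [|W|] plus the degree of
    [v], while the last vertex contributes only to the factor that depends on [J]. *)
Fixpoint loop_poly V : {poly int} :=
  if V is v :: W then
    (if W is [::] then 1 else loop_poly W * ('X - ((size W + count (G v) W)%N%:Z)%:P))
  else 1.

(** Only the number of vertices enters, so in a complete graph the vertex to peel can be chosen
    freely. *)
Lemma loop_poly_complete V : uniq V -> complete V ->
  loop_poly V = \prod_(1 <= k < size V) ('X - ((k + k)%N%:Z)%:P).
Proof.
elim: V => [|v [|w W] IH] hu hc; [by rewrite big_geq|by rewrite big_geq|].
rewrite (_ : loop_poly _ = loop_poly (w :: W) * ('X - ((size (w :: W) + count (G v) (w :: W))%N%:Z)%:P)) //.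
rewrite (_ : size [:: v, w & W] = (size (w :: W)).+1) // big_nat_recr // -IH; last first.
- by move=> a b aW bW; apply: hc; rewrite inE ?aW ?bW orbT.
- by case/andP: hu.
congr (_ * ('X - (_)%:P)); congr (_%:Z); congr (_ + _)%N.
change (count (G v) (w :: W) = size (w :: W)).
apply/eqP; rewrite -all_count; apply/allP => u uW; apply: hc; [exact: mem_head|by rewrite in_cons uW orbT|].
by case/andP: hu => vW _; apply/eqP => uv; move: vW; rewrite -uv uW.
Qed.

(** In increasing order the first vertex has the smallest neighbourhood, and by symmetry each of its
    neighbours dominates the rest, as [peel_mixed] requires. *)
Theorem loop_class_good V J : (0 < size V)%N -> sorted ltn V ->
  (forall w, w \in J -> w \in V -> dominating V w) -> loop_good V J (loop_poly V).
Proof.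
move: {2}(size V) (erefl (size V)) => n; elim: n V J => [|n IH] V J; first by move=> ->.
case: V => // v [|w0 W0] hn _ hs hJ; first exact: loop_good1.
set W := w0 :: W0 in hn hs hJ *.
have polyE : loop_poly (v :: W) = loop_poly W * ('X - ((size W + count (G v) W)%N%:Z)%:P) by [].
have size_W : (0 < size W)%N by [].
clearbody W.
have hu : uniq (v :: W) by apply: sorted_uniq hs; [exact: ltn_trans|exact: ltnn].
have [vW uW] := andP hu.
have hvlt u : u \in W -> (v < u)%N := allP (order_path_min ltn_trans (hs : path ltn v W)) u.
have vneq u : u \in W -> u != v by move/hvlt => h; rewrite gtn_eqF.
have hsW : sorted ltn W by exact: path_sorted hs.
have hG a b : a \in W -> b \in W -> b != a -> G v b -> G a b.
  by move=> /hvlt/ltnW va _ ba; exact: Gvic.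
have hdom w : w \in W -> G v w -> dominating W w.
  move=> wW vw u uW' uw; rewrite Gsym; apply: Gvic vw; [exact/ltnW/hvlt|by rewrite eq_sym].
have [vJ|vJ] := boolP (v \in J); last first.
  rewrite polyE; apply: peel_mixed => //.
    by move=> w wJ wW; rewrite Gsym; apply: hJ; rewrite ?mem_head ?inE ?wW ?orbT // eq_sym vneq.
  by move=> J' hJ'; apply: IH => //; case: hn.
(* Being in [J], [v] dominates; its neighbourhood is also the smallest, so all pairs are
   adjacent. *)
have hc : complete (v :: W).
  have vd : dominating (v :: W) v by apply: hJ => //; exact: mem_head.
  move=> a b; rewrite inE => /predU1P[->|aW] bV ba; first exact: vd.
  move: bV; rewrite inE => /predU1P[->|bW].
    by rewrite Gsym; apply: vd; rewrite ?inE ?aW ?orbT ?vneq.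
  by apply: hG => //; apply: vd; rewrite ?inE ?bW ?orbT ?vneq.
have [hall|] := boolP (all (mem J) (v :: W)).
  rewrite polyE (_ : count (G v) W = size W); last first.
    apply/eqP; rewrite -all_count; apply/allP => u uW'.
    by apply: hc; rewrite ?mem_head ?inE ?uW' ?orbT ?vneq.
  apply: peel_all => //; first by move=> u /(allP hall).
  by move=> J' hJ'; apply: IH => //; case: hn.
(* A vertex [w] outside [J] is peeled in place of [v]. *)
case/allPn => w wV wJ.
apply: (loop_good_perm (perm_to_rem wV)).
have szr : size (rem w (v :: W)) = size W by rewrite size_rem.
have hrs : {subset rem w (v :: W) <= v :: W} by exact: mem_rem.
have hcr : complete (rem w (v :: W)) by move=> a b /hrs aV /hrs bV; exact: hc.
have hur : uniq (rem w (v :: W)) by exact: rem_uniq.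
have hpu : uniq (w :: rem w (v :: W)) by rewrite -(perm_uniq (perm_to_rem wV)).
have wr : w \notin rem w (v :: W) by case/andP: hpu.
have -> : loop_poly (v :: W) =
    loop_poly (rem w (v :: W)) * ('X - ((size (rem w (v :: W)) + count (G w) (rem w (v :: W)))%N%:Z)%:P).
  rewrite !loop_poly_complete // szr [size _]/= big_nat_recr //=; congr (_ * ('X - (_)%:P)).
  congr (_%:Z); congr (_ + _)%N; rewrite -[LHS]szr; apply/esym/eqP; rewrite -all_count; apply/allP => u ur.
  by apply: hc; [|exact: hrs|apply/eqP => uw; move: wr; rewrite -{1}uw ur].
apply: peel_mixed => //.
- by rewrite szr.
- by move=> a b aW bW ba _; exact: hcr.
- by move=> a aW _ b bW ba; exact: hcr.
- move=> a _ aW; apply: hc; [by []|exact: hrs|].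
  by apply/eqP => uw; move: wr; rewrite -{1}uw aW.
move=> J' hJ'; apply: IH => //; rewrite ?szr //; first by case: hn.
by apply: subseq_sorted (rem_subseq _ _) hs; exact: ltn_trans.
Qed.

End Threshold.

(** * Ideals of type A and B *)

Section IdealB.
Variables (R : realType) (l : nat).
Notation aff := ('rV[int]_l * R)%type.
Implicit Types (gs : seq aff) (y : nat -> aff).
(* Membership of an atom in an ideal of type A or B; in type A, [EOne i] is [e_i - e_l]. *)
Variable P : pred atom.
Hypothesis P_type : forall h, P h -> if h is ENeg _ then false else notDbl h.
Hypothesis P_Sub : forall i j i' j', P (ESub i j) -> (i <= i' < j')%N -> (j' <= j)%N -> (j < l)%N ->
  P (ESub i' j').
Hypothesis P_One : forall i i', P (EOne i) -> (i <= i' < l)%N -> P (EOne i').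
Hypothesis P_One_Sub : forall i i' j', P (EOne i) -> (i <= i' < j')%N -> (j' < l)%N -> P (ESub i' j').
Hypothesis P_Add : forall i j i' j', P (EAdd i j) -> (i < j < l)%N -> (i <= i' < j')%N -> (j <= j' < l)%N ->
  P (EAdd i' j').
Hypothesis P_Add_One : forall i j, P (EAdd i j) -> (i < j < l)%N -> P (EOne i).

Definition verts m := iota m (l - m).
Definition ideal_class m h := [&& vertices_in (verts m) h, atom_wf h & P h].

Lemma mem_verts m i : (i \in verts m) = (m <= i < l)%N.
Proof. by rewrite mem_iota; case: (leqP m i) => //= mi; rewrite /verts; lia. Qed.

(* Closed upwards also beyond the range of indices, so that it is a threshold graph. *)
Definition add_graph : rel nat := fun v w =>
  `[< exists i j, [/\ (i < j < l)%N, P (EAdd i j), (i <= minn v w)%N & (j <= maxn v w)%N] >].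

Lemma add_graph_sym : symmetric add_graph.
Proof. by move=> v w; rewrite /add_graph minnC maxnC. Qed.

Lemma add_graph_vic v w u : (v <= w)%N -> u != w -> add_graph v u -> add_graph w u.
Proof.
move=> vw _ /asboolP[i [j [h1 h2 h3 h4]]]; apply/asboolP; exists i, j; split=> //; lia.
Qed.

Lemma add_graphE v w : (v < w < l)%N -> add_graph v w = P (EAdd v w).
Proof.
move=> vwl; apply/asboolP/idP => [[i [j [h1 h2 h3 h4]]]|h].
  by apply: (P_Add h2 h1); lia.
by exists v, w; split=> //; lia.
Qed.

(** All [EOne i] and [ESub i j] from [m] on lie below [EOne m], so only the positive edges remain
    free. In type A there are none and the graph is empty. *)
Lemma ideal_loop_class m : P (EOne m) -> ideal_class m =1 loop_class add_graph (verts m) [::].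
Proof.
move=> Pm [i j|i j|i|i|i]; rewrite /ideal_class /= ?mem_verts.
- apply/idP/idP => [/and3P[/andP[-> ->] -> _]//|/and3P[hi hj ij]].
  by rewrite hi hj ij /=; apply: (P_One_Sub Pm); lia.
- apply/idP/idP => [/and3P[/andP[hi hj] ij hP]|/and4P[hi hj ij]].
    by rewrite hi hj ij add_graphE //; lia.
  by rewrite add_graphE ?hi ?hj ?ij //; lia.
- case: (boolP (m <= i < l)%N) => //= hi; exact: (P_One Pm).
- by rewrite in_nil andbF; apply/negbTE/negP => /andP[_ /P_type].
- by apply/negbTE/negP => /andP[_ /P_type].
Qed.

(** [Q] is fixed before [gs] and [y], so an arrangement and its restrictions to the added
    hypersurfaces share it. *)
Lemma ideal_good n m : (m + n = l)%N -> exists Q, forall gs y, frame gs (verts m) y ->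
  good (atomB y) gs (ideal_class m) ('X^(l - size gs - n) * Q).
Proof.
elim: n m => [|n IH] m mn.
  exists 1 => gs y hfr; rewrite mulr1 subn0; apply: good_nil; last exact: frame_ratl hfr.
    have h0 i : (i \in verts m) = false by rewrite mem_verts; lia.
    by move=> [i j|i j|i|i|i]; rewrite /ideal_class /= h0.
  exact: frame_prim hfr.
have vertsE : verts m = m :: verts m.+1 by rewrite /verts (_ : (l - m = (l - m.+1).+1)%N) //; lia.
have size_verts : size (verts m) = n.+1 by rewrite size_iota; lia.
have [Pm|Pm] := boolP (P (EOne m)).
  exists (loop_poly add_graph (verts m) * ('X - ((n.+1 + 0)%N%:Z)%:P)) => gs y hfr.
  have := @loop_class_good R l add_graph add_graph_sym add_graph_vic (verts m) [::].
  rewrite size_verts /loop_good size_verts count_pred0 => /(_ isT (iota_ltn_sorted _ _)) H.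
  apply: good_eq (H _ gs y hfr) => // h; exact/esym/ideal_loop_class.
have [Q IHm] := IH m.+1 (etrans (addSnnS m n) mn).
pose fs := [seq ESub m w | w <- verts m.+1 & P (ESub m w)].
exists (('X - ((size fs)%:Z)%:P) * Q) => gs y hfr.
have sub_verts : {subset verts m.+1 <= verts m} by move=> i; rewrite vertsE inE => ->; rewrite orbT.
have hsz := frame_size (iota_uniq _ _) hfr; rewrite size_verts in hsz.
pose q1 : {poly int} := 'X^(l - size gs - n.+1) * Q.
have fsP h : h \in fs -> exists2 w, h = ESub m w & (m < w < l)%N && P (ESub m w).
  by case/mapP => w; rewrite mem_filter mem_verts => /andP[h1 h2] ->; exists w; rewrite // h2.
have hinv h : ideal_class m.+1 h -> ~~ involves m h.
  case/and3P => hv _ _; have mneq i : i \in verts m.+1 -> (i == m) = false.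
    by rewrite mem_verts => hi; apply/negbTE; lia.
  by case: h hv => [i j|i j|i|i|i] /=; [case/andP|case/andP| | |]; move=> *; rewrite ?mneq.
have hE h : (h \in fs) || ideal_class m.+1 h = ideal_class m h.
  apply/idP/idP => [/orP[/fsP[w ->]|]|].
  - case/andP => hw Pw; rewrite /ideal_class /= !mem_verts Pw; lia.
  - case/and3P => hv hw hP; apply/and3P; split=> //.
    by case: h hv {hw hP} => [i j|i j|i|i|i] /=; try exact: sub_verts;
      case/andP => /sub_verts -> /sub_verts ->.
  have hm i : i \in verts m -> i != m -> i \in verts m.+1 by rewrite vertsE inE => /predU1P[->|//]; rewrite eqxx.
  case/and3P; case: h => [i j|i j|i|i|i] /=.
  - case/andP => hi hj ij hP; have jm : j != m by move: hi ij; rewrite mem_verts; lia.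
    have [im|im] := eqVneq i m.
      by apply/orP; left; rewrite im; apply: map_f; rewrite mem_filter; apply/andP; split; [rewrite -im|exact: hm].
    by apply/orP; right; rewrite /ideal_class /= ij hP !hm.
  - case/andP => hi hj ij hP; have jm : j != m by move: hi ij; rewrite mem_verts; lia.
    have [im|im] := eqVneq i m.
      (* A positive edge at [m] lies above [e_m] in the root order, so none is present here. *)
      case/negP: Pm; rewrite -im; apply: (P_Add_One hP); move: hj; rewrite mem_verts; lia.
    by apply/orP; right; rewrite /ideal_class /= ij hP !hm.
  - move=> hi _ hP; have [im|im] := eqVneq i m; first by case/negP: Pm; rewrite -im.
    by apply/orP; right; rewrite /ideal_class /= hP hm.
  - by move=> _ _ /P_type.
  - by move=> _ _ /P_type.
have hwf h : (h \in fs) || ideal_class m.+1 h -> [/\ vertices_in (m :: verts m.+1) h, atom_wf h & notDbl h].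
  rewrite hE -vertsE => /and3P[-> -> /P_type]; by case: (h).
have h1 : good (atomB y) gs (fun a => (a \in fs) || ideal_class m.+1 a) (('X - (0 + (size fs)%:Z)%:P) * q1).
  apply: (@good_fiber R l (atomB y) notDbl _ _ _ false m) => //.
  - by move=> th; have [a ha] := valued_atomB y th; exists a => h _; exact: ha.
  - apply: good_eq (IHm gs y (frame_sub sub_verts hfr)) => //.
    by rewrite polyC0 subr0 /q1 [RHS]mulrA -exprS; congr ('X^_ * _); lia.
  - by rewrite map_inj_uniq ?filter_uniq ?iota_uniq // => a b [].
  - by move=> f /fsP[w -> _]; apply/negP => /hinv /=; rewrite eqxx.
  - by move=> h /hwf[].
  - move=> f ff; have [h3 h4 h5] : [/\ vertices_in (m :: verts m.+1) f, atom_wf f & notDbl f].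
      by apply: hwf; rewrite ff.
    rewrite -vertsE in h3.
    by split; [exact: (prim_atomB hfr h3 h4 h5)|exact: (ratl_atomB hfr h3)].
  move=> f ff; have [w fE /andP[hw Pw]] := fsP f ff.
  have wm : w \in verts m.+1 by rewrite mem_verts.
  have fE' : f = kind_atom KSub m w by rewrite fE /= /mkSub; case: ltnP hw => //=; lia.
  exists KSub, w, (ideal_class m.+1); split=> //.
  - have hfr' : frame (atomB y f :: gs) (verts m.+1) y.
      rewrite fE'; apply: (@frame_restr R l gs _ (verts m.+1) y KSub m w hfr) => //.
        by rewrite vertsE mem_head.
      by rewrite mem_verts ltnn.
    apply: good_eq (IHm (atomB y f :: gs) y hfr') => //.
    by rewrite /q1 /=; congr ('X^_ * _); lia.
  - move=> h hh hne; split; first by have [_ _] := hwf h hh; case: (h).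
    case/orP: hh => [/fsP[u hu /andP[hul Pu]]|hh]; last by rewrite res_atom_notinv ?hinv //= hh.
    rewrite hu /= eqxx /= andbT /mkSub /ideal_class; have uw : u != w by apply: contraNneq hne => uw; rewrite hu fE uw.
    case: ltngtP uw => //= wu _; rewrite !mem_verts.
      by rewrite wu (P_Sub Pu) /= ?andbT; lia.
    by rewrite wu (P_Sub Pw) /= ?andbT; lia.
  - move=> t tS; split; last by exists t => //; rewrite res_atom_notinv ?hinv // mem_head.
    by case/and3P: tS => _ _ /P_type; case: (t).
apply: good_eq h1 => //.
by rewrite /q1 add0r; ring.
Qed.

End IdealB.

(** * Ideals of type C *)

Section IdealC.
Variables (R : realType) (l : nat).
Notation aff := ('rV[int]_l * R)%type.
Implicit Types (gs : seq aff) (y : nat -> aff).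

Definition isC h := match h with ESub _ _ | EAdd _ _ | EDbl _ => true | _ => false end.

Variable I : atom -> aff.
Hypothesis I_valued : valued I isC.
Hypothesis I_ratl : forall h, ratl 2 [:: I h].

(* In type C the functions [e_i] are not characters: [2 * e_i] takes the value [2 * t i + c]
   with [c] of arbitrary parity. *)
Definition frameC gs (V : seq nat) :=
  (forall ks (t : nat -> int) (c : int), size ks = size gs -> exists x,
     [/\ [seq idot g.1 x | g <- gs] = ks,
         forall i j, i \in V -> j \in V -> idot (I (ESub i j)).1 x = t i - t j,
         forall i j, i \in V -> j \in V -> idot (I (EAdd i j)).1 x = t i + t j + c
       & forall i, i \in V -> idot (I (EDbl i)).1 x = t i + t i + c]) /\ ratl 2 gs.

Lemma frameC_sub gs V V' : {subset V' <= V} -> frameC gs V -> frameC gs V'.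
Proof.
move=> hs [h hr]; split=> // ks t c hk; have [x [h1 h2 h3 h4]] := h ks t c hk.
by exists x; split=> // [i j /hs hi /hs hj|i j /hs hi /hs hj|i /hs hi]; auto.
Qed.

(** The differences [e_j - e_v] are roots, hence genuine characters, and stay independent on
    [2 e_v = 0]: the restriction leaves type C for the setting of [frame]. *)
Lemma frameC_frame gs V V' v : frameC gs V -> v \in V -> v \notin V' -> {subset V' <= V} ->
  frame (I (EDbl v) :: gs) V' (fun j => - I (ESub v j)).
Proof.
move=> [h hr] vV vV' hs; split.
- move=> [//|z ks] t [hk].
  have [x [h1 h2 h3 h4]] := h ks (fun i => if i == v then 0 else t i) z hk.
  exists x; split=> [|i iV']; first by rewrite /= h1 h4 // eqxx !add0r.
  rewrite idotNl h2 //; last exact: hs.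
  rewrite eqxx sub0r opprK; case: eqP => // iv.
  by move: vV'; rewrite -iv iV'.
- by move=> g; rewrite inE => /predU1P[->|/hr//]; apply: I_ratl; exact: mem_head.
- move=> i _; apply/ratl1 => /=; rewrite mulrN rpredN.
  by apply: I_ratl; exact: mem_head.
Qed.

Lemma frameC_size gs V v : uniq (v :: V) -> frameC gs (v :: V) -> (size gs + size (v :: V) <= l)%N.
Proof.
move=> /andP[vV uV] h; rewrite /= addnS -addSn.
apply: (@frame_size R l (I (EDbl v) :: gs) V (fun j => - I (ESub v j)) uV).
apply: frameC_frame h _ vV _; first exact: mem_head.
by move=> u uV'; rewrite inE uV' orbT.
Qed.

Lemma frameC_gs_prim gs V : frameC gs V -> prim gs.
Proof. by move=> [h _] ks hk; have [x [hx _ _ _]] := h ks (fun=> 0) 0 hk; exists x. Qed.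

Lemma frameC_prim gs V h : frameC gs V -> vertices_in V h -> atom_wf h -> isC h -> prim (I h :: gs).
Proof.
move=> [hf _] hv hw hd [//|k ks] [hk].
case: h hv hw hd => [i j|i j|//|//|i] /= hv hw _.
- have [x [h1 h2 _ _]] := hf ks (fun u => if u == i then k else 0) 0 hk.
  by exists x; case/andP: hv => hi hj; rewrite h1 h2 // eqxx gtn_eqF // subr0.
- have [x [h1 _ h2 _]] := hf ks (fun=> 0) k hk.
  by exists x; case/andP: hv => hi hj; rewrite h1 h2 // !add0r.
- have [x [h1 _ _ h2]] := hf ks (fun=> 0) k hk.
  by exists x; rewrite h1 h2 // !add0r.
Qed.

Lemma frameC_restr gs V V' k v w : frameC gs V -> v \in V -> v \notin V' -> {subset V' <= V} ->
  (k = KSub \/ k = KAdd) -> w \in V' -> frameC (I (kind_atom k v w) :: gs) V'.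
Proof.
move=> [hf hr] vV vV' V'V hk wV'; have wV := V'V _ wV'.
have wv : (w == v) = false by apply: contraNF vV' => /eqP <-.
split; last first.
  by move=> g; rewrite inE => /predU1P[->|/hr //]; apply: I_ratl; exact: mem_head.
move=> [//|z ks] t c [hks].
pose b := match k with KSub => (if (v < w)%N then z else - z) + t w | _ => z - c - t w end.
have [x [h1 h2 h3 h4]] := hf ks (fun i => if i == v then b else t i) c hks.
have tE i : i \in V' -> (if i == v then b else t i) = t i.
  by move=> iV'; case: eqP => // iv; move: vV'; rewrite -iv iV'.
exists x; split; last 3 first.
- by move=> i j iV' jV'; rewrite h2 ?V'V // !tE.
- by move=> i j iV' jV'; rewrite h3 ?V'V // !tE.
- by move=> i iV'; rewrite h4 ?V'V // !tE.
rewrite /= h1; congr (_ :: _); rewrite /b in h2 h3 *; case: hk h2 h3 {h4 tE} => -> /= h2 h3.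
- by rewrite /mkSub; case: ifP => vw; rewrite /= h2 // eqxx wv ?vw; ring.
- by rewrite /mkAdd; case: ifP => vw; rewrite /= h3 // eqxx wv; ring.
Qed.

Variable P : pred atom.
Hypothesis P_type : forall h, P h -> isC h.
Hypothesis P_Sub : forall i j i' j', P (ESub i j) -> (i <= i' < j')%N -> (j' <= j)%N -> (j < l)%N ->
  P (ESub i' j').
Hypothesis P_Add : forall i j i' j', P (EAdd i j) -> (i < j < l)%N -> (i <= i' < j')%N -> (j <= j' < l)%N ->
  P (EAdd i' j').
Hypothesis P_Add_Sub : forall i j i' j', P (EAdd i j) -> (i < j < l)%N -> (i <= i' < j')%N -> (j' < l)%N ->
  P (ESub i' j').
Hypothesis P_Add_Dbl : forall i j j', P (EAdd i j) -> (i < j < l)%N -> (j <= j' < l)%N -> P (EDbl j').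
Hypothesis P_Dbl : forall i i', P (EDbl i) -> (i <= i' < l)%N -> P (EDbl i').
Hypothesis P_Dbl_Sub : forall i i' j', P (EDbl i) -> (i <= i' < j')%N -> (j' < l)%N -> P (ESub i' j').
Hypothesis P_Dbl_Add : forall i i' j', P (EDbl i) -> (i <= i' < j')%N -> (j' < l)%N -> P (EAdd i' j').

Notation vtx := (verts l).
Notation icl := (ideal_class l P).

Lemma P_mkAdd i j u w : P (EAdd i j) -> (i < j < l)%N -> u != w -> (i <= minn u w)%N ->
  (j <= maxn u w)%N -> (maxn u w < l)%N -> P (mkAdd u w).
Proof.
by move=> hP hij uw h1 h2 h3; rewrite /mkAdd; case: ltnP => h; apply: (P_Add hP hij); lia.
Qed.

Lemma ideal_class_mkAdd m u w : u \in vtx m -> w \in vtx m -> u != w -> P (mkAdd u w) ->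
  icl m (mkAdd u w).
Proof.
move=> hu hw uw; rewrite /ideal_class /mkAdd; case: ltngtP uw => //= h _ ->; by rewrite hu hw h.
Qed.

Lemma ideal_class_mkSub m u w : u \in vtx m -> w \in vtx m -> u != w -> P (mkSub u w) ->
  icl m (mkSub u w).
Proof.
move=> hu hw uw; rewrite /ideal_class /mkSub; case: ltngtP uw => //= h _ ->; by rewrite hu hw h.
Qed.

Definition not_dbl m h := h != EDbl m.

(** Here [2 e_w = 0] is connected, so [EAdd m w] and [ESub m w] meet in the single hypersurface
    [EDbl w], which belongs to the ideal because it lies below [EAdd m w]. *)
Lemma fiberC m n Q : (m + n.+1 = l)%N ->
  (forall gs, frameC gs (vtx m.+1) -> good I gs (icl m.+1) ('X^(l - size gs - n) * Q)) ->
  exists d, [/\ P (EDbl m) -> d = (n + n)%N & forall gs, frameC gs (vtx m) ->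
    good I gs (predI (not_dbl m) (icl m)) (('X - (d%:Z)%:P) * ('X^(l - size gs - n.+1) * Q))].
Proof.
move=> mn IHm.
have vertsE : vtx m = m :: vtx m.+1 by rewrite /verts (_ : (l - m = (l - m.+1).+1)%N) //; lia.
have size_verts : size (vtx m.+1) = n by rewrite size_iota; lia.
have mW : m \notin vtx m.+1 by rewrite mem_verts ltnn.
pose fs1 := [seq ESub m w | w <- vtx m.+1 & P (ESub m w)].
pose fs2 := [seq EAdd m w | w <- vtx m.+1 & P (EAdd m w)].
pose fs := fs1 ++ fs2.
exists (size fs); split.
  move=> Pm; rewrite size_cat !size_map !size_filter; congr (_ + _)%N.
    rewrite -[RHS]size_verts; apply/eqP; rewrite -all_count; apply/allP => w; rewrite mem_verts => hw.
    by apply: (P_Dbl_Sub Pm); lia.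
  rewrite -[RHS]size_verts; apply/eqP; rewrite -all_count; apply/allP => w; rewrite mem_verts => hw.
  by apply: (P_Dbl_Add Pm); lia.
move=> gs hfr.
have sub_verts : {subset vtx m.+1 <= vtx m} by move=> i; rewrite vertsE inE => ->; rewrite orbT.
have hsz : (size gs + n.+1 <= l)%N.
  have := hfr; rewrite vertsE => /(frameC_size _); rewrite -vertsE => /(_ (iota_uniq _ _)).
  by rewrite vertsE /= size_verts.
pose q1 : {poly int} := 'X^(l - size gs - n.+1) * Q.
have fsP h : h \in fs -> exists k w, [/\ h = kind_atom k m w, k = KSub \/ k = KAdd, (m < w < l)%N & P h].
  rewrite mem_cat => /orP[] /mapP[w]; rewrite mem_filter mem_verts => /andP[h1 h2] ->.
    by exists KSub, w; split=> //=; [rewrite /mkSub; case: ltnP h2; rewrite ?andbF //; lia|left].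
  by exists KAdd, w; split=> //=; [rewrite /mkAdd; case: ltnP h2; rewrite ?andbF //; lia|right].
have hinv h : icl m.+1 h -> ~~ involves m h.
  case/and3P => hv _ _; have mneq i : i \in vtx m.+1 -> (i == m) = false.
    by rewrite mem_verts => hi; apply/negbTE; lia.
  by case: h hv => [i j|i j|i|i|i] /=; [case/andP|case/andP| | |]; move=> *; rewrite ?mneq.
have hE h : (h \in fs) || icl m.+1 h = predI (not_dbl m) (icl m) h.
  apply/idP/idP => [/orP[|hh]|].
  - case/fsP => k [w [-> hk hw hP]]; apply/andP; split.
      by case: hk => -> /=; rewrite /mkSub /mkAdd; case: ifP => _; apply/eqP.
    have wm : w \in vtx m by rewrite mem_verts; lia.
    have mm : m \in vtx m by rewrite vertsE mem_head.
    by case: hk hP => -> /= hP; [apply: ideal_class_mkSub|apply: ideal_class_mkAdd] => //; lia.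
  - apply/andP; split.
      by have := hinv h hh; apply: contraNneq => -> /=.
    case/and3P: hh => hv hw hP; apply/and3P; split=> //.
    by case: h hv {hw hP} => [i j|i j|i|i|i] /=; try exact: sub_verts;
      case/andP => /sub_verts -> /sub_verts ->.
  have hm i : i \in vtx m -> i != m -> i \in vtx m.+1 by rewrite vertsE inE => /predU1P[->|//]; rewrite eqxx.
  case/andP => hnd /and3P; case: h hnd => [i j|i j|i|i|i] hnd [].
  - move=> /= /andP[hi hj] ij hP; have jm : j != m by move: hi ij; rewrite mem_verts; lia.
    have [im|im] := eqVneq i m.
      apply/orP; left; rewrite mem_cat; apply/orP; left; rewrite im; apply: map_f.
      by rewrite mem_filter; apply/andP; split; [rewrite -im|exact: hm].
    by apply/orP; right; rewrite /ideal_class /= ij hP !hm.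
  - move=> /= /andP[hi hj] ij hP; have jm : j != m by move: hi ij; rewrite mem_verts; lia.
    have [im|im] := eqVneq i m.
      apply/orP; left; rewrite mem_cat; apply/orP; right; rewrite im; apply: map_f.
      by rewrite mem_filter; apply/andP; split; [rewrite -im|exact: hm].
    by apply/orP; right; rewrite /ideal_class /= ij hP !hm.
  - by move=> _ _ /P_type.
  - by move=> _ _ /P_type.
  - move=> /= hi _ hP; apply/orP; right; rewrite /ideal_class /= hP hm //.
    by apply: contraNneq hnd => ->.
have hwf h : (h \in fs) || icl m.+1 h -> [/\ vertices_in (vtx m) h, atom_wf h & isC h].
  by rewrite hE => /andP[_ /and3P[-> -> /P_type]].
have h1 : good I gs (fun a => (a \in fs) || icl m.+1 a) (('X - (0 + (size fs)%:Z)%:P) * q1).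
  apply: (@good_fiber R l I isC _ _ _ true m) => //.
  - apply: good_eq (IHm gs (frameC_sub sub_verts hfr)) => //.
    by rewrite polyC0 subr0 /q1 [RHS]mulrA -exprS; congr ('X^_ * _); lia.
  - rewrite cat_uniq !map_inj_uniq ?filter_uniq ?iota_uniq //=; [|by move=> a b []|by move=> a b []].
    by rewrite andbT; apply/hasPn => h /mapP[w _ ->]; apply/negP => /mapP[].
  - move=> f; case/fsP => k [w [-> hk _ _]]; apply/negP => /hinv.
    by case: hk => -> /=; rewrite /mkSub /mkAdd; case: ifP => _ /=; rewrite eqxx ?orbT.
  - by move=> h /hwf[].
  - move=> f ff; have [h3 h4 h5] : [/\ vertices_in (vtx m) f, atom_wf f & isC f].
      by apply: hwf; rewrite ff.
    by split; [exact: (frameC_prim hfr h3 h4 h5)|exact: I_ratl].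
  move=> f ff; have [k [w [fE hk hw hPf]]] := fsP f ff.
  have wm : w \in vtx m.+1 by rewrite mem_verts.
  exists k, w, (icl m.+1); split=> //.
  - have hfr' : frameC (I f :: gs) (vtx m.+1).
      rewrite fE; apply: (frameC_restr hfr) => //.
      by rewrite vertsE mem_head.
    apply: good_eq (IHm (I f :: gs) hfr') => //.
    by rewrite /q1 /=; congr ('X^_ * _); lia.
  - move=> h hh hne; split; first by case: (h).
    case/orP: hh => [|hh]; last by rewrite res_atom_notinv ?hinv //= hh.
    rewrite mem_cat => /orP[] /mapP[u]; rewrite mem_filter => /andP[Pu hu] hE'.
    + have hul : (m < u < l)%N by move: hu; rewrite mem_verts.
      case: hk fE => kE fE; rewrite hE' kE /= eqxx /=.
        have fS : f = ESub m w by rewrite fE kE /= /mkSub; case: ltnP hw => //=; lia.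
        have uw : u != w by apply: contraNneq hne => uw; rewrite hE' fS uw.
        rewrite andbT; apply: ideal_class_mkSub => //; first by rewrite eq_sym.
        by rewrite /mkSub; case: ltnP => h'; [apply: (P_Sub Pu)|apply: (P_Sub (j := w) (i := m)); rewrite -?fS]; lia.
      have fA : f = EAdd m w by rewrite fE kE /= /mkAdd; case: ltnP hw => //=; lia.
      rewrite fA in hPf.
      case: (eqVneq u w) => uw /=; rewrite andbT.
        by rewrite /ideal_class /= wm; apply: (P_Add_Dbl hPf); lia.
      apply: ideal_class_mkAdd => //; first by rewrite eq_sym.
      by apply: (P_mkAdd hPf); rewrite 1?eq_sym //; lia.
    + have hul : (m < u < l)%N by move: hu; rewrite mem_verts.
      case: hk fE => kE fE; rewrite hE' kE /= eqxx /=.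
        case: (eqVneq u w) => uw /=; rewrite andbT.
          by rewrite /ideal_class /= wm; apply: (P_Add_Dbl Pu); lia.
        apply: ideal_class_mkAdd => //; first by rewrite eq_sym.
        by apply: (P_mkAdd Pu); rewrite 1?eq_sym //; lia.
      have fA : f = EAdd m w by rewrite fE kE /= /mkAdd; case: ltnP hw => //=; lia.
      have uw : u != w by apply: contraNneq hne => uw; rewrite hE' fA uw.
      rewrite andbT; apply: ideal_class_mkSub => //; first by rewrite eq_sym.
      by rewrite /mkSub; case: ltnP => h'; apply: (P_Add_Sub Pu); lia.
  - move=> t tS; split; last by exists t => //; rewrite res_atom_notinv ?hinv // mem_head.
    by case/and3P: tS => _ _ /P_type.
by apply: good_eq h1 => //; rewrite add0r.
Qed.

(* Traces of the hyperplanes on [2 * e_m = 0], in the coordinates [e_i - e_m]. *)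
Definition dbl_trace m h :=
  match h with
  | ESub i j | EAdd i j => if i == m then [:: EOne j] else [:: h]
  | EDbl i => [:: EOne i; ENeg i]
  | _ => [::]
  end.

Lemma splits_dbl_trace m h : isC h -> h != EDbl m ->
  splits (I (EDbl m)) (I h) (map (atomB (fun j => - I (ESub m j))) (dbl_trace m h)).
Proof.
move=> hC hm.
have hval th : exists a, (forall h, isC h -> ev (I h) th = atom_val a h) /\
    (forall t, ev (atomB (fun j => - I (ESub m j)) t) th = atom_val (fun j => a j - a m) t).
  have [a ha] := I_valued th; exists a; split=> // t.
  have [b hb] := valued_atomB (fun j => - I (ESub m j)) th.
  have ab j : b j = a j - a m.
    by have := hb (EOne j) isT; rewrite /= evN (ha (ESub m j)) //= opprB => <-.
  by rewrite hb //; case: t => [i j|i j|i|i|i] /=; rewrite !ab.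
split=> [th|].
  have [a [ha hb]] := hval th; rewrite !ha // has_map => /= h2.
  rewrite (eq_has (a2 := fun t => atom_val (fun j => a j - a m) t \is a Num.int)); last by move=> t; rewrite /= hb.
  case: h hC hm => [i j|i j|//|//|i] _ hm /=.
  - case: (eqVneq i m) => [->|im] /=; rewrite orbF; first by rewrite -rpredN opprB.
    by rewrite (_ : a i - a m - _ = a i - a j) //; ring.
  - case: (eqVneq i m) => [->|im] /=; rewrite orbF; apply: intB_eq.
      by rewrite (_ : _ - _ = a m *+ 2) //; ring.
    by rewrite (_ : _ - _ = a m *+ 2) //; ring.
  - rewrite orbF -int_double; apply: intB_eq.
    by rewrite (_ : _ - _ = a m *+ 2) //; ring.
exists 2%N => // _ /mapP[t tt ->] th; have [a [ha hb]] := hval th; rewrite !ha // hb => /= h2.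
case: h hC hm tt => [i j|i j|//|//|i] _ hm /=.
- case: (eqVneq i m) => [->|im]; rewrite inE => /eqP -> /= h; rewrite rpredM ?natr_int //.
    by rewrite -opprB rpredN.
  by rewrite (_ : _ - _ = a i - a j) //; ring.
- case: (eqVneq i m) => [->|im]; rewrite inE => /eqP -> /= h; rewrite rpredM ?natr_int //.
    by rewrite (_ : _ - _ = a m + a j - a m *+ 2) ?rpredB //; ring.
  by rewrite (_ : _ + _ = a i + a j - a m *+ 2) ?rpredB //; ring.
- rewrite !inE => /orP[] /eqP -> /= h.
    by rewrite (_ : _ * _ = a i *+ 2 - a m *+ 2) ?rpredB //; ring.
  rewrite (_ : _ * _ = a i *+ 2 - a m *+ 2 + (2^-1 + 2^-1)); last by ring.
  by rewrite half_add_half rpredD ?rpredB ?rpred1.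
Qed.

(** The roots [2, 4, ..., 2 (n - 1)] and [n] of the full type C arrangement on [n] vertices. *)
Definition full_poly n : {poly int} :=
  (\prod_(1 <= k < n) ('X - ((k + k)%N%:Z)%:P)) * ('X - (n%:Z)%:P).

Lemma idealC_good n m : (m + n = l)%N -> exists Q : {poly int},
  [/\ n = 0%N -> Q = 1, (0 < n)%N -> P (EDbl m) -> Q = full_poly n &
   forall gs, frameC gs (vtx m) -> good I gs (icl m) ('X^(l - size gs - n) * Q)].
Proof.
elim: n m => [|n IH] m mn.
  exists 1; split=> // gs hfr; rewrite mulr1 subn0; apply: good_nil; last by case: hfr.
    have h0 i : (i \in vtx m) = false by rewrite mem_verts; lia.
    by move=> [i j|i j|i|i|i]; rewrite /ideal_class /= h0.
  exact: frameC_gs_prim hfr.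
have [Q [Q0 Qfull IHm]] := IH m.+1 (etrans (addSnnS m n) mn).
have [d [hd hgood]] := fiberC mn IHm.
have vertsE : vtx m = m :: vtx m.+1 by rewrite /verts (_ : (l - m = (l - m.+1).+1)%N) //; lia.
have size_verts : size (vtx m.+1) = n by rewrite size_iota; lia.
have mW : m \notin vtx m.+1 by rewrite mem_verts ltnn.
have mm : m \in vtx m by rewrite vertsE mem_head.
have sub_verts : {subset vtx m.+1 <= vtx m} by move=> i; rewrite vertsE inE => ->; rewrite orbT.
have [Pm|Pm] := boolP (P (EDbl m)); last first.
  exists (('X - (d%:Z)%:P) * Q); split=> // gs hfr.
  apply: good_eq (hgood gs hfr) => [h|]; last by rewrite mulrCA.
  rewrite /= /not_dbl; case: eqVneq => //= ->; apply/esym/negbTE/negP => /and3P[_ _ hP].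
  by rewrite hP in Pm.
pose q2 : {poly int} := \prod_(1 <= k < n.+1) ('X - ((k + k)%N%:Z)%:P).
(* With [EDbl m] all later roots are present, so [Q] is [full_poly n] and [d = 2n] completes the
   even roots; what is left over is the restriction polynomial [q2] times the factor of root [n]. *)
have QE : ('X - (d%:Z)%:P) * Q = ('X - (n%:Z)%:P) * q2.
  rewrite hd // /q2; case: (posnP n) => [n0|n0].
    by rewrite Q0 // n0 big_geq.
  rewrite (Qfull n0); last by apply: (P_Dbl Pm); lia.
  by rewrite big_nat_recr //= /full_poly; ring.
exists (('X - (n.+1%:Z)%:P) * q2); split=> // [_ _|gs hfr]; first by rewrite /full_poly mulrC.
pose G : rel nat := fun _ _ => true.
pose y j := - I (ESub m j).
have hfr2 : frame (I (EDbl m) :: gs) (vtx m.+1) y by exact: (frameC_frame hfr).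
have h2 : good (atomB y) (I (EDbl m) :: gs) (loop_class G (vtx m.+1) (vtx m.+1)) ('X^(l - size gs - n.+1) * q2).
  case: (posnP n) => [n0|n0].
    have v0 : vtx m.+1 = [::] by apply: size0nil; rewrite size_verts.
    have hnil a : loop_class G (vtx m.+1) (vtx m.+1) a = false by rewrite v0; case: a.
    apply: good_eq (good_nil (atomB y) hnil (frame_prim hfr2) (frame_ratl hfr2)) => //.
    by rewrite /q2 n0 big_geq // mulr1 /=; congr 'X^_; lia.
  have Gs : symmetric G by [].
  have := @loop_class_good R l G Gs (fun _ _ _ _ _ _ => isT) (vtx m.+1) (vtx m.+1).
  rewrite size_verts => /(_ n0 (iota_ltn_sorted _ _) (fun _ _ _ _ _ _ => isT)) H.
  apply: good_eq (H _ _ hfr2) => //; rewrite loop_poly_complete ?iota_uniq // size_verts.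
  rewrite (_ : count _ _ = n); last by apply/eqP; rewrite -[X in _ == X]size_verts -all_count; apply/allP.
  by rewrite /q2 big_nat_recr //= ; congr ('X^_ * _); lia.
have [s2 [us2 hs2 hi2]] := h2.
have S0P h : predI (not_dbl m) (icl m) h -> isC h /\ h != EDbl m by case/andP => ? /and3P[_ _ /P_type].
have h3 : good I gs (fun a => (a \in [:: EDbl m]) || predI (not_dbl m) (icl m) a)
    (('X - (n%:Z + (size [:: EDbl m])%:Z)%:P) * ('X^(l - size gs - n.+1) * q2)).
  apply: good_chain => //.
  - by apply: good_eq (hgood gs hfr) => //; rewrite mulrCA QE mulrCA.
  - by move=> f; rewrite inE => /eqP ->; rewrite /= /not_dbl eqxx.
  - by move=> f; rewrite inE => /eqP ->; split; [apply: (frameC_prim hfr)|exact: I_ratl].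
  move=> f; rewrite inE => /eqP ->.
  exists (map (atomB y) s2), (fun h => map (atomB y) (dbl_trace m h)); split=> //.
    move=> h hh hne; have {hh} hh : predI (not_dbl m) (icl m) h.
      by move: hh; rewrite inE (negbTE hne).
    have [hC _] := S0P h hh; split; first exact: splits_dbl_trace.
    have hm i : i \in vtx m -> i != m -> i \in vtx m.+1 by rewrite vertsE inE => /predU1P[->|//]; rewrite eqxx.
    move=> _ /mapP[t tt ->]; apply: map_f; rewrite hs2.
    case/andP: hh => _ /and3P[]; case: h hC hne tt => [i j|i j|//|//|i] _ hne /=.
    + case: (eqVneq i m) => [->|im]; rewrite inE => /eqP -> /andP[hi hj] ij _.
        by rewrite unfold_in /= hm //; apply/eqP => jm; rewrite jm ltnn in ij.
      rewrite unfold_in /= ij !hm //; apply/eqP => jm.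
      by move: hi ij; rewrite jm mem_verts; lia.
    + case: (eqVneq i m) => [->|im]; rewrite inE => /eqP -> /andP[hi hj] ij _.
        by rewrite unfold_in /= hm //; apply/eqP => jm; rewrite jm ltnn in ij.
      rewrite unfold_in /= ij !hm //; apply/eqP => jm.
      by move: hi ij; rewrite jm mem_verts; lia.
    + have im : i != m by apply: contraNneq hne => ->.
      by rewrite !inE => /orP[] /eqP -> hi _ _; rewrite unfold_in /= !hm.
  have mltW i : i \in vtx m.+1 -> (m < i < l)%N by rewrite mem_verts.
  move=> _ /mapP[t + ->]; rewrite hs2 unfold_in.
  have key h : icl m h -> h != EDbl m -> t \in dbl_trace m h ->
      exists2 h, predI (not_dbl m) (icl m) h & atomB y t \in map (atomB y) (dbl_trace m h).
    by move=> h4 h5 h6; exists h; [apply/andP|apply: map_f].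
  (* Edges avoiding [m] are their own traces; [y_i = 0] comes from [e_m - e_i], and [y_i = 1/2] from
     [2 e_i]. *)
  case: t key => [i j|i j|i|i|//] key /=.
  - case/and3P => hi hj ij; apply: (key (ESub i j)).
    + rewrite /ideal_class /= !sub_verts // ij; apply: (P_Dbl_Sub Pm).
        by have := mltW _ hi; lia.
      by have := mltW _ hj; lia.
    + by apply/eqP.
    + by rewrite /= ifF ?mem_head //; apply/eqP => im; move: mW; rewrite -{1}im hi.
  - case/and4P => hi hj ij _; apply: (key (EAdd i j)).
    + rewrite /ideal_class /= !sub_verts // ij; apply: (P_Dbl_Add Pm).
        by have := mltW _ hi; lia.
      by have := mltW _ hj; lia.
    + by apply/eqP.
    + by rewrite /= ifF ?mem_head //; apply/eqP => im; move: mW; rewrite -{1}im hi.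
  - move=> hi; apply: (key (ESub m i)).
    + rewrite /ideal_class /= mm sub_verts //=; have := mltW _ hi => hlt.
      by rewrite (_ : (m < i)%N); [apply: (P_Dbl_Sub Pm); lia|lia].
    + by apply/eqP.
    + by rewrite /= eqxx mem_head.
  - case/andP => hi _; apply: (key (EDbl i)).
    + by rewrite /ideal_class /= sub_verts //=; apply: (P_Dbl Pm); have := mltW _ hi; lia.
    + by apply/eqP => -[im]; move: mW; rewrite -{1}im hi.
    + by rewrite /= !inE eqxx orbT.
apply: good_eq h3 => [h|].
  rewrite inE /= /not_dbl; case: eqVneq => //= ->.
  by rewrite /ideal_class /= mm Pm.
by rewrite -PoszD addn1 mulrCA.
Qed.

End IdealC.

(** * Roots in coordinates *)

Section Roots.
Variables (t : RType) (l : nat).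

(** The fundamental coweight dual to the [k]-th simple root, up to a factor 2 at the last index of
    type C: it reads off coefficients. *)
Definition psum n (k : nat) (v : 'rV[int]_n) : int := \sum_(j < n | (j <= k)%N) v 0 j.

Lemma psumD n k (u v : 'rV[int]_n) : psum k (u + v) = psum k u + psum k v.
Proof. by rewrite /psum -big_split; apply: eq_bigr => j _; rewrite mxE. Qed.

Lemma psumN n k (u : 'rV[int]_n) : psum k (- u) = - psum k u.
Proof. by rewrite /psum -sumrN; apply: eq_bigr => j _; rewrite mxE. Qed.

Lemma psumZ n k (c : int) (u : 'rV[int]_n) : psum k (c *: u) = c * psum k u.
Proof. by rewrite /psum mulr_sumr; apply: eq_bigr => j _; rewrite mxE. Qed.

Lemma psum_sum n k m (F : 'I_m -> 'rV[int]_n) : psum k (\sum_i F i) = \sum_i psum k (F i).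
Proof.
by rewrite /psum [RHS]exchange_big; apply: eq_bigr => j _; rewrite summxE.
Qed.

Lemma psum_evec n k i : (i < n)%N -> psum k (evec n i) = (i <= k)%N%:Z.
Proof.
move=> hi; rewrite /psum; have [ik|ki] := leqP i k.
  rewrite (bigD1 (Ordinal hi)) //= big1 ?addr0 => [|j /andP[_ hj]]; first by rewrite mxE eqxx.
  by rewrite mxE; case: eqP => // e; case/eqP: hj; apply: val_inj.
by rewrite big1 // => j hj; rewrite mxE; case: eqP => // e; lia.
Qed.

Lemma psum_inj n (u v : 'rV[int]_n) : (forall k, (k < n)%N -> psum k u = psum k v) -> u = v.
Proof.
move=> h; apply/rowP => -[k hk].
have e (w : 'rV[int]_n) : psum k w = w 0 (Ordinal hk) + (if k is k'.+1 then psum k' w else 0).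
  rewrite /psum (bigD1 (Ordinal hk)) //=; congr (_ + _).
  have P (j : 'I_n) : ((j <= k)%N && (j != Ordinal hk)) = (j < k)%N.
    by rewrite [in RHS]ltn_neqAle andbC.
  rewrite (eq_bigl _ _ P); case: (k) => [|k']; first by rewrite big_pred0.
  by apply: eq_bigl => j; rewrite ltnS.
have := h k hk; rewrite !e; case: k hk e => [|k'] hk e; first by rewrite !addr0.
by rewrite (h k') ?(ltnW hk) // => /addIr.
Qed.

Definition is_last k := if t is TC then (k.+1 == l)%N else false.

Lemma psum_simple_root (i : 'I_l) k : (k < edim t l)%N ->
  psum k (simple_root t i) = (if is_last k then 2 else 1) * (i == k :> nat)%N%:Z.
Proof.
have hi := ltn_ord i; rewrite /is_last; case: t => /= hk.
- by rewrite psumD psumN !psum_evec //=; lia.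
- case: ifP => hl; rewrite ?psumD ?psumN !psum_evec //=; lia.
- case: ifP => hl; rewrite ?psumZ ?psumD ?psumN !psum_evec //=; case: eqP => h; lia.
Qed.

Lemma psum_root_of (s : 'I_l -> int) (k : nat) : (k < edim t l)%N ->
  psum k (root_of t s) = (if is_last k then 2 else 1) * (if insub k is Some i then s i else 0).
Proof.
move=> hk; rewrite /root_of psum_sum.
under eq_bigr do rewrite psumZ psum_simple_root // mulrCA.
rewrite -mulr_sumr; congr (_ * _); case: insubP => [i _ ik|hkl].
  rewrite (bigD1 i) //= big1 ?addr0; first by rewrite ik eqxx mulr1.
  by move=> j ji; rewrite -ik (inj_eq val_inj) (negbTE ji) mulr0.
by rewrite big1 // => i _; case: eqP => [ik|_]; [move: hkl; rewrite -ik ltn_ord|rewrite mulr0].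
Qed.

(** Coefficients in the simple roots. As the last simple root of type C is [2 e_l], the partial sum
    2 of [EAdd] or [EDbl] there is halved, which is written as subtracting 1. *)
Definition cv h k : int :=
  match h with
  | ESub i j => (i <= k)%N%:Z - (j <= k)%N%:Z
  | EAdd i j => (i <= k)%N%:Z + (j <= k)%N%:Z - (is_last k)%:Z
  | EOne i => (i <= k)%N%:Z
  | ENeg _ => 0
  | EDbl i => (i <= k)%N%:Z + (i <= k)%N%:Z - (is_last k)%:Z
  end.

Definition cvf h (k : 'I_l) := cv h k.

Definition eps h : 'rV[int]_(edim t l) :=
  match h with
  | ESub i j => evec _ i - evec _ j
  | EAdd i j => evec _ i + evec _ j
  | EOne i => if t is TA then evec _ i - evec _ l else evec _ i
  | ENeg _ => 0
  | EDbl i => 2 *: evec _ i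
  end.

Definition valid h :=
  match h with
  | ESub i j => (i < j < l)%N
  | EAdd i j => if t is TA then false else (i < j < l)%N
  | EOne i => if t is TC then false else (i < l)%N
  | ENeg _ => false
  | EDbl i => if t is TC then (i < l)%N else false
  end.

Lemma root_of_cvf h : valid h -> root_of t (cvf h) = eps h.
Proof.
move=> hv; apply: psum_inj => k hk; rewrite psum_root_of // /cvf.
have -> : (if insub k is Some i then cv h (nat_of_ord (i : 'I_l)) else 0) =
    if (k < l)%N then cv h k else 0.
  by case: insubP => [i -> ->//|/negbTE ->].
move: hv hk; rewrite /valid /eps /cv /is_last; case: t => /=.
all: case: h => [i j|i j|i|i|i] //= hv hk; rewrite ?psumZ ?psumD ?psumN !psum_evec //=; try lia.
all: by case: ifP => h1; try case: ifP => h2; lia.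
Qed.

Lemma cvf_inj_root s h : valid h -> root_of t s = eps h -> s = cvf h.
Proof.
move=> hv; rewrite -root_of_cvf // => e; apply: funext => i.
have hi : (i < edim t l)%N by have := ltn_ord i; case: (t) => /=; lia.
have := congr1 (psum i) e; rewrite !psum_root_of //.
have -> : insub (i : nat) = Some i by exact: valK.
by case: ifP => _; [move/mulfI; apply|rewrite !mul1r].
Qed.

Lemma PhiPlusP s : @PhiPlus t l s <-> exists2 h, valid h & s = cvf h.
Proof.
split; last first.
  case=> h hv ->; rewrite /PhiPlus /= /pos_root_eps root_of_cvf //.
  rewrite /eps; move: hv; rewrite /valid; case: t => /=; case: h => [i j|i j|i|i|i] //= hv.
  - by left; exists i, j; split=> //; lia.
  - by left; exists i, l; split=> //; lia.
  - by left; exists i, j; split=> //; lia.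
  - by right; left; split=> //; exists i, j.
  - by right; right; left; split=> //; exists i.
  - by left; exists i, j; split=> //; lia.
  - by right; left; split=> //; exists i, j.
  - by right; right; right; split=> //; exists i.
rewrite /PhiPlus /= /pos_root_eps.
case=> [[i [j [hij e]]]|[[tA [i [j [hij e]]]]|[[tB [i [hi e]]]|[tC [i [hi e]]]]]].
- have [hjl|hjl] := ltnP j l.
    have hv : valid (ESub i j) by rewrite /valid; lia.
    by exists (ESub i j) => //; apply: cvf_inj_root.
  have [tA jl] : t = TA /\ j = l by move: hij; case: (t) => /= h; split=> //; lia.
  have hv : valid (EOne i) by rewrite /valid tA; lia.
  by exists (EOne i) => //; apply: cvf_inj_root => //; rewrite e /eps tA jl.
- have hv : valid (EAdd i j) by rewrite /valid; move: tA; case: (t).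
  by exists (EAdd i j) => //; apply: cvf_inj_root.
- have hv : valid (EOne i) by rewrite /valid tB.
  by exists (EOne i) => //; apply: cvf_inj_root => //; rewrite e /eps tB.
- have hv : valid (EDbl i) by rewrite /valid tC.
  by exists (EDbl i) => //; apply: cvf_inj_root => //; rewrite e /eps.
Qed.

End Roots.

(** * From an ideal to a list of atoms *)

Section Final.
Variables (R : realType) (t : RType) (l : nat).
Notation aff := ('rV[int]_l * R)%type.
Notation cvf := (@cvf t l).
Notation valid := (valid t l).
Variable I : set ('I_l -> int).
Hypothesis hI : is_ideal t I.

Definition in_ideal h := valid h && `[< I (cvf h) >].

Lemma in_ideal_le h h' : in_ideal h -> valid h' ->
  (forall k, (k < l)%N -> cv t l h' k <= cv t l h k) -> in_ideal h'.
Proof.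
move=> /andP[hv /asboolP Ih] hv' hle; rewrite /in_ideal hv' /=; apply/asboolP.
apply: (hI.2 _ _ Ih); first by apply/PhiPlusP; exists h'.
by move=> i; apply: hle.
Qed.

Definition root_aff h : aff := (\row_k cvf h k, 0).

(** Primitivity makes each [Hset] connected, so it is its own only component. *)
Lemma toric_arr_Arr (Ih : atom -> aff) (s : seq atom) :
  (forall h, (h \in s) = in_ideal h) ->
  (forall h, h \in s -> Ih h = root_aff h /\ prim [:: Ih h]) ->
  @toric_arr R l I = Arr [::] (map Ih s).
Proof.
move=> hs hIh; have HZ h : h \in s -> Hset (cvf h) (cone R) = Zs [:: Ih h].
  move=> /hIh[-> _]; apply/seteqP; split=> p.
    case=> /torusP[th ->]; rewrite charv_ex => /e1_eq1 hint; apply/Zs_ex => g.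
    rewrite inE => /eqP ->; rewrite /ev addr0 /lin.
    by rewrite (eq_bigr (fun i => (cvf h i)%:~R * th 0 i)) // => i _; rewrite mxE.
  case=> th -> /(_ _ (mem_head _ _)); rewrite /ev addr0 => hint.
  split; first exact: torus_ex.
  rewrite charv_ex -e10; apply/e1_eq; rewrite subr0.
  by move: hint; rewrite /lin; under eq_bigr do rewrite mxE.
apply/seteqP; split=> K.
  case=> b [Ib [p hp <-]]; have [h hv bE] := iffLR (PhiPlusP t b) (hI.1 _ Ib).
  have hh : h \in s by rewrite hs /in_ideal hv -bE; apply/asboolP.
  exists (Ih h); first exact: map_f.
  rewrite bE HZ // in hp *; apply: connected_component_id => //.
  by apply: prim_connected; have [] := hIh h hh.
case=> _ /mapP[h hh ->] ->; exists (cvf h).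
have := hh; rewrite hs => /andP[_ /asboolP Ih']; split=> //.
have [_ hp] := hIh h hh; have [p Zp] := prim_nonempty hp.
exists p; rewrite HZ //; apply: connected_component_id => //; exact: prim_connected.
Qed.

Lemma good_toric_arr (Ih : atom -> aff) q : good Ih [::] (ideal_class l in_ideal 0) q ->
  (forall h, in_ideal h -> Ih h = root_aff h) -> Ind (@torus R l) (@toric_arr R l I).
Proof.
case=> s [us hs [[_ hprim _] hind _]] hIh.
have hs' h : (h \in s) = in_ideal h.
  rewrite hs unfold_in /ideal_class; case: (boolP (in_ideal h)); rewrite ?andbF // => /andP[hv _].
  have mv i : (i \in verts l 0) = (i < l)%N by rewrite mem_verts.
  rewrite andbT; case: h hv => [i j|i j|i|i|i]; rewrite /valid /= ?mv; case: (t) => //; lia.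
rewrite -Zs_nil (@toric_arr_Arr Ih s) // => h hh; split.
  by apply: hIh; rewrite -hs'.
by apply: hprim; exact: map_f.
Qed.

End Final.

(** * The simple-root coordinates of the torus as frames *)

Section Coordinates.
Variables (R : realType) (l : nat).
Notation aff := ('rV[int]_l * R)%type.

Lemma exists_tails (u : nat -> int) : exists x : 'rV[int]_l,
  forall i, (i < l)%N -> \sum_(k < l) (i <= k)%N%:Z * x 0 k = u i.
Proof.
(* Truncated at [l], so that the tail sum of differences telescopes to [u i]. *)
pose v k := if (k < l)%N then u k else 0.
exists (\row_k (v k - v k.+1)) => i hi.
under eq_bigr do rewrite mxE.
rewrite -(big_mkord xpredT (fun k => (i <= k)%N%:Z * (v k - v k.+1))).
rewrite (big_cat_nat _ (n := i)) ?(ltnW hi) //= big_nat big1 ?add0r => [|k /andP[_ ki]]; last first.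
  by rewrite leqNgt ki mul0r.
have -> : u i = - v l - - v i by rewrite /v ltnn hi oppr0 sub0r opprK.
rewrite -(telescope_sumr (fun k => - v k) (ltnW hi)) big_nat [RHS]big_nat; apply: eq_bigr => k /andP[ik _].
by rewrite ik mul1r opprK addrC.
Qed.

(** The sum of the simple roots from [i] on: [e_i] in type B, and [e_i] minus the last basis vector
    in type A. *)
Definition tail_aff (i : nat) : aff := (\row_k (i <= k)%N%:Z, 0).

Lemma idot_tail i (x : 'rV[int]_l) : idot (tail_aff i).1 x = \sum_(k < l) (i <= k)%N%:Z * x 0 k.
Proof. by apply: eq_bigr => k _; rewrite mxE. Qed.

Lemma mem_verts0 i : (i \in verts l 0) = (i < l)%N.
Proof. by rewrite mem_verts. Qed.

Lemma frame_tail : frame [::] (verts l 0) tail_aff.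
Proof.
split=> [ks u /size0nil ->|//|i _].
  have [x hx] := exists_tails u; exists x; split=> // i; rewrite mem_verts0 => /hx <-.
  exact: idot_tail.
by apply/ratl1; rewrite /= mulr0 rpred0.
Qed.

Lemma root_aff_ratl t h : ratl 2 [:: root_aff R t l h].
Proof. by apply/ratl1; rewrite /= mulr0 rpred0. Qed.

Lemma root_aff_valued : valued (root_aff R TC l) isC.
Proof.
move=> th; pose B : R := \sum_(k < l) (is_last TC l k)%:R * th 0 k.
pose A i : R := \sum_(k < l) (i <= k)%N%:R * th 0 k.
(* [B] is the angle of the last simple root [2 e_l], which enters [e_i] with coefficient one half
   but the tail sum [A i] with coefficient one. *)
exists (fun i => A i - B / 2) => -[i j|i j|//|//|i] _; rewrite /ev addr0 /lin /=.
- rewrite opprB addrA subrK /A -sumrB; apply: eq_bigr => k _.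
  by rewrite mxE /cvf /cv rmorphB mulrBl.
- rewrite (_ : _ + _ = A i + A j - B); last by field.
  rewrite /A /B -big_split -sumrB; apply: eq_bigr => k _ /=.
  by rewrite mxE /cvf /cv rmorphB rmorphD !mulrDl mulNr.
- rewrite (_ : _ *+ 2 = A i + A i - B); last by field.
  rewrite /A /B -big_split -sumrB; apply: eq_bigr => k _ /=.
  by rewrite mxE /cvf /cv rmorphB rmorphD !mulrDl mulNr.
Qed.

Lemma idot_root_aff h (x : 'rV[int]_l) : (0 < l)%N -> isC h ->
  let s i := \sum_(k < l) (i <= k)%N%:Z * x 0 k in
  idot (root_aff R TC l h).1 x = match h with
    | ESub i j => s i - s j | EAdd i j => s i + s j - s l.-1 | EDbl i => s i + s i - s l.-1 | _ => 0 end.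
Proof.
move=> l0 hC s; have hB : s l.-1 = \sum_(k < l) (is_last TC l k)%:Z * x 0 k.
  by apply: eq_bigr => k _; congr (_%:Z * _); have := ltn_ord k; rewrite /is_last; lia.
case: h hC => [i j|i j|//|//|i] _; rewrite ?hB /idot /s -?big_split -?sumrB; apply: eq_bigr => k _;
  by rewrite mxE /cvf /cv /= ?mulrDl ?mulNr.
Qed.

Lemma frameC_root_aff : (0 < l)%N -> frameC (root_aff R TC l) [::] (verts l 0).
Proof.
move=> l0; split=> // ks u c /size0nil ->.
(* With these tail sums [s], the combination [s i + s j - s l.-1] equals [u i + u j + c]. *)
have [x hx] := exists_tails (fun i => u i + (c + u l.-1)).
have hl : (l.-1 < l)%N by lia.
exists x; split=> // [i j|i j|i]; rewrite ?mem_verts0 => hi; try move=> hj;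
  rewrite idot_root_aff //= ?hx //; ring.
Qed.

End Coordinates.

Theorem theorem1p4 (R : realType) (t : RType) (l : nat) (hl : rank_ok t l)
    (I : set ('I_l -> int)) (hI : is_ideal t I) :
  Ind (@torus R l) (@toric_arr R l I).
Proof.
have l0 : (0 < l)%N by move: hl; case: (t) => /=; lia.
have hle h h' := @in_ideal_le t l I hI h h'.
have Pv h : in_ideal t I h -> valid t l h by case/andP.
have [tC|tC] := pselect (t = TC).
  (* The closure properties below are pointwise comparisons of the coefficients [cv]. *)
  subst t; set P := in_ideal TC I in hle Pv.
  have P_Sub i j i' j' : P (ESub i j) -> (i <= i' < j')%N -> (j' <= j)%N -> (j < l)%N -> P (ESub i' j').
    by move=> hP h1 h2 h3; apply: (hle _ _ hP) => /=; [lia|move=> k hk; lia].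
  have P_Add i j i' j' : P (EAdd i j) -> (i < j < l)%N -> (i <= i' < j')%N -> (j <= j' < l)%N ->
      P (EAdd i' j').
    by move=> hP h1 h2 h3; apply: (hle _ _ hP) => /=; [lia|move=> k hk; lia].
  have P_Add_Sub i j i' j' : P (EAdd i j) -> (i < j < l)%N -> (i <= i' < j')%N -> (j' < l)%N ->
      P (ESub i' j').
    by move=> hP h1 h2 h3; apply: (hle _ _ hP) => /=; [lia|move=> k hk; lia].
  have P_Add_Dbl i j j' : P (EAdd i j) -> (i < j < l)%N -> (j <= j' < l)%N -> P (EDbl j').
    by move=> hP h1 h2; apply: (hle _ _ hP) => /=; [lia|move=> k hk; lia].
  have P_Dbl i i' : P (EDbl i) -> (i <= i' < l)%N -> P (EDbl i').
    by move=> hP h1; apply: (hle _ _ hP) => /=; [lia|move=> k hk; lia].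
  have P_Dbl_Sub i i' j' : P (EDbl i) -> (i <= i' < j')%N -> (j' < l)%N -> P (ESub i' j').
    by move=> hP h1 h2; apply: (hle _ _ hP) => /=; [lia|move=> k hk; lia].
  have P_Dbl_Add i i' j' : P (EDbl i) -> (i <= i' < j')%N -> (j' < l)%N -> P (EAdd i' j').
    by move=> hP h1 h2; apply: (hle _ _ hP) => /=; [lia|move=> k hk; lia].
  have P_type h : P h -> isC h by move/Pv; case: h.
  have [Q [_ _ hQ]] := @idealC_good R l _ (@root_aff_valued R l) (fun h => @root_aff_ratl R l TC h) P
    P_type P_Sub P_Add P_Add_Sub P_Add_Dbl P_Dbl P_Dbl_Sub P_Dbl_Add l 0 erefl.
  by apply: (good_toric_arr hI (hQ _ (@frameC_root_aff R l l0))).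
set P := in_ideal t I in hle Pv.
have nolast k : is_last t l k = false by move: tC; rewrite /is_last; case: (t).
have P_type h : P h -> if h is ENeg _ then false else notDbl h.
  by move/Pv; move: tC; case: (t) => // _; case: h.
have P_Sub i j i' j' : P (ESub i j) -> (i <= i' < j')%N -> (j' <= j)%N -> (j < l)%N -> P (ESub i' j').
  by move=> hP h1 h2 h3; apply: (hle _ _ hP) => /=; [lia|move=> k hk; lia].
have P_One i i' : P (EOne i) -> (i <= i' < l)%N -> P (EOne i').
  move=> hP h1; apply: (hle _ _ hP) => /=; last by move=> k hk; lia.
  by move: tC; case: (t) => //; lia.
have P_One_Sub i i' j' : P (EOne i) -> (i <= i' < j')%N -> (j' < l)%N -> P (ESub i' j').
  by move=> hP h1 h2; apply: (hle _ _ hP) => /=; [lia|move=> k hk; lia].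
have P_Add i j i' j' : P (EAdd i j) -> (i < j < l)%N -> (i <= i' < j')%N -> (j <= j' < l)%N ->
    P (EAdd i' j').
  move=> hP h1 h2 h3; apply: (hle _ _ hP) => /=; last by move=> k hk; lia.
  by move: (Pv _ hP) => /=; case: (t) => //; lia.
have P_Add_One i j : P (EAdd i j) -> (i < j < l)%N -> P (EOne i).
  move=> hP h1; apply: (hle _ _ hP) => /=; last by move=> k hk; rewrite nolast; lia.
  by move: tC; case: (t) => //; lia.
have [Q hQ] := @ideal_good R l P P_type P_Sub P_One P_One_Sub P_Add P_Add_One l 0 erefl.
apply: (good_toric_arr hI (hQ _ _ (@frame_tail R l))).
move=> h /Pv; rewrite /root_aff => hv; rewrite [LHS]surjective_pairing; congr (_, _).
  apply/rowP => k; rewrite mxE /cvf /cv nolast.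
  by case: h hv => [i j|i j|i|i|i] //= hv; rewrite !mxE ?subr0 //; move: tC hv; case: (t).
by case: h hv => [i j|i j|i|i|i] //= hv; rewrite ?subr0 ?addr0 //; move: tC hv; case: (t).
Qed.
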